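(* Let $N$ be a positive integer and suppose that $k\in\frac12+\mathbb Z$. Then there is no nonzero harmonic weak Maass form $g\in H_{2-k}(\Gamma_0(4N))$ such that $g^+=0$.
   Context: Conventions. $\mathbb H$ is the upper half plane, $z=x+iy$. Every complex power uses $z=|z|e^{i\arg z}$ with $-\pi<\arg z\le\pi$. $\theta(z)=1+2\sum_{n\ge1}e^{2\pi i n^2z}$, $\chi_\theta(\gamma)=\theta(\gamma z)/((cz+d)^{1/2}\theta(z))$ for $\gamma=\begin{pmatrix}a&b\\c&d\end{pmatrix}\in\Gamma_0(4)$. Slash operator: $(h|_\kappa\gamma)(z)=\overline{\chi_\theta(\gamma)}^{2\kappa}(cz+d)^{-\kappa}h(\gamma z)$ for $\gamma\in\Gamma_0(4N)$. Harmonic weak Maass forms. $H_\kappa(\Gamma_0(4N))$ is the space of smooth $h:\mathbb H\to\mathbb C$ with $h|_\kappa\gamma=h$ for all $\gamma\in\Gamma_0(4N)$, $\Delta_\kappa h=0$ where $\Delta_\kappa=-y^2(\partial_x^2+\partial_y^2)+i\kappa y(\partial_x+i\partial_y)$, and such that for some $\delta>0$, $(cz+d)^{-\kappa}h(\gamma z)=O(e^{\delta y})$ as $y\to\infty$ uniformly in $x$ for every $\gamma=\begin{pmatrix}a&b\\c&d\end{pmatrix}\in\mathrm{SL}_2(\mathbb Z)$. Such $h$ decomposes uniquely as $h=h^++h^-$ with $h^+(z)=\sum_{n\gg-\infty}a^+(n)e^{2\pi i n z}$ (the holomorphic part) and $h^-(z)=\sum_{n\ne0}a^-(n)B_\kappa(2\pi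 ny)e^{2\pi i n x}+a^-(0)c(y)$ (the nonholomorphic part), where $B_\kappa(x)=e^{-x}\int_{-2x}^\infty e^{-t}t^{-\kappa}dt$ (convergent for $\kappa<1$, holomorphically continued in $\kappa$ for $x\neq0$ as for the gamma function, with the branch convention $-\pi<\arg\le\pi$ for complex powers), $c(y)=\log y$ if $\kappa=1$ and $c(y)=y^{1-\kappa}$ otherwise. *)

(* Defs.v *)
(* Stdlib real numbers with Coquelicot.  A function on the upper half plane is
   a map [C -> C] whose values off the upper half plane are never used. *)
From Stdlib Require Import Reals ZArith.
From Coquelicot Require Import Coquelicot.
Open Scope C_scope.

Definition Cexp (z : C) : C :=
  RtoC (exp (Re z)) * (cos (Im z), sin (Im z)).

(* For [z <> 0] the value lies in (-PI, PI], with [Carg z = PI] on the negative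
   real axis.  [Carg 0] is meaningless, and so is [Cpowc 0 s]. *)
Definition Carg (z : C) : R :=
  if Rle_dec 0 (Im z) then acos (Re z / Cmod z) else (- acos (Re z / Cmod z))%R.

Definition Clog (z : C) : C := (ln (Cmod z), Carg z).

Definition Cpowc (z s : C) : C := Cexp (s * Clog z).

Definition upper_half_plane (z : C) : Prop := (0 < Im z)%R.

(* e^{2 pi i n z} *)
Definition qexp (n : Z) (z : C) : C := Cexp (RtoC (2 * PI * IZR n) * Ci * z).

Definition CSeries (a : nat -> C) : C :=
  (Series (fun n => Re (a n)), Series (fun n => Im (a n))).

Definition theta (z : C) : C :=
  1 + 2 * CSeries (fun n => qexp (Z.of_nat (S n) * Z.of_nat (S n)) z).

Record mat2 : Set := Mat2 { ma : Z; mb : Z; mc : Z; md : Z }.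

Definition SL2Z (g : mat2) : Prop := (ma g * md g - mb g * mc g = 1)%Z.

Definition Gamma0 (M : nat) (g : mat2) : Prop :=
  SL2Z g /\ (Z.of_nat M | mc g)%Z.

Definition autj (g : mat2) (z : C) : C := RtoC (IZR (mc g)) * z + RtoC (IZR (md g)).

Definition moebius (g : mat2) (z : C) : C :=
  (RtoC (IZR (ma g)) * z + RtoC (IZR (mb g))) / autj g z.

(* For [g] in [Gamma0 4] this does not depend on the point [z] of the upper
   half plane, by the transformation law of theta. *)
Definition chi_theta (g : mat2) (z : C) : C :=
  theta (moebius g z) / (Cpowc (autj g z) (RtoC (1 / 2)) * theta z).

Definition slash (kappa : R) (h : C -> C) (g : mat2) (z : C) : C :=
  Cpowc (Cconj (chi_theta g z)) (RtoC (2 * kappa))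
  * Cpowc (autj g z) (RtoC (- kappa)) * h (moebius g z).

Definition smooth_on_H (h : C -> C) : Prop :=
  forall (n : nat) (x y : R), (0 < y)%R ->
    ex_diff_n (fun u v => Re (h (u, v))) n x y /\
    ex_diff_n (fun u v => Im (h (u, v))) n x y.

Definition dx (h : C -> C) (z : C) : C :=
  (Derive (fun t : R => Re (h (t, Im z))) (Re z),
   Derive (fun t : R => Im (h (t, Im z))) (Re z)).

Definition dy (h : C -> C) (z : C) : C :=
  (Derive (fun t : R => Re (h (Re z, t))) (Im z),
   Derive (fun t : R => Im (h (Re z, t))) (Im z)).

Definition Laplacian (kappa : R) (h : C -> C) (z : C) : C :=
  let y := RtoC (Im z) in
  - (y * y) * (dx (dx h) z + dy (dy h) z)
  + Ci * RtoC kappa * y * (dx h z + Ci * dy h z).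

Record harmonic_weak_Maass (kappa : R) (M : nat) (h : C -> C) : Prop := {
  hwm_smooth : smooth_on_H h;
  hwm_modular : forall (g : mat2) (z : C),
    Gamma0 M g -> upper_half_plane z -> slash kappa h g z = h z;
  hwm_harmonic : forall z : C, upper_half_plane z -> Laplacian kappa h z = 0;
  hwm_growth : exists delta : R, (0 < delta)%R /\
    forall g : mat2, SL2Z g ->
    exists K Y : R, forall z : C, upper_half_plane z -> (Y <= Im z)%R ->
      (Cmod (Cpowc (autj g z) (RtoC (- kappa)) * h (moebius g z))
       <= K * exp (delta * Im z))%R
}.

(* [I] is the integral of [f] from [w] to +infinity along the real line; when
   [w < 0] it is improper at 0 as well. *)
Definition is_integral_to_infty (f : R -> C) (w : R) (I : C) : Prop :=
  ((0 < w)%R /\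
   is_RInt_gen (V := C_R_NormedModule) f (at_point w) (Rbar_locally p_infty) I)
  \/
  ((w < 0)%R /\ exists I1 I2 : C,
   is_RInt_gen (V := C_R_NormedModule) f (at_point w) (at_left 0) I1 /\
   is_RInt_gen (V := C_R_NormedModule) f (at_right 0) (Rbar_locally p_infty) I2 /\
   I = I1 + I2).

Definition entire (F : C -> C) : Prop :=
  forall s : C, ex_derive (K := C_AbsRing) (V := C_NormedModule) F s.

(* [v] is the value B_kappa(x), for [x <> 0]: for fixed [x] the integral
   e^{-x} int_{-2x}^oo e^{-t} t^{-s} dt converges on the half plane Re s < 1 and
   has a unique entire continuation in s, since the incomplete gamma function
   Gamma(a, w) is entire in a for fixed w <> 0. *)
Definition is_Bvalue (kappa : C) (x : R) (v : C) : Prop :=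
  exists F : C -> C,
    entire F /\
    (forall s : C, (Re s < 1)%R ->
       exists I : C,
         is_integral_to_infty
           (fun t : R => RtoC (exp (- t)) * Cpowc (RtoC t) (- s)) (-2 * x) I /\
         F s = RtoC (exp (- x)) * I) /\
    F kappa = v.

Definition is_Bfun (kappa : R) (B : R -> C) : Prop :=
  forall x : R, x <> 0%R -> is_Bvalue (RtoC kappa) x (B x).

Definition cfun (kappa y : R) : R :=
  if Req_dec_T kappa 1 then ln y else Rpower y (1 - kappa).

Definition is_Zseries (a : Z -> C) (l : C) : Prop :=
  exists l1 l2 : C,
    is_series (V := C_R_NormedModule) (fun n : nat => a (Z.of_nat n)) l1 /\
    is_series (V := C_R_NormedModule) (fun n : nat => a (- Z.of_nat (S n))%Z) l2 /\
    l = l1 + l2.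

Definition holomorphic_expansion (hp : C -> C) : Prop :=
  exists ap : Z -> C,
    (exists n0 : Z, forall n : Z, (n < n0)%Z -> ap n = 0) /\
    forall z : C, upper_half_plane z ->
      is_Zseries (fun n => ap n * qexp n z) (hp z).

Definition nonholomorphic_expansion (kappa : R) (hm : C -> C) : Prop :=
  exists (B : R -> C) (am : Z -> C),
    is_Bfun kappa B /\
    forall z : C, upper_half_plane z ->
      is_Zseries
        (fun n => if Z.eq_dec n 0 then am 0%Z * RtoC (cfun kappa (Im z))
                  else am n * B (2 * PI * IZR n * Im z)%R * qexp n (RtoC (Re z)))
        (hm z).

(* [hp] is the holomorphic part h^+ of [h]. *)
Definition is_holomorphic_part (kappa : R) (h hp : C -> C) : Prop :=
  exists hm : C -> C,
    holomorphic_expansion hp /\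
    nonholomorphic_expansion kappa hm /\
    forall z : C, upper_half_plane z -> h z = hp z + hm z.

(* Main.v *)
Require Import Defs.
From Stdlib Require Import Reals ZArith Lra Lia Psatz ClassicalEpsilon.
From Coquelicot Require Import Coquelicot.
Open Scope C_scope.

(** Write kappa = 2 - k = 3/2 - m with m an integer, and let h be a form whose
    holomorphic part vanishes.  The idea is to continue the transformation law of
    h to a place where the square root of y has changed sign: the incomplete
    gamma functions of the nonholomorphic part then combine with their own
    continuations into constants, and the coefficients become those of a
    holomorphic q-series that has to vanish.

    1. Since kappa is a half integer, B_kappa(x) = e^{-x} Psi(sqrt(-2x)), where Psi
    is a relative of the complementary error function: it is holomorphic off 0,
    its derivative is -2 v^{2m-2} e^{-v^2}, it decays like e^{-v^2} on the right
    half plane, and Psi(v) + Psi(-v) is a nonzero constant 2 C0 (B_profile_exists;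
    the case m = 1 is an error function, and integration by parts moves m by one).
    Hence h(z) = S(sqrt y, z) with
      S(V, z) = a(0) V^{2m-1} + sum_{n <> 0} a(n) Psi(mu_n V) q^n, mu_n^2 = -4 pi n.
    Convergence on the imaginary axis alone forces a(n) to decay faster than any
    exponential as n -> +oo and to grow subexponentially as n -> -oo (coeff_pos,
    coeff_neg), so that S is defined for independent V and z with Re V >= 0 and
    Im z < 2 Re V^2.  If Re V = 0 and Im z < 0 then both S(V, z) and S(-V, z) are
    defined, and their sum is 2 C0 A(z), where A(z) = sum_{n <> 0} a(n) q^n converges
    on the lower half plane (ext_sum_sym).

    2. Let g = (1 0; M 1) with M = 4N.  Cleared of denominators, the
    transformation law on the line Im z = eta/M relates h(g z), h(z), |Mz+1| and
    the conjugates of theta(g z) and theta(z) (slash_cleared).  Putting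
    Mz + 1 = eta (sinh t + i) makes z, its conjugate, |Mz+1| = eta cosh t, g z, its
    conjugate and sqrt(Im g z) holomorphic in t, so the relation continues from
    the real t-axis down to Im t = -pi/2.  The two points t = 5 - i pi/2 and
    t = -5 - i pi/2 have the same sinh and opposite cosh: the two continued
    relations differ by the sign of V and by a sign coming from the odd number
    3 - 2m, and they add up to 2 C0 A(g z) = 0, unless one of the two theta values
    vanishes (cut_identity).  As eta varies, g z runs down the vertical line through
    1/M.  Theta has no zero high up and does not vanish on a segment of a vertical
    line, so A vanishes far down on that line, hence on a horizontal segment of
    length 1, and all a(n) with n <> 0 vanish (coefficients_zero).

    3. There remains h(z) = a(0) y^{m-1/2}.  If a(0) <> 0, the transformation law is a
    relation between theta(z), theta(g z) and |Mz+1|^2.  On the line Im z = y0 the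
    factor |Mz+1|^2 equals (Mz+1)(Mz+1-2i M y0), so the relation continues from each
    line to the whole half plane; comparing two values of y0 shows that
    theta(z) theta(g z) = 0 everywhere, which is false (constant_term_impossible).

    All continuation arguments rest on vanishing_propagates: if F is a bounded
    uniform limit of holomorphic functions on the rectangle [-2, 2] x [-1, 0] and
    vanishes on its top side, then it vanishes at -i.  This is Cauchy's theorem
    applied to F(z) e^{-K (z+i)^2} as K -> +oo: the Gaussian is concentrated near -i
    on the bottom side and is tiny on the vertical sides. *)

Bind Scope C_scope with C.
Arguments Cmod _%_C_scope.
Arguments Re _%_C_scope.
Arguments Im _%_C_scope.
Arguments RtoC _%_R_scope.

(** * Complex derivatives and the exponential *)

(** Kept opaque below: unfolding it during unification exposes filters and
    slows every differentiation down. *)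
Definition is_cderive (f : C -> C) (z l : C) : Prop :=
  is_derive (K := C_AbsRing) (V := C_NormedModule) f z l.

Lemma is_cderive_spec (f : C -> C) (z l : C) : is_cderive f z l <->
  forall eps : R, (0 < eps)%R -> exists d : R, (0 < d)%R /\
   forall h : C, (Cmod h < d)%R -> (Cmod (f (z + h)%C - f z - l * h) <= eps * Cmod h)%R.
Proof.
split.
- intros [_ H] eps He.
  destruct (H z (fun P HP => HP) (mkposreal eps He)) as [d Hd].
  exists d; split; [apply cond_pos|intros h Hh].
  assert (B : ball (M := AbsRing_UniformSpace C_AbsRing) z d (z + h)).
  { change (Cmod (z + h - z) < d)%R. now replace (z + h - z) with h by ring. }
  specialize (Hd (z + h) B).
  change (Cmod (f (z + h)%C - f z - (z + h - z) * l) <= eps * Cmod (z + h - z))%R in Hd.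
  replace (z + h - z) with h in Hd by ring. now rewrite (Cmult_comm l h).
- intros H. split.
  { apply is_linear_scal_l. }
  intros x Hx.
  assert (E : z = x).
  { apply (is_filter_lim_locally_unique (K := C_AbsRing)(V := AbsRing_NormedModule C_AbsRing) z x Hx). }
  subst x. intros eps. destruct (H eps (cond_pos eps)) as [d [Hd1 Hd]].
  exists (mkposreal d Hd1). intros y Hy.
  change (Cmod (y - z) < d)%R in Hy. specialize (Hd (y - z) Hy).
  change (Cmod (f y - f z - (y - z) * l) <= eps * Cmod (y - z))%R.
  assert (R1 : forall a b : C, a + (b - a) = b) by (intros; ring).
  rewrite R1 in Hd. now rewrite (Cmult_comm _ l).
Qed.

Lemma is_cderive_eq (f : C -> C) (z a b : C) : is_cderive f z a -> a = b -> is_cderive f z b.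
Proof. now intros H <-. Qed.

Lemma is_cderive_ext (f g : C -> C) (z l : C) : (forall t, f t = g t) -> is_cderive f z l -> is_cderive g z l.
Proof. intros H. apply (is_derive_ext (K := C_AbsRing) (V := C_NormedModule)). exact H. Qed.

Lemma is_cderive_plus (f g : C -> C) (z a b : C) : is_cderive f z a -> is_cderive g z b ->
  is_cderive (fun t => f t + g t) z (a + b).
Proof. intros H1 H2. apply (is_derive_plus (K:=C_AbsRing) f g); auto. Qed.

Lemma is_cderive_id z : is_cderive (fun t => t) z 1.
Proof. apply is_cderive_spec. intros eps He. exists 1%R; split; [lra|]. intros h Hh.
replace (z + h - z - 1 * h) with (RtoC 0) by ring. rewrite Cmod_0.
apply Rmult_le_pos; [lra|apply Cmod_ge_0]. Qed.

Lemma is_cderive_const c z : is_cderive (fun t => c) z 0.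
Proof. apply is_cderive_spec. intros eps He. exists 1%R; split; [lra|]. intros h Hh.
replace (c - c - 0 * h) with (RtoC 0) by ring. rewrite Cmod_0.
apply Rmult_le_pos; [lra|apply Cmod_ge_0]. Qed.

(** The product and chain rules see C as a normed module over itself in another
    presentation; the two derivatives agree because the norms do. *)
Lemma is_cderive_AbsRing (f : C -> C) (z l : C) : is_cderive f z l ->
  is_derive (K := C_AbsRing) (V := AbsRing_NormedModule C_AbsRing) f z l.
Proof.
intros [_ H]. split. apply is_linear_scal_l. intros x Hx eps. destruct (H x Hx eps) as [d Hd].
exists d. exact Hd.
Qed.
Lemma is_cderive_of_AbsRing (f : C -> C) (z l : C) : 
  is_derive (K := C_AbsRing) (V := AbsRing_NormedModule C_AbsRing) f z l -> is_cderive f z l.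
Proof.
intros [_ H]. split. apply is_linear_scal_l. intros x Hx eps. destruct (H x Hx eps) as [d Hd].
exists d. exact Hd.
Qed.

Lemma is_cderive_mult (f g : C -> C) (z a b : C) : is_cderive f z a -> is_cderive g z b ->
  is_cderive (fun t => f t * g t) z (a * g z + f z * b).
Proof. intros H1 H2. apply is_cderive_of_AbsRing.
 apply (is_derive_mult (K:=C_AbsRing) f g z a b); [now apply is_cderive_AbsRing..|exact Cmult_comm].
Qed.

Lemma is_cderive_comp (f g : C -> C) (z a b : C) : is_cderive f (g z) a -> is_cderive g z b ->
  is_cderive (fun t => f (g t)) z (b*a).
Proof. intros H1 H2. apply (is_derive_comp (K:=C_AbsRing) (V := C_NormedModule) f g z a b).
 exact H1. now apply is_cderive_AbsRing. Qed.

Lemma exp_le_le (x y : R) : (x <= y -> exp x <= exp y)%R.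
Proof. intros [H| ->]; [left; now apply exp_increasing|right; reflexivity]. Qed.

Lemma exp_pow_INR (x : R) (n : nat) : (exp (x * INR n) = exp x ^ n)%R.
Proof.
induction n as [|n IH]; [simpl; now rewrite Rmult_0_r, exp_0|].
rewrite S_INR, Rmult_plus_distr_l, exp_plus, IH, Rmult_1_r. simpl. ring.
Qed.

Lemma abs_sin_le (x : R) : (Rabs (sin x) <= Rabs x)%R.
Proof.
destruct (MVT_gen sin 0 x cos) as [c [_ Hc]].
- intros t _. auto_derive; trivial; ring.
- intros t _. apply continuity_sin.
- rewrite sin_0, !Rminus_0_r in Hc. rewrite Hc, Rabs_mult.
  assert (H := COS_bound c). assert (Rabs (cos c) <= 1)%R by (apply Rabs_le; lra).
  assert (H1 := Rabs_pos x). nra.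
Qed.

Lemma one_minus_cos_le (x : R) : (0 <= 1 - cos x <= x * x / 2)%R.
Proof.
assert (H := COS_bound x). split; [lra|].
replace x with (2 * (x / 2))%R at 1 by field. rewrite cos_2a_sin.
assert (H1 := abs_sin_le (x / 2)). apply Rsqr_le_abs_1 in H1. unfold Rsqr in H1. nra.
Qed.

Lemma abs_sin_sub_le (x : R) : (Rabs x <= 1)%R -> (Rabs (sin x - x) <= x * x)%R.
Proof.
intros Hx. destruct (MVT_gen (fun t => sin t - t)%R 0 x (fun t => cos t - 1)%R) as [c [Hc1 Hc]].
- intros t _. auto_derive; trivial; ring.
- intros t _. apply continuity_minus; [apply continuity_sin|apply derivable_continuous, derivable_id].
- rewrite sin_0, !Rminus_0_r in Hc. rewrite Hc, Rabs_mult.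
  assert (H := one_minus_cos_le c). rewrite (Rabs_left1 (cos c - 1)) by lra.
  assert (H1 : (c * c <= Rabs x * Rabs x)%R).
  { revert Hc1 Hx. unfold Rmin, Rmax, Rabs. destruct (Rle_dec 0 x), (Rcase_abs x); intros; nra. }
  assert (H2 := Rabs_pos x). rewrite <- (Rabs_pos_eq (x * x)) by nra. rewrite Rabs_mult. nra.
Qed.

(** Both e^x >= 1 + x and e^{-x} >= 1 - x; the second bounds e^x by 1/(1-x). *)
Lemma exp_sub_le (x : R) : (Rabs x <= 1 / 2)%R -> (Rabs (exp x - 1 - x) <= 2 * (x * x))%R.
Proof.
intros Hx. apply Rabs_le_between in Hx.
assert (H1 := exp_ineq1_le x). assert (H2 := exp_ineq1_le (- x)).
rewrite Rabs_pos_eq by lra.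
assert (H3 : (exp x * exp (- x) = 1)%R) by (rewrite <- exp_plus, Rplus_opp_r; apply exp_0).
assert (H4 := exp_pos x).
assert (H5 : (exp x * (1 - x) <= 1)%R) by nra. nra.
Qed.

Lemma Cexp_plus (a b : C) : Cexp (a + b) = Cexp a * Cexp b.
Proof.
unfold Cexp, Cmult, Cplus, RtoC, Re, Im; simpl. rewrite exp_plus, cos_plus, sin_plus.
f_equal; ring.
Qed.

Lemma Cexp_0 : Cexp 0 = 1.
Proof. unfold Cexp, Cmult, RtoC, Re, Im; simpl. rewrite exp_0, cos_0, sin_0. f_equal; ring. Qed.

Lemma Cmod_Cexp (z : C) : Cmod (Cexp z) = exp (Re z).
Proof.
unfold Cexp. rewrite Cmod_mult, Cmod_R, Rabs_pos_eq by (left; apply exp_pos).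
unfold Cmod; simpl. replace (_ + _)%R with 1%R; [rewrite sqrt_1; apply Rmult_1_r|].
etransitivity; [symmetry; exact (sin2_cos2 (Im z))|]. unfold Rsqr, Im. simpl. match goal with |- @eq ?T ?a ?b => change (@eq R a b) end. ring.
Qed.

Lemma Cexp_nz (z : C) : Cexp z <> 0.
Proof. apply Cmod_gt_0. rewrite Cmod_Cexp. apply exp_pos. Qed.

Lemma Cexp_opp (z : C) : Cexp (- z) = / Cexp z.
Proof.
rewrite <- (Cmult_1_l (/ Cexp z)), <- Cexp_0. replace (RtoC 0) with (- z + z) by ring.
rewrite Cexp_plus. field. apply Cexp_nz.
Qed.

Lemma Cexp_RtoC (x : R) : Cexp (RtoC x) = RtoC (exp x).
Proof. unfold Cexp, Cmult, RtoC, Re, Im; simpl. rewrite cos_0, sin_0. f_equal; ring. Qed.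

Lemma Cmod_le_abs (z : C) : (Cmod z <= Rabs (Re z) + Rabs (Im z))%R.
Proof.
assert (Hz : z = RtoC (Re z) + Ci * RtoC (Im z)).
{ destruct z as [a b]; unfold Ci, RtoC, Cmult, Cplus, Re, Im; simpl; f_equal; ring. }
rewrite Hz at 1.
eapply Rle_trans; [apply Cmod_triangle|]. rewrite Cmod_mult, Cmod_Ci, !Cmod_R. lra.
Qed.

Lemma im_le_Cmod (z : C) : (Rabs (Im z) <= Cmod z)%R.
Proof. eapply Rle_trans; [apply Rmax_r|apply Rmax_Cmod]. Qed.

(** The second-order remainder of the exponential at 0, which is what its
    differentiability needs; it is assembled from the real remainders of exp, cos
    and sin. *)
Lemma Cexp_sub_le (h : C) : (Cmod h <= 1 / 2)%R -> (Cmod (Cexp h - 1 - h) <= 8 * (Cmod h * Cmod h))%R.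
Proof.
intros Hh. destruct h as [a b].
assert (Ha := re_le_Cmod (a, b)). assert (Hb := im_le_Cmod (a, b)). simpl in Ha, Hb.
set (r := Cmod (a, b)) in *.
assert (H1 := exp_sub_le a ltac:(lra)). assert (H2 := one_minus_cos_le b).
assert (H3 := abs_sin_sub_le b ltac:(lra)). assert (H4 := abs_sin_le b).
assert (Ha0 := Rabs_pos a). assert (Hb0 := Rabs_pos b).
assert (Ha2 : (a * a <= r * r)%R).
{ rewrite <- (Rabs_pos_eq (a * a)) by nra. rewrite Rabs_mult. nra. }
assert (Hb2 : (b * b <= r * r)%R).
{ rewrite <- (Rabs_pos_eq (b * b)) by nra. rewrite Rabs_mult. nra. }
assert (H5 : (Rabs (exp a - 1) <= 2 * r)%R).
{ replace (exp a - 1)%R with (exp a - 1 - a + a)%R by ring.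
  eapply Rle_trans; [apply Rabs_triang|]. assert (a * a <= Rabs a * (1 / 2))%R.
  { rewrite <- (Rabs_pos_eq (a * a)) by nra. rewrite Rabs_mult. nra. } lra. }
assert (H7 : (exp a <= 2)%R) by (apply Rabs_le_between in H5; lra).
assert (H8 := exp_pos a).
eapply Rle_trans; [apply Cmod_le_abs|]. unfold Cexp, Cmult, Cminus, Cplus, Copp, RtoC, Re, Im; simpl.
replace (exp a * cos b - 0 * sin b + - (1) + - a)%R with ((exp a - 1 - a) - exp a * (1 - cos b))%R by ring.
replace (exp a * sin b + 0 * cos b + - 0 + - b)%R with ((exp a - 1) * sin b + (sin b - b))%R by ring.
assert (H9 : (Rabs ((exp a - 1 - a) - exp a * (1 - cos b)) <= 3 * (r * r))%R).
{ eapply Rle_trans; [apply Rabs_triang|]. rewrite Rabs_Ropp, (Rabs_pos_eq (exp a * _)) by nra. nra. }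
assert (H10 : (Rabs ((exp a - 1) * sin b + (sin b - b)) <= 3 * (r * r))%R).
{ eapply Rle_trans; [apply Rabs_triang|]. rewrite Rabs_mult.
  assert (Rabs (exp a - 1) * Rabs (sin b) <= 2 * r * r)%R.
  { apply Rmult_le_compat; try apply Rabs_pos; lra. } nra. }
nra.
Qed.

Lemma is_cderive_Cexp (z : C) : is_cderive Cexp z (Cexp z).
Proof.
apply is_cderive_spec. intros eps He.
assert (He0 := exp_pos (Re z)).
exists (Rmin (1 / 2) (eps / (8 * exp (Re z)))). split.
{ apply Rmin_pos; [lra|]. apply Rdiv_lt_0_compat; lra. }
intros h Hh.
replace (Cexp (z + h) - Cexp z - Cexp z * h) with (Cexp z * (Cexp h - 1 - h))
  by (rewrite Cexp_plus; ring).
rewrite Cmod_mult, Cmod_Cexp.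
assert (H1 : (Cmod h < 1 / 2)%R) by (eapply Rlt_le_trans; [apply Hh|apply Rmin_l]).
assert (H2 : (Cmod h < eps / (8 * exp (Re z)))%R) by (eapply Rlt_le_trans; [apply Hh|apply Rmin_r]).
assert (H3 := Cexp_sub_le h ltac:(lra)). assert (H0 := Cmod_ge_0 h).
apply Rle_trans with (exp (Re z) * (8 * (Cmod h * Cmod h)))%R; [apply Rmult_le_compat_l; lra|].
replace (exp (Re z) * (8 * (Cmod h * Cmod h)))%R with ((8 * exp (Re z) * Cmod h) * Cmod h)%R by ring.
apply Rmult_le_compat_r; [lra|].
apply Rmult_lt_compat_l with (r := (8 * exp (Re z))%R) in H2; [|lra].
replace (8 * exp (Re z) * (eps / (8 * exp (Re z))))%R with eps in H2 by (field; lra). lra.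
Qed.

Lemma is_cderive_inv (z : C) : z <> 0 -> is_cderive (fun t => / t) z (- / (z * z)).
Proof.
intros Hz. apply is_cderive_spec. intros eps He.
assert (Hm := proj1 (Cmod_gt_0 z) Hz).
set (m := Cmod z) in *.
exists (Rmin (m / 2) (eps * (m * m * m) / 2)). split.
{ apply Rmin_pos; [lra|]. assert (0 < m * m)%R by nra. assert (0 < m * m * m)%R by nra. nra. }
intros h Hh.
assert (H1 : (Cmod h < m / 2)%R) by (eapply Rlt_le_trans; [apply Hh|apply Rmin_l]).
assert (H2 : (Cmod h < eps * (m * m * m) / 2)%R) by (eapply Rlt_le_trans; [apply Hh|apply Rmin_r]).
assert (H3 : (m / 2 <= Cmod (z + h))%R).
{ assert (H := Cmod_triangle (z + h) (- h)). rewrite Cmod_opp in H.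
  replace (z + h + - h) with z in H by ring. fold m in H. lra. }
assert (Hzh : z + h <> 0) by (apply Cmod_gt_0; lra).
replace (/ (z + h) - / z - - / (z * z) * h) with (h * h / (z * z * (z + h))) by (field; auto).
rewrite Cmod_div by (repeat apply Cmult_neq_0; auto).
rewrite !Cmod_mult. fold m. assert (H0 := Cmod_ge_0 h).
assert (Hm2 : (0 < m * m)%R) by nra.
apply Rle_div_l; [nra|].
apply Rle_trans with (eps * Cmod h * (m * m * (m / 2)))%R; [nra|].
apply Rmult_le_compat_l; [nra|]. nra.
Qed.

Lemma is_cderive_opp (f : C -> C) (z a : C) : is_cderive f z a -> is_cderive (fun t => - f t) z (- a).
Proof.
intros H. rewrite is_cderive_spec in *. intros eps He. destruct (H eps He) as [d [Hd1 Hd]].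
exists d. split; [exact Hd1|]. intros h Hh.
replace (- f (z + h) - - f z - - a * h) with (- (f (z + h) - f z - a * h)) by ring.
rewrite Cmod_opp. now apply Hd.
Qed.

Lemma is_cderive_minus (f g : C -> C) (z a b : C) : is_cderive f z a -> is_cderive g z b ->
  is_cderive (fun t => f t - g t) z (a - b).
Proof. intros H1 H2. exact (is_cderive_plus f (fun t => - g t) z a (- b) H1 (is_cderive_opp g z b H2)). Qed.

Lemma is_cderive_pow (f : C -> C) (n : nat) (z a : C) : is_cderive f z a ->
  is_cderive (fun t => f t ^ S n) z (RtoC (INR (S n)) * f z ^ n * a).
Proof.
intros H. induction n as [|n IH].
- apply (is_cderive_ext f).
  { intros t. change (f t = f t * 1). ring. }
  apply (is_cderive_eq f z a); [exact H|]. simpl. ring.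
- eapply is_cderive_eq; [exact (is_cderive_mult f (fun t => f t ^ S n) z _ _ H IH)|].
  rewrite (S_INR (S n)), RtoC_plus. rewrite !Cpow_S. ring.
Qed.

Global Opaque is_cderive.

Ltac Cring := match goal with |- @eq _ ?a ?b => change (@eq C a b) end; ring.

(** Syntax-directed differentiation; leaves that are not recognized, and the
    nonvanishing of denominators, become subgoals. *)
Ltac cder :=
  lazymatch goal with
  | |- is_cderive (fun t => t) ?z _ => exact (is_cderive_id z)
  | |- is_cderive (fun _ => ?c) ?z _ => exact (is_cderive_const c z)
  | |- is_cderive (fun t => Cplus (@?f t) (@?g t)) ?z _ => refine (is_cderive_plus f g z _ _ _ _); cder
  | |- is_cderive (fun t => Cminus (@?f t) (@?g t)) ?z _ => refine (is_cderive_minus f g z _ _ _ _); cder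
  | |- is_cderive (fun t => Cmult (@?f t) (@?g t)) ?z _ => refine (is_cderive_mult f g z _ _ _ _); cder
  | |- is_cderive (fun t => Copp (@?f t)) ?z _ => refine (is_cderive_opp f z _ _); cder
  | |- is_cderive (fun t => Cexp (@?f t)) ?z _ =>
      refine (is_cderive_comp Cexp f z _ _ (is_cderive_Cexp (f z)) _); cder
  | |- is_cderive (fun t => Cinv (@?f t)) ?z _ =>
      refine (is_cderive_comp Cinv f z _ _ (is_cderive_inv (f z) _) _); [|cder]
  | |- is_cderive (fun t => Cdiv (@?f t) (@?g t)) ?z ?l =>
      change (is_cderive (fun t => Cmult (f t) (Cinv (g t))) z l); cder
  | |- is_cderive (fun t => Cpow (@?f t) (S ?n)) ?z _ => refine (is_cderive_pow f n z _ _); cder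
  | |- is_cderive ?f ?z _ => idtac
  end; cbv beta.

Definition cdiff (f : C -> C) (z : C) : Prop := exists l, is_cderive f z l.
Ltac cdiff := eexists; cder.

Notation CR := C_R_NormedModule.
Notation CRc := C_R_CompleteNormedModule.
Notation is_rderive := (is_derive (K := R_AbsRing) (V := CR)).
Notation csum := (sum_n (G := CR)).
Notation is_cseries := (is_series (V := CR)).
Notation is_cRInt_gen := (is_RInt_gen (V := CR)).
Notation clocally := (locally (T := CR)).

Lemma norm_CR (z : C) : norm (V := CR) z = Cmod z.
Proof.
unfold norm; simpl. unfold prod_norm, Cmod. f_equal.
change (Rabs (fst z) ^ 2 + Rabs (snd z) ^ 2 = fst z ^ 2 + snd z ^ 2)%R. now rewrite !pow2_abs.
Qed.

(** Restriction to a line with direction e turns a complex derivative into the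
    derivative of a curve in the plane. *)
Lemma is_cderive_line (f : C -> C) (z e l : C) (t : R) : is_cderive f (z + RtoC t * e) l ->
  is_rderive (fun s : R => f (z + RtoC s * e)) t (l * e).
Proof.
intros H. rewrite is_cderive_spec in H. split; [apply is_linear_scal_l|].
intros x Hx.
assert (E : t = x) by apply (is_filter_lim_locally_unique (V := AbsRing_NormedModule R_AbsRing) t x Hx).
subst x. intros eps.
assert (He := Cmod_ge_0 e).
destruct (H (eps / (Cmod e + 1))%R) as [d [Hd1 Hd]].
{ apply Rdiv_lt_0_compat; [apply cond_pos|lra]. }
assert (Hd2 : (0 < d / (Cmod e + 1))%R) by (apply Rdiv_lt_0_compat; lra).
exists (mkposreal _ Hd2). intros y Hy. 
change (Rabs (y - t) < d / (Cmod e + 1))%R in Hy.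
assert (Hh : (Cmod (RtoC (y - t) * e) < d)%R).
{ rewrite Cmod_mult, Cmod_R. apply Rlt_div_r in Hy; [|lra].
  assert (H0 := Rabs_pos (y - t)). nra. }
specialize (Hd _ Hh). rewrite norm_CR.
replace (z + RtoC t * e + RtoC (y - t) * e) with (z + RtoC y * e) in Hd by (rewrite RtoC_minus; ring).
match goal with |- (Cmod ?A <= _)%R =>
  replace A with (f (z + RtoC y * e) - f (z + RtoC t * e) - l * (RtoC (y - t) * e)) end.
2:{ transitivity (f (z + RtoC y * e) - f (z + RtoC t * e) - RtoC (y - t) * (l * e)); [ring|].
    rewrite <- (scal_R_Cmult (y - t) (l * e)). reflexivity. }
eapply Rle_trans; [apply Hd|]. rewrite Cmod_mult, Cmod_R.
change (eps / (Cmod e + 1) * (Rabs (y - t) * Cmod e) <= eps * Rabs (y - t))%R.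
assert (Hep := cond_pos eps). assert (H0 := Rabs_pos (y - t)).
replace (eps / (Cmod e + 1) * (Rabs (y - t) * Cmod e))%R with (eps * Rabs (y - t) * (Cmod e / (Cmod e + 1)))%R by (field; lra).
rewrite <- (Rmult_1_r (eps * Rabs (y - t))) at 2. apply Rmult_le_compat_l; [nra|].
apply Rle_div_l; lra.
Qed.

Lemma is_cderive_hline (f : C -> C) (x y : R) (l : C) : is_cderive f (x, y) l ->
  is_rderive (fun s : R => f (s, y)) x l.
Proof.
intros H. replace l with (l * 1) by ring.
apply (is_derive_ext (fun s : R => f ((0, y)%R + RtoC s * 1))).
{ intros t. f_equal. unfold RtoC, Cplus, Cmult; simpl; f_equal; ring. }
apply is_cderive_line. replace ((0, y)%R + RtoC x * 1) with ((x, y) : C); [exact H|].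
unfold RtoC, Cplus, Cmult; simpl; f_equal; ring.
Qed.

Lemma is_cderive_vline (f : C -> C) (x y : R) (l : C) : is_cderive f (x, y) l ->
  is_rderive (fun s : R => f (x, s)) y (Ci * l).
Proof.
intros H. rewrite Cmult_comm.
apply (is_derive_ext (fun s : R => f ((x, 0)%R + RtoC s * Ci))).
{ intros t. f_equal. unfold RtoC, Ci, Cplus, Cmult; simpl; f_equal; ring. }
apply is_cderive_line. replace ((x, 0)%R + RtoC y * Ci) with ((x, y) : C); [exact H|].
unfold RtoC, Ci, Cplus, Cmult; simpl; f_equal; ring.
Qed.

Lemma cdiff_continuous (f : C -> C) (z : C) : cdiff f z ->
  forall eps : R, (0 < eps)%R -> exists d : R, (0 < d)%R /\
   forall h : C, (Cmod h < d)%R -> (Cmod (f (z + h)%C - f z) <= eps)%R.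
Proof.
intros [l Hl] eps He. rewrite is_cderive_spec in Hl. destruct (Hl 1%R Rlt_0_1) as [d [Hd1 Hd]].
assert (H0 := Cmod_ge_0 l).
exists (Rmin d (eps / (Cmod l + 1))). split.
{ apply Rmin_pos; [lra|]. apply Rdiv_lt_0_compat; lra. }
intros h Hh.
assert (H1 : (Cmod h < d)%R) by (eapply Rlt_le_trans; [apply Hh|apply Rmin_l]).
assert (H2 : (Cmod h < eps / (Cmod l + 1))%R) by (eapply Rlt_le_trans; [apply Hh|apply Rmin_r]).
apply Rlt_div_r in H2; [|lra].
replace (f (z + h) - f z) with ((f (z + h) - f z - l * h) + l * h) by ring.
eapply Rle_trans; [apply Cmod_triangle|]. rewrite Cmod_mult. specialize (Hd h H1). nra.
Qed.

Lemma cdiff_cont_h (f : C -> C) (x y : R) : cdiff f (x, y) ->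
  continuous (U := CR) (fun s : R => f (s, y)) x.
Proof.
intros [l Hl]. apply (ex_derive_continuous (K := R_AbsRing) (V := CR)).
exists l. now apply is_cderive_hline.
Qed.

Lemma cdiff_cont_v (f : C -> C) (x y : R) : cdiff f (x, y) ->
  continuous (U := CR) (fun s : R => Ci * f (x, s)) y.
Proof.
intros [l Hl]. apply (ex_derive_continuous (K := R_AbsRing) (V := CR)).
exists (Ci * (0 * f (x, y) + Ci * l)). apply (is_cderive_vline (fun z => Ci * f z)).
apply is_cderive_mult; [apply is_cderive_const|exact Hl].
Qed.

(** * Bisection of rectangles and the Cauchy-Goursat theorem *)

(** If Q fails on a rectangle it fails on one of the four quarters, hence on a
    nested sequence of similar rectangles shrinking to a point (p, q), where the
    local hypothesis contradicts it.  It yields both the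
    theorem of Goursat and boundedness on rectangles. *)
Lemma rect_bisection (Q : R -> R -> R -> R -> Prop) (x0 y0 w h : R) : (0 < w)%R -> (0 < h)%R ->
  (forall x y w h, Q x y (w / 2) (h / 2) -> Q (x + w / 2) y (w / 2) (h / 2) ->
     Q x (y + h / 2) (w / 2) (h / 2) -> Q (x + w / 2) (y + h / 2) (w / 2) (h / 2) -> Q x y w h)%R ->
  (forall p q, x0 <= p <= x0 + w -> y0 <= q <= y0 + h -> exists d, 0 < d /\
     forall x y k, 0 < k < d -> x <= p <= x + k * w -> y <= q <= y + k * h -> Q x y (k * w) (k * h))%R ->
  Q x0 y0 w h.
Proof.
intros Hw Hh Hsplit Hloc.
destruct (classic (Q x0 y0 w h)) as [|HN]; [assumption|exfalso].
set (P := fun (n : nat) (c : R * R) => ~ Q (fst c) (snd c) (w / 2 ^ n)%R (h / 2 ^ n)%R).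
assert (Hstep : forall n c, P n c -> exists c', P (S n) c' /\
   (fst c <= fst c' <= fst c + w / 2 ^ S n)%R /\ (snd c <= snd c' <= snd c + h / 2 ^ S n)%R).
{ intros n [x y] HP. unfold P in HP; simpl fst in HP; simpl snd in HP.
  assert (Hp : (0 < 2 ^ n)%R) by (apply pow_lt; lra).
  assert (E1 : (w / 2 ^ n / 2 = w / 2 ^ S n)%R) by (simpl; field; lra).
  assert (E2 : (h / 2 ^ n / 2 = h / 2 ^ S n)%R) by (simpl; field; lra).
  assert (P1 : (0 < w / 2 ^ S n)%R) by (apply Rdiv_lt_0_compat; [lra|apply pow_lt; lra]).
  assert (P2 : (0 < h / 2 ^ S n)%R) by (apply Rdiv_lt_0_compat; [lra|apply pow_lt; lra]).
  assert (HS := Hsplit x y (w / 2 ^ n)%R (h / 2 ^ n)%R). rewrite E1, E2 in HS.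
  destruct (classic (Q x y (w / 2 ^ S n) (h / 2 ^ S n))%R) as [H1|H1].
  2:{ exists (x, y). split; [exact H1|repeat split; cbn [fst snd]; lra]. }
  destruct (classic (Q (x + w / 2 ^ S n) y (w / 2 ^ S n) (h / 2 ^ S n))%R) as [H2|H2].
  2:{ exists ((x + w / 2 ^ S n)%R, y). split; [exact H2|repeat split; cbn [fst snd]; lra]. }
  destruct (classic (Q x (y + h / 2 ^ S n) (w / 2 ^ S n) (h / 2 ^ S n))%R) as [H3|H3].
  2:{ exists (x, (y + h / 2 ^ S n)%R). split; [exact H3|repeat split; cbn [fst snd]; lra]. }
  destruct (classic (Q (x + w / 2 ^ S n) (y + h / 2 ^ S n) (w / 2 ^ S n) (h / 2 ^ S n))%R) as [H4|H4].
  2:{ exists ((x + w / 2 ^ S n)%R, (y + h / 2 ^ S n)%R). split; [exact H4|repeat split; cbn [fst snd]; lra]. }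
  exfalso; auto. }
assert (Hseq : exists c : nat -> R * R, c O = (x0, y0) /\ forall n, P n (c n) /\
   (fst (c n) <= fst (c (S n)) <= fst (c n) + w / 2 ^ S n)%R /\
   (snd (c n) <= snd (c (S n)) <= snd (c n) + h / 2 ^ S n)%R).
{ set (T := {nc : nat * (R * R) | P (fst nc) (snd nc)}).
  assert (HT : forall t : T, exists t' : T, fst (proj1_sig t') = S (fst (proj1_sig t)) /\
     let c := snd (proj1_sig t) in let c' := snd (proj1_sig t') in let n := fst (proj1_sig t) in
     (fst c <= fst c' <= fst c + w / 2 ^ S n)%R /\ (snd c <= snd c' <= snd c + h / 2 ^ S n)%R).
  { intros [[n c] HP]. simpl in HP. destruct (Hstep n c HP) as [c' [HP' Hc']].
    exists (exist _ (S n, c') HP'). split; [reflexivity|exact Hc']. }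
  set (g := fun t => proj1_sig (constructive_indefinite_description _ (HT t))).
  assert (Hg := fun t => proj2_sig (constructive_indefinite_description _ (HT t))).
  change (forall t : T, fst (proj1_sig (g t)) = S (fst (proj1_sig t)) /\
     let c := snd (proj1_sig t) in let c' := snd (proj1_sig (g t)) in let n := fst (proj1_sig t) in
     (fst c <= fst c' <= fst c + w / 2 ^ S n)%R /\ (snd c <= snd c' <= snd c + h / 2 ^ S n)%R) in Hg.
  assert (HP0 : P O (x0, y0)).
  { unfold P. simpl. now rewrite !Rdiv_1_r. }
  set (t := fun n => Nat.iter n g (exist _ (O, (x0, y0)) HP0 : T)).
  assert (Ht : forall n, fst (proj1_sig (t n)) = n).
  { induction n as [|n IH]; [reflexivity|]. simpl. rewrite (proj1 (Hg _)). now f_equal. }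
  exists (fun n => snd (proj1_sig (t n))). split; [reflexivity|]. intros n. split.
  - assert (H := proj2_sig (t n)). simpl in H. now rewrite Ht in H.
  - assert (H := proj2 (Hg (t n))). simpl in H. rewrite Ht in H. exact H. }
destruct Hseq as [c [Hc0 Hc]].
assert (Hlim : forall (u : nat -> R) (v : R), (0 < v)%R ->
   (forall n, u n <= u (S n) <= u n + v / 2 ^ S n)%R ->
   exists p, forall n, (u n <= p <= u n + v / 2 ^ n)%R).
{ intros u v Hv Hu.
  assert (Hmono : forall n k, (u n <= u (n + k)%nat)%R).
  { intros n k. induction k as [|k IH]; [rewrite Nat.add_0_r; lra|].
    rewrite Nat.add_succ_r. assert (H := Hu (n + k)%nat). lra. }
  assert (Hup : forall n k, (u (n + k)%nat + v / 2 ^ (n + k) <= u n + v / 2 ^ n)%R).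
  { intros n k. induction k as [|k IH]; [rewrite Nat.add_0_r; lra|].
    rewrite Nat.add_succ_r. assert (H := Hu (n + k)%nat).
    assert ((v / 2 ^ (n + k) = 2 * (v / 2 ^ S (n + k)))%R).
    { simpl. field. apply pow_nonzero; lra. } lra. }
  assert (Hvp : forall n, (0 < v / 2 ^ n)%R) by (intros n; apply Rdiv_lt_0_compat; [lra|apply pow_lt; lra]).
  assert (Hub : forall n m, (u m <= u n + v / 2 ^ n)%R).
  { intros n m. destruct (Nat.le_ge_cases n m) as [H|H].
    - replace m with (n + (m - n))%nat by lia. assert (H1 := Hup n (m - n)%nat).
      assert (H2 := Hvp (n + (m - n))%nat). lra.
    - replace n with (m + (n - m))%nat by lia. assert (H1 := Hmono m (n - m)%nat).
      assert (H2 := Hvp (m + (n - m))%nat). lra. }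
  destruct (completeness (fun r => exists n, r = u n)) as [p [Hp1 Hp2]].
  - exists (u O + v / 2 ^ 0)%R. intros r [n ->]. apply Hub.
  - exists (u O), O. reflexivity.
  - exists p. intros n. split.
    + apply Hp1. now exists n.
    + apply Hp2. intros r [m ->]. apply Hub. }
destruct (Hlim (fun n => fst (c n)) w Hw) as [p Hp]; [intros n; apply Hc|].
destruct (Hlim (fun n => snd (c n)) h Hh) as [q Hq]; [intros n; apply Hc|].
destruct (Hloc p q) as [d [Hd1 Hd]].
{ assert (H := Hp O). rewrite Hc0 in H. simpl in H. lra. }
{ assert (H := Hq O). rewrite Hc0 in H. simpl in H. lra. }
destruct (pow_lt_1_zero (/ 2) ltac:(rewrite Rabs_pos_eq; lra) d Hd1) as [n Hn].
specialize (Hn n (Nat.le_refl n)).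
rewrite Rabs_pos_eq in Hn by (apply pow_le; lra).
assert (Hi : (0 < (/ 2) ^ n)%R) by (apply pow_lt; lra).
apply (proj1 (Hc n)).
assert (E : forall v, (v / 2 ^ n = (/ 2) ^ n * v)%R) by (intros v; rewrite pow_inv; unfold Rdiv; ring).
rewrite !E. apply Hd; [lra| |]; rewrite <- E; [apply Hp|apply Hq].
Qed.

Definition hint (f : C -> C) (y a b : R) : C := RInt (V := CRc) (fun t => f (t, y)) a b.
(** The factor i is dz along a vertical segment. *)
Definition vint (f : C -> C) (x c d : R) : C := RInt (V := CRc) (fun t => Ci * f (x, t)) c d.
(** The integral along the boundary, counterclockwise. *)
Definition bdry (f : C -> C) (a b c d : R) : C :=
  hint f c a b + vint f b c d - hint f d a b - vint f a c d.

Definition in_rect (a b c d : R) (z : C) : Prop := (a <= Re z <= b /\ c <= Im z <= d)%R.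

Lemma ex_hint (f : C -> C) (y a b : R) : (a <= b)%R -> (forall t, a <= t <= b -> cdiff f (t, y))%R ->
  ex_RInt (V := CRc) (fun t => f (t, y)) a b.
Proof.
intros Hab H. apply (ex_RInt_continuous (V := CRc)). intros t Ht.
rewrite Rmin_left, Rmax_right in Ht by lra. now apply cdiff_cont_h, H.
Qed.

Lemma ex_vint (f : C -> C) (x c d : R) : (c <= d)%R -> (forall t, c <= t <= d -> cdiff f (x, t))%R ->
  ex_RInt (V := CRc) (fun t => Ci * f (x, t)) c d.
Proof.
intros Hab H. apply (ex_RInt_continuous (V := CRc)). intros t Ht.
rewrite Rmin_left, Rmax_right in Ht by lra. now apply cdiff_cont_v, H.
Qed.

Lemma hint_chasles (f : C -> C) (y a b c : R) : (a <= b)%R -> (b <= c)%R ->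
  (forall t, a <= t <= c -> cdiff f (t, y))%R -> hint f y a c = hint f y a b + hint f y b c.
Proof.
intros H1 H2 H. symmetry. apply (RInt_Chasles (V := CRc)); apply ex_hint; auto; intros t Ht; apply H; lra.
Qed.

Lemma vint_chasles (f : C -> C) (x a b c : R) : (a <= b)%R -> (b <= c)%R ->
  (forall t, a <= t <= c -> cdiff f (x, t))%R -> vint f x a c = vint f x a b + vint f x b c.
Proof.
intros H1 H2 H. symmetry. apply (RInt_Chasles (V := CRc)); apply ex_vint; auto; intros t Ht; apply H; lra.
Qed.

Lemma hint_minus (f g : C -> C) (y a b : R) : (a <= b)%R ->
  (forall t, a <= t <= b -> cdiff f (t, y))%R -> (forall t, a <= t <= b -> cdiff g (t, y))%R ->
  hint (fun z => f z - g z) y a b = hint f y a b - hint g y a b.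
Proof.
intros Hab Hf Hg. exact (RInt_minus (V := CRc) _ _ _ _ (ex_hint f y a b Hab Hf) (ex_hint g y a b Hab Hg)).
Qed.

Lemma vint_minus (f g : C -> C) (x a b : R) : (a <= b)%R ->
  (forall t, a <= t <= b -> cdiff f (x, t))%R -> (forall t, a <= t <= b -> cdiff g (x, t))%R ->
  vint (fun z => f z - g z) x a b = vint f x a b - vint g x a b.
Proof.
intros Hab Hf Hg. unfold vint.
rewrite (RInt_ext (V := CRc) _ (fun t => minus (Ci * f (x, t)) (Ci * g (x, t)))).
- exact (RInt_minus (V := CRc) _ _ _ _ (ex_vint f x a b Hab Hf) (ex_vint g x a b Hab Hg)).
- intros t _. change (Ci * (f (x, t) - g (x, t)) = Ci * f (x, t) - Ci * g (x, t)). ring.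
Qed.

Lemma hint_le (f : C -> C) (y a b M : R) : (a <= b)%R -> (forall t, a <= t <= b -> cdiff f (t, y))%R ->
  (forall t, a <= t <= b -> Cmod (f (t, y)) <= M)%R -> (Cmod (hint f y a b) <= (b - a) * M)%R.
Proof.
intros Hab Hf HM. rewrite <- norm_CR.
apply (norm_RInt_le_const (V := CR) (fun t => f (t, y))); [exact Hab| |].
- intros t Ht. rewrite norm_CR. now apply HM.
- apply (RInt_correct (V := CRc)). now apply ex_hint.
Qed.

Lemma vint_le (f : C -> C) (x a b M : R) : (a <= b)%R -> (forall t, a <= t <= b -> cdiff f (x, t))%R ->
  (forall t, a <= t <= b -> Cmod (f (x, t)) <= M)%R -> (Cmod (vint f x a b) <= (b - a) * M)%R.
Proof.
intros Hab Hf HM. rewrite <- norm_CR.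
apply (norm_RInt_le_const (V := CR) (fun t => Ci * f (x, t))); [exact Hab| |].
- intros t Ht. rewrite norm_CR, Cmod_mult, Cmod_Ci, Rmult_1_l. now apply HM.
- apply (RInt_correct (V := CRc)). now apply ex_vint.
Qed.

Lemma hint_prim (F f : C -> C) (y a b : R) : (a <= b)%R ->
  (forall t, a <= t <= b -> is_cderive F (t, y) (f (t, y)))%R -> (forall t, a <= t <= b -> cdiff f (t, y))%R ->
  hint f y a b = F (b, y) - F (a, y).
Proof.
intros Hab HF Hf. apply (is_RInt_unique (V := CRc)).
apply (is_RInt_derive (V := CRc) (fun t => F (t, y)));
  rewrite Rmin_left, Rmax_right by lra; intros t Ht.
- now apply is_cderive_hline, HF.
- now apply cdiff_cont_h, Hf.
Qed.

Lemma vint_prim (F f : C -> C) (x a b : R) : (a <= b)%R ->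
  (forall t, a <= t <= b -> is_cderive F (x, t) (f (x, t)))%R -> (forall t, a <= t <= b -> cdiff f (x, t))%R ->
  vint f x a b = F (x, b) - F (x, a).
Proof.
intros Hab HF Hf. apply (is_RInt_unique (V := CRc)).
apply (is_RInt_derive (V := CRc) (fun t => F (x, t)));
  rewrite Rmin_left, Rmax_right by lra; intros t Ht.
- now apply is_cderive_vline, HF.
- now apply cdiff_cont_v, Hf.
Qed.

Lemma cdiff_minus (f g : C -> C) (z : C) : cdiff f z -> cdiff g z -> cdiff (fun t => f t - g t) z.
Proof. intros [a Ha] [b Hb]. cdiff; eassumption. Qed.

Lemma is_cderive_affine_prim (A l z : C) :
  is_cderive (fun t => A * t + l * RtoC (1 / 2) * (t * t)) z (A + l * z).
Proof.
eapply is_cderive_eq; [cder|].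
assert (H : RtoC (1 / 2) + RtoC (1 / 2) = 1) by (rewrite <- RtoC_plus; f_equal; lra).
transitivity (A + l * (RtoC (1 / 2) + RtoC (1 / 2)) * z); [ring|rewrite H; ring].
Qed.

Lemma cdiff_affine (A l z : C) : cdiff (fun t => A + l * t) z.
Proof. cdiff. Qed.

Lemma bdry_minus (f g : C -> C) (a b c d : R) : (a <= b)%R -> (c <= d)%R ->
  (forall s t, a <= s <= b -> c <= t <= d -> cdiff f (s, t))%R ->
  (forall s t, a <= s <= b -> c <= t <= d -> cdiff g (s, t))%R ->
  bdry (fun z => f z - g z) a b c d = bdry f a b c d - bdry g a b c d.
Proof.
intros Hab Hcd Hf Hg. unfold bdry.
rewrite (hint_minus f g c a b), (hint_minus f g d a b), (vint_minus f g b c d), (vint_minus f g a c d);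
  try assumption; try (intros; apply Hf; lra); try (intros; apply Hg; lra).
ring.
Qed.

Lemma bdry_prim (F f : C -> C) (a b c d : R) : (a <= b)%R -> (c <= d)%R ->
  (forall s t, a <= s <= b -> c <= t <= d -> is_cderive F (s, t) (f (s, t)))%R ->
  (forall s t, a <= s <= b -> c <= t <= d -> cdiff f (s, t))%R -> bdry f a b c d = 0.
Proof.
intros Hab Hcd HF Hf. unfold bdry.
rewrite (hint_prim F f c a b), (hint_prim F f d a b), (vint_prim F f b c d), (vint_prim F f a c d);
  try assumption; try (intros; apply HF; lra); try (intros; apply Hf; lra).
ring.
Qed.

(** Bisection: near a point f is affine up to an error small against the distance;
    the affine part has a primitive, and the error contributes little compared
    with the area of the rectangle. *)
Theorem goursat (f : C -> C) (x y w h : R) : (0 < w)%R -> (0 < h)%R ->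
  (forall z, in_rect x (x + w) y (y + h) z -> cdiff f z) -> bdry f x (x + w) y (y + h) = 0.
Proof.
intros Hw Hh Hf. apply Cmod_eq_0.
apply Rle_antisym; [|apply Cmod_ge_0].
apply Rnot_lt_le. intros Hpos.
set (eps := (Cmod (bdry f x (x + w) y (y + h)) / (2 * (w * h)))%R).
assert (Hwh : (0 < w * h)%R) by nra.
assert (Heps : (0 < eps)%R) by (apply Rdiv_lt_0_compat; lra).
set (Q := fun x' y' w' h' : R => (x <= x' -> x' + w' <= x + w -> y <= y' -> y' + h' <= y + h -> 0 < w' -> 0 < h' ->
   Cmod (bdry f x' (x' + w') y' (y' + h')) <= eps * (w' * h'))%R).
assert (HQ : Q x y w h).
{ apply rect_bisection; auto.
  - intros a b u v Q1 Q2 Q3 Q4 H1 H2 H3 H4 H5 H6.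
    assert (D : forall p q, (a <= p <= a + u -> b <= q <= b + v -> cdiff f (p, q))%R).
    { intros p q Hp Hq. apply Hf. unfold in_rect; simpl; lra. }
    specialize (Q1 ltac:(lra) ltac:(lra) ltac:(lra) ltac:(lra) ltac:(lra) ltac:(lra)).
    specialize (Q2 ltac:(lra) ltac:(lra) ltac:(lra) ltac:(lra) ltac:(lra) ltac:(lra)).
    specialize (Q3 ltac:(lra) ltac:(lra) ltac:(lra) ltac:(lra) ltac:(lra) ltac:(lra)).
    specialize (Q4 ltac:(lra) ltac:(lra) ltac:(lra) ltac:(lra) ltac:(lra) ltac:(lra)).
    replace (a + u / 2 + u / 2)%R with (a + u)%R in * by field.
    replace (b + v / 2 + v / 2)%R with (b + v)%R in * by field.
    replace (bdry f a (a + u) b (b + v)) with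
      ((bdry f a (a + u / 2) b (b + v / 2) + bdry f (a + u / 2) (a + u) b (b + v / 2)) +
       (bdry f a (a + u / 2) (b + v / 2) (b + v) + bdry f (a + u / 2) (a + u) (b + v / 2) (b + v))).
    2:{ unfold bdry.
        rewrite (hint_chasles f b a (a + u / 2) (a + u)) by (try lra; intros; apply D; lra).
        rewrite (hint_chasles f (b + v) a (a + u / 2) (a + u)) by (try lra; intros; apply D; lra).
        rewrite (vint_chasles f (a + u) b (b + v / 2) (b + v)) by (try lra; intros; apply D; lra).
        rewrite (vint_chasles f a b (b + v / 2) (b + v)) by (try lra; intros; apply D; lra).
        ring. }
    eapply Rle_trans; [apply Cmod_triangle|].
    eapply Rle_trans; [apply Rplus_le_compat; apply Cmod_triangle|]. lra.
  - intros p q Hp Hq. destruct (Hf (p, q)) as [l Hl]; [unfold in_rect; simpl; lra|].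
    rewrite is_cderive_spec in Hl.
    destruct (Hl (eps * (w * h) / (2 * (w + h) * (w + h)))%R) as [d [Hd1 Hd]].
    { apply Rdiv_lt_0_compat; nra. }
    exists (d / (w + h))%R. split; [apply Rdiv_lt_0_compat; lra|].
    intros a b k Hk Hpa Hqb H1 H2 H3 H4 H5 H6.
    set (z0 := (p, q) : C) in *. set (A := f z0 - l * z0).
    assert (Hkd : (k * (w + h) < d)%R) by (apply Rlt_div_r; lra).
    assert (D : forall s t, (a <= s <= a + k * w -> b <= t <= b + k * h -> cdiff f (s, t))%R).
    { intros s t Hs Ht. apply Hf. unfold in_rect; simpl; lra. }
    set (r := fun z => f z - (A + l * z)).
    assert (Dr : forall s t, (a <= s <= a + k * w -> b <= t <= b + k * h -> cdiff r (s, t))%R).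
    { intros s t Hs Ht. apply cdiff_minus; [now apply D|apply cdiff_affine]. }
    set (M := (eps * (w * h) / (2 * (w + h)) * k)%R).
    assert (HM : forall s t, (a <= s <= a + k * w -> b <= t <= b + k * h -> Cmod (r (s, t)) <= M)%R).
    { intros s t Hs Ht. set (u := (s, t) - z0).
      assert (Hu : (Cmod u <= k * (w + h))%R).
      { eapply Rle_trans; [apply Cmod_le_abs|]. unfold u, z0; simpl.
        assert (Rabs (s + - p) <= k * w)%R by (apply Rabs_le; lra).
        assert (Rabs (t + - q) <= k * h)%R by (apply Rabs_le; lra). lra. }
      specialize (Hd u ltac:(lra)).
      assert (Eu : z0 + u = ((s, t) : C)) by (unfold u; generalize z0; generalize ((s, t) : C); intros c1 c2; ring); rewrite Eu in Hd.
      assert (Er : r (s, t) = f (s, t) - f z0 - l * u) by (unfold r, A, u; generalize (f z0) (f (s, t)) z0; generalize ((s, t) : C); intros c1 c2 c3 c4; ring); rewrite Er.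
      eapply Rle_trans; [apply Hd|].
      replace M with (eps * (w * h) / (2 * (w + h) * (w + h)) * (k * (w + h)))%R by (unfold M; field; lra).
      apply Rmult_le_compat_l; [|exact Hu]. left; apply Rdiv_lt_0_compat; nra. }
    replace (bdry f a (a + k * w) b (b + k * h)) with (bdry r a (a + k * w) b (b + k * h)).
    2:{ unfold r. rewrite (bdry_minus f (fun z => A + l * z)); try lra; try exact D;
          [|intros; apply cdiff_affine].
        rewrite (bdry_prim (fun t => A * t + l * RtoC (1 / 2) * (t * t)) (fun z => A + l * z)); try lra;
          [ring|intros; apply is_cderive_affine_prim|intros; apply cdiff_affine]. }
    unfold bdry.
    assert (B1 := hint_le r b a (a + k * w) M ltac:(lra) ltac:(intros; apply Dr; lra) ltac:(intros; apply HM; lra)).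
    assert (B2 := hint_le r (b + k * h) a (a + k * w) M ltac:(lra) ltac:(intros; apply Dr; lra) ltac:(intros; apply HM; lra)).
    assert (B3 := vint_le r a b (b + k * h) M ltac:(lra) ltac:(intros; apply Dr; lra) ltac:(intros; apply HM; lra)).
    assert (B4 := vint_le r (a + k * w) b (b + k * h) M ltac:(lra) ltac:(intros; apply Dr; lra) ltac:(intros; apply HM; lra)).
    unfold Cminus.
    eapply Rle_trans; [apply Cmod_triangle|]. rewrite Cmod_opp.
    eapply Rle_trans; [apply Rplus_le_compat_r, Cmod_triangle|]. rewrite Cmod_opp.
    eapply Rle_trans; [apply Rplus_le_compat_r, Rplus_le_compat_r, Cmod_triangle|].
    replace (eps * (k * w * (k * h)))%R with (2 * (k * w) * M + 2 * (k * h) * M)%R by (unfold M; field; lra).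
    lra. }
specialize (HQ ltac:(lra) ltac:(lra) ltac:(lra) ltac:(lra) ltac:(lra) ltac:(lra)).
replace (eps * (w * h))%R with (Cmod (bdry f x (x + w) y (y + h)) / 2)%R in HQ by (unfold eps; field; lra).
lra.
Qed.

(** * Propagation of zeros from a side of a rectangle *)

Lemma cdiff_mult (f g : C -> C) (z : C) : cdiff f z -> cdiff g z -> cdiff (fun t => f t * g t) z.
Proof. intros [a Ha] [b Hb]. cdiff; eassumption. Qed.

Lemma cdiff_plus (f g : C -> C) (z : C) : cdiff f z -> cdiff g z -> cdiff (fun t => f t + g t) z.
Proof. intros [a Ha] [b Hb]. cdiff; eassumption. Qed.

Lemma cdiff_const (c z : C) : cdiff (fun _ => c) z.
Proof. cdiff. Qed.

Lemma cdiff_comp (f g : C -> C) (z : C) : cdiff f (g z) -> cdiff g z -> cdiff (fun t => f (g t)) z.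
Proof. intros [a Ha] [b Hb]. eexists. exact (is_cderive_comp f g z a b Ha Hb). Qed.

(** Bounded uniform limits of functions holomorphic at the points of K.  Series
    are such limits by construction, and products and powers inherit the property. *)
Definition unif_holo (K : C -> Prop) (F : C -> C) : Prop := exists Fn : nat -> C -> C,
  (forall n z, K z -> cdiff (Fn n) z) /\
  (exists B : R, forall n z, K z -> (Cmod (Fn n z) <= B)%R) /\
  (forall eps : R, (0 < eps)%R -> exists n0 : nat, forall n z, (n0 <= n)%nat -> K z ->
     (Cmod (Fn n z - F z) <= eps)%R).

(** Other paths are reduced to this rectangle by composing with a holomorphic
    map of it. *)
Definition model_rect : C -> Prop := in_rect (-2) 2 (-1) 0.

Section Vanish.
Variable K : R.
Hypothesis HK : (1 <= K)%R.
Let E (z : C) : C := Cexp (- (RtoC K * ((z + Ci) * (z + Ci)))).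

(** The Gaussian centred at -i: real and largest at -i on the bottom side, at most
    e^{-3K} on the vertical sides, at most e^K on the top side. *)
Lemma gauss_mod (p q : R) : Cmod (E (p, q)) = exp (- (K * (p * p - (q + 1) * (q + 1)))).
Proof.
unfold E. rewrite Cmod_Cexp. f_equal. unfold Cmult, Cplus, Copp, Ci, RtoC, Re, Im; simpl. ring.
Qed.

Lemma gauss_bottom (p : R) : E (p, (-1)%R) = RtoC (exp (- (K * (p * p)))).
Proof.
unfold E. rewrite <- Cexp_RtoC. f_equal. unfold Cmult, Cplus, Copp, Ci, RtoC, Re, Im; simpl. f_equal; ring.
Qed.

Lemma gauss_cdiff (z : C) : cdiff E z.
Proof. unfold E. cdiff. Qed.

Definition gauss_mass : R := RInt (fun p => exp (- (K * (p * p)))) (-2) 2.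

Lemma gauss_cont (p : R) : continuous (fun p : R => exp (- (K * (p * p)))) p.
Proof.
apply (ex_derive_continuous (fun p : R => exp (- (K * (p * p))))). auto_derive. trivial.
Qed.

Lemma gauss_ex (a b : R) : ex_RInt (fun p => exp (- (K * (p * p)))) a b.
Proof. apply (ex_RInt_continuous (V := R_CompleteNormedModule)). intros z _. apply gauss_cont. Qed.

(** On [0, 1/K] the integrand is at least e^{-1}.  The lower bound of order 1/K is
    far from sharp but beats every e^{-c K}. *)
Lemma gauss_mass_ge : (exp (-1) / K <= gauss_mass)%R.
Proof.
unfold gauss_mass.
assert (HK1 : (0 < / K <= 1)%R).
{ split; [apply Rinv_0_lt_compat; lra|]. rewrite <- Rinv_1. apply Rinv_le_contravar; lra. }
rewrite <- (RInt_Chasles (V := R_CompleteNormedModule) _ (-2) 0 2) by apply gauss_ex.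
rewrite <- (RInt_Chasles (V := R_CompleteNormedModule) _ 0 (/ K) 2) by apply gauss_ex.
change (exp (-1) / K <= RInt (fun p => exp (- (K * (p * p)))) (-2) 0 +
  (RInt (fun p => exp (- (K * (p * p)))) 0 (/ K) + RInt (fun p => exp (- (K * (p * p)))) (/ K) 2))%R.
assert (H1 : (0 <= RInt (fun p => exp (- (K * (p * p)))) (-2) 0)%R).
{ apply RInt_ge_0; [lra|apply gauss_ex|intros; left; apply exp_pos]. }
assert (H2 : (0 <= RInt (fun p => exp (- (K * (p * p)))) (/ K) 2)%R).
{ apply RInt_ge_0; [lra|apply gauss_ex|intros; left; apply exp_pos]. }
assert (H3 : (RInt (fun _ => exp (-1)) 0 (/ K) <= RInt (fun p => exp (- (K * (p * p)))) 0 (/ K))%R).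
{ apply RInt_le; [lra|apply ex_RInt_const|apply gauss_ex|].
  intros x Hx. apply exp_le_le.
  assert (H : (K * x <= 1)%R).
  { replace 1%R with (K * / K)%R by (field; lra). apply Rmult_le_compat_l; lra. }
  nra. }
rewrite RInt_const in H3. change (scal (/ K - 0) (exp (-1)))%R with ((/ K - 0) * exp (-1))%R in H3.
unfold Rdiv. lra.
Qed.

(** Cauchy: the integral over the bottom side is that over the three other ones. *)
Lemma gauss_side (G : C -> C) (B e : R) :
  (forall z, model_rect z -> cdiff G z) -> (forall z, model_rect z -> Cmod (G z) <= B)%R ->
  (forall x, -2 <= x <= 2 -> Cmod (G (x, 0%R)) <= e)%R ->
  (Cmod (hint (fun z => (G z * E z)%C) (-1) (-2) 2) <= 4 * (e * exp K) + 2 * (B * exp (- (3 * K))))%R.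
Proof.
intros HG HB He.
assert (HGE : forall s t, (-2 <= s <= 2 -> -1 <= t <= 0 -> cdiff (fun z => (G z * E z)%C) (s, t))%R).
{ intros s t Hs Ht. apply cdiff_mult; [apply HG; unfold model_rect, in_rect; simpl; lra|apply gauss_cdiff]. }
assert (H := goursat (fun z => (G z * E z)%C) (-2) (-1) 4 1 ltac:(lra) ltac:(lra)).
replace (-2 + 4)%R with 2%R in H by ring. replace (-1 + 1)%R with 0%R in H by ring.
assert (H0 : bdry (fun z => (G z * E z)%C) (-2) 2 (-1) 0 = 0).
{ apply H. intros [s t] Hz. unfold in_rect in Hz; simpl in Hz. apply HGE; lra. }
clear H. unfold bdry in H0.
replace (hint (fun z => (G z * E z)%C) (-1) (-2) 2) with
  (hint (fun z => (G z * E z)%C) 0 (-2) 2 + (vint (fun z => (G z * E z)%C) (-2) (-1) 0 - vint (fun z => (G z * E z)%C) 2 (-1) 0)).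
2:{ match goal with |- _ = ?X => replace X with (X - 0) by ring end. rewrite <- H0. ring. }
assert (B1 : (Cmod (hint (fun z => (G z * E z)%C) 0 (-2) 2) <= (2 - -2) * (e * exp K))%R).
{ apply hint_le; [lra|intros; apply HGE; lra|]. intros t Ht. rewrite Cmod_mult, gauss_mod.
  apply Rmult_le_compat; [apply Cmod_ge_0|left; apply exp_pos|now apply He|].
  apply exp_le_le. nra. }
assert (BV : forall x, (x * x = 4)%R -> (-2 <= x <= 2)%R ->
   (Cmod (vint (fun z => (G z * E z)%C) x (-1) 0) <= (0 - -1) * (B * exp (- (3 * K))))%R).
{ intros x Hx Hx2. apply vint_le; [lra|intros; apply HGE; lra|]. intros t Ht. rewrite Cmod_mult, gauss_mod.
  apply Rmult_le_compat; [apply Cmod_ge_0|left; apply exp_pos|apply HB; unfold model_rect, in_rect; simpl; lra|].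
  apply exp_le_le. rewrite Hx. assert ((t + 1) * (t + 1) <= 1)%R by nra. nra. }
assert (B2 := BV 2%R ltac:(lra) ltac:(lra)). assert (B3 := BV (-2)%R ltac:(lra) ltac:(lra)).
eapply Rle_trans; [apply Cmod_triangle|]. unfold Cminus.
eapply Rle_trans; [apply Rplus_le_compat_l, Cmod_triangle|]. rewrite Cmod_opp. lra.
Qed.

(** Near -i the function is close to its value L, and away from -i the Gaussian is
    small; so the integral over the bottom side is about L times the mass. *)
Lemma gauss_center (G : C -> C) (L : C) (B d : R) : (0 < d)%R ->
  (forall z, model_rect z -> cdiff G z) -> (forall z, model_rect z -> Cmod (G z) <= B)%R ->
  (forall x, -2 <= x <= 2 -> Rabs x < d -> Cmod (G (x, (-1)%R) - L) <= Cmod L / 2)%R ->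
  (Cmod L / 2 * gauss_mass <= Cmod (hint (fun z => (G z * E z)%C) (-1) (-2) 2) + 4 * ((B + Cmod L) * exp (- (K * (d * d)))))%R.
Proof.
intros Hd HG HB HL.
set (c := ((B + Cmod L) * exp (- (K * (d * d))))%R).
assert (HGE : forall s, (-2 <= s <= 2 -> cdiff (fun z => (G z * E z)%C) (s, (-1)%R))%R).
{ intros s Hs. apply cdiff_mult; [apply HG; unfold model_rect, in_rect; simpl; lra|apply gauss_cdiff]. }
assert (H1 : is_RInt (V := CR) (fun t => G (t, (-1)%R) * E (t, (-1)%R)) (-2) 2 (hint (fun z => (G z * E z)%C) (-1) (-2) 2)).
{ apply (RInt_correct (V := CRc)). apply (ex_hint (fun z => (G z * E z)%C)); [lra|exact HGE]. }
assert (H2 : is_RInt (V := CR) (fun t => L * E (t, (-1)%R)) (-2) 2 (L * RtoC gauss_mass)).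
{ assert (Hg : is_RInt (fun p => exp (- (K * (p * p)))) (-2) 2 gauss_mass) by (apply (RInt_correct (V := R_CompleteNormedModule)), gauss_ex).
  apply (is_RInt_ext (V := CR) (fun t => (Re L * exp (- (K * (t * t))), Im L * exp (- (K * (t * t)))))%R).
  { intros t _. rewrite gauss_bottom. destruct L as [L1 L2]. unfold Cmult, RtoC; simpl. f_equal; ring. }
  replace (L * RtoC gauss_mass) with ((Re L * gauss_mass, Im L * gauss_mass)%R : C).
  2:{ destruct L as [L1 L2]. unfold Cmult, RtoC; simpl. f_equal; ring. }
  apply (is_RInt_fct_extend_pair (U := R_NormedModule) (V := R_NormedModule)); simpl;
    apply (is_RInt_scal (V := R_NormedModule)); exact Hg. }
assert (H3 : (Cmod (hint (fun z => (G z * E z)%C) (-1) (-2) 2 - (L * RtoC gauss_mass)%C) <= Cmod L / 2 * gauss_mass + 4 * c)%R).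
{ rewrite <- norm_CR.
  apply (norm_RInt_le (V := CR) (fun t => minus (G (t, (-1)%R) * E (t, (-1)%R)) (L * E (t, (-1)%R)) : CR)
    (fun t => Cmod L / 2 * exp (- (K * (t * t))) + c)%R (-2) 2); [lra| | |].
  - intros t Ht. rewrite norm_CR.
    change (Cmod (G (t, (-1)%R) * E (t, (-1)%R) - L * E (t, (-1)%R)) <= Cmod L / 2 * exp (- (K * (t * t))) + c)%R.
    replace (G (t, (-1)%R) * E (t, (-1)%R) - L * E (t, (-1)%R)) with ((G (t, (-1)%R) - L) * E (t, (-1)%R)) by ring.
    rewrite Cmod_mult, gauss_bottom, Cmod_R, Rabs_pos_eq by (left; apply exp_pos).
    assert (He := exp_pos (- (K * (t * t)))). assert (HL0 := Cmod_ge_0 L).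
    assert (Hc : (0 <= B)%R).
    { eapply Rle_trans; [apply Cmod_ge_0|apply (HB (t, (-1)%R))]. unfold model_rect, in_rect; simpl; lra. }
    assert (He2 := exp_pos (- (K * (d * d)))).
    destruct (Rlt_le_dec (Rabs t) d) as [Htd|Htd].
    + apply Rle_trans with (Cmod L / 2 * exp (- (K * (t * t))))%R.
      * apply Rmult_le_compat_r; [lra|]. now apply HL.
      * assert (0 <= c)%R by (unfold c; nra). lra.
    + apply Rle_trans with c; [|nra].
      unfold c. apply Rmult_le_compat; [apply Cmod_ge_0|lra| |].
      * unfold Cminus. eapply Rle_trans; [apply Cmod_triangle|]. rewrite Cmod_opp.
        apply Rplus_le_compat_r, HB. unfold model_rect, in_rect; simpl; lra.
      * apply exp_le_le. apply Ropp_le_contravar. apply Rmult_le_compat_l; [lra|].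
        rewrite <- (Rabs_pos_eq (t * t)) by nra. rewrite Rabs_mult. nra.
  - apply (is_RInt_minus (V := CR)); assumption.
  - apply (is_RInt_plus (V := R_NormedModule)).
    + apply (is_RInt_scal (V := R_NormedModule)). apply (RInt_correct (V := R_CompleteNormedModule)), gauss_ex.
    + replace (4 * c)%R with (scal (2 - -2)%R c). apply (is_RInt_const (V := R_NormedModule)).
      change ((2 - -2) * c = 4 * c)%R. ring. }
assert (H4 : (Cmod L * gauss_mass <= Cmod (hint (fun z => (G z * E z)%C) (-1) (-2) 2 - (L * RtoC gauss_mass)%C) + Cmod (hint (fun z => (G z * E z)%C) (-1) (-2) 2))%R).
{ assert (H5 : (0 <= gauss_mass)%R).
  { eapply Rle_trans; [|apply gauss_mass_ge]. left. apply Rdiv_lt_0_compat; [apply exp_pos|lra]. }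
  replace (Cmod L * gauss_mass)%R with (Cmod (L * RtoC gauss_mass)) by (rewrite Cmod_mult, Cmod_R, Rabs_pos_eq by exact H5; reflexivity).
  rewrite <- (Cmod_opp (_ - _)).
  eapply Rle_trans; [|apply Cmod_triangle]. right. f_equal. ring. }
fold c. lra.
Qed.
End Vanish.

(** If the value L at -i were nonzero, gauss_center and gauss_side would give
    |L|/K <= const e^{-c K} for all K: the approximation error on the top side, which
    is multiplied by e^K, is sent to 0 first, with K fixed. *)
Theorem vanishing_propagates (F : C -> C) : unif_holo model_rect F -> (forall x, -2 <= x <= 2 -> F (x, 0%R) = 0)%R -> F (0, -1)%R = 0.
Proof.
intros [Fn [HFn [[B HB] Hconv]]] Htop.
destruct (classic (F (0, -1)%R = 0)) as [|HN]; [assumption|exfalso].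
set (L := F (0, -1)%R) in *. apply Cmod_gt_0 in HN. set (l := Cmod L) in *.
assert (Hbot : forall x, (-2 <= x <= 2)%R -> model_rect (x, (-1)%R)) by (intros x Hx; unfold model_rect, in_rect; simpl; lra).
destruct (Hconv (l / 8)%R ltac:(lra)) as [n0 Hn0].
destruct (cdiff_continuous (Fn n0) (0, -1)%R (HFn n0 _ (Hbot 0%R ltac:(lra))) (l / 8)%R ltac:(lra)) as [d [Hd1 Hd]].
set (d' := Rmin d 1). assert (Hd' : (0 < d' <= 1)%R) by (split; [apply Rmin_pos; lra|apply Rmin_r]).
assert (HB0 : (0 <= B)%R).
{ eapply Rle_trans; [apply Cmod_ge_0|apply (HB O _ (Hbot 0%R ltac:(lra)))]. }
assert (Hnear : forall n x, (n0 <= n)%nat -> (-2 <= x <= 2)%R -> (Rabs x < d')%R -> (Cmod (Fn n (x, (-1)%R) - L) <= Cmod L / 2)%R).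
{ intros n x Hn Hx Hxd. fold l.
  assert (A1 := Hn0 n _ Hn (Hbot x Hx)). assert (A2 := Hn0 n0 _ (Nat.le_refl _) (Hbot x Hx)).
  assert (A3 := Hn0 n0 _ (Nat.le_refl _) (Hbot 0%R ltac:(lra))). fold L in A3.
  assert (A4 : (Cmod (Fn n0 (x, (-1)%R) - Fn n0 (0, -1)%R) <= l / 8)%R).
  { replace ((x, (-1)%R) : C) with ((0, -1)%R + RtoC x) by (unfold RtoC, Cplus; simpl; f_equal; ring).
    apply Hd. rewrite Cmod_R. eapply Rlt_le_trans; [exact Hxd|apply Rmin_l]. }
  replace (Fn n (x, (-1)%R) - L) with
    (((Fn n (x, (-1)%R) - F (x, (-1)%R)) + - (Fn n0 (x, (-1)%R) - F (x, (-1)%R))) +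
     ((Fn n0 (x, (-1)%R) - Fn n0 (0, -1)%R) + (Fn n0 (0, -1)%R - L))) by ring.
  eapply Rle_trans; [apply Cmod_triangle|].
  eapply Rle_trans; [apply Rplus_le_compat; apply Cmod_triangle|]. rewrite Cmod_opp. lra. }
assert (Hmain : forall K, (1 <= K)%R -> (l / 2 * (exp (-1) / K) <= (6 * B + 4 * l) * exp (- (K * (d' * d'))))%R).
{ intros K HK. apply le_epsilon. intros eps Heps.
  destruct (Hconv (eps / (4 * exp K))%R) as [n1 Hn1].
  { apply Rdiv_lt_0_compat; [lra|]. assert (H := exp_pos K). lra. }
  set (n := Nat.max n0 n1).
  assert (S1 := gauss_side K HK (Fn n) B (eps / (4 * exp K)) (HFn n) (HB n)).
  assert (S2 := gauss_center K HK (Fn n) L B d' (proj1 Hd') (HFn n) (HB n)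
    (fun x Hx Hxd => Hnear n x (Nat.le_max_l _ _) Hx Hxd)).
  assert (S3 := gauss_mass_ge K HK). fold l in S2.
  lapply S1; clear S1; [intros S1|].
  2:{ intros x Hx. assert (Hk : model_rect (x, 0%R)) by (unfold model_rect, in_rect; simpl; lra).
      assert (H := Hn1 n _ (Nat.le_max_r _ _) Hk). rewrite (Htop x Hx) in H.
      now replace (Fn n (x, 0%R) - 0) with (Fn n (x, 0%R)) in H by ring. }
  assert (He := exp_pos K).
  replace (4 * (eps / (4 * exp K) * exp K))%R with eps in S1 by (field; lra).
  assert (S4 : (exp (- (3 * K)) <= exp (- (K * (d' * d'))))%R) 
    by (apply exp_le_le; assert (d' * d' <= 1)%R by nra; nra).
  assert (S5 := Rmult_le_compat_l B _ _ HB0 S4).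
  assert (S6 := Rmult_le_compat_l (l / 2) _ _ ltac:(lra) S3). lra. }
set (cc := ((6 * B + 4 * l) * 4 / (d' * d' * (d' * d')))%R).
assert (Hdd : (0 < d' * d')%R) by nra.
assert (Hcc : (0 < cc)%R) by (apply Rdiv_lt_0_compat; nra).
assert (Hmain2 : forall K, (1 <= K)%R -> (l / 2 * exp (-1) * K <= cc)%R).
{ intros K HK. specialize (Hmain K HK).
  assert (Hx : (exp (- (K * (d' * d'))) <= 4 / (K * (d' * d') * (K * (d' * d'))))%R).
  { set (y := (K * (d' * d'))%R). assert (Hy : (0 < y)%R) by (unfold y; nra).
    rewrite exp_Ropp. replace (4 / (y * y))%R with (/ ((y / 2) * (y / 2)))%R by (field; lra).
    apply Rinv_le_contravar; [nra|].
    replace y with (y / 2 + y / 2)%R at 3 by field. rewrite exp_plus.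
    assert (H := exp_ineq1_le (y / 2)). nra. }
  assert (HK2 : (0 < K * K)%R) by nra.
  apply Rmult_le_compat_l with (r := (K * K)%R) in Hmain; [|lra].
  replace (K * K * (l / 2 * (exp (-1) / K)))%R with (l / 2 * exp (-1) * K)%R in Hmain by (field; lra).
  eapply Rle_trans; [exact Hmain|].
  apply Rle_trans with (K * K * ((6 * B + 4 * l) * (4 / (K * (d' * d') * (K * (d' * d'))))))%R.
  - apply Rmult_le_compat_l; [lra|]. apply Rmult_le_compat_l; [lra|exact Hx].
  - right. unfold cc. field. lra. }
assert (He := exp_pos (-1)).
assert (Hle : (0 < l / 2 * exp (-1))%R) by nra.
specialize (Hmain2 (cc / (l / 2 * exp (-1)) + 1)%R).
assert (Hq : (0 < cc / (l / 2 * exp (-1)))%R) by (apply Rdiv_lt_0_compat; lra).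
specialize (Hmain2 ltac:(lra)).
replace (l / 2 * exp (-1) * (cc / (l / 2 * exp (-1)) + 1))%R with (cc + l / 2 * exp (-1))%R in Hmain2 by (field; lra).
lra.
Qed.

(** * Uniform limits of holomorphic functions *)

Lemma unif_holo_bounded K F : unif_holo K F -> exists B : R, forall z, K z -> (Cmod (F z) <= B)%R.
Proof.
intros [Fn [_ [[B HB] Hc]]]. destruct (Hc 1%R Rlt_0_1) as [n0 Hn0].
exists (B + 1)%R. intros z Hz. specialize (Hn0 n0 z (Nat.le_refl _) Hz).
replace (F z) with (Fn n0 z + - (Fn n0 z - F z)) by ring.
eapply Rle_trans; [apply Cmod_triangle|]. rewrite Cmod_opp. specialize (HB n0 z Hz). lra.
Qed.

Lemma unif_holo_ext K F G : (forall z, K z -> F z = G z) -> unif_holo K F -> unif_holo K G.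
Proof.
intros H [Fn [H1 [H2 H3]]]. exists Fn. repeat split; try assumption.
intros eps He. destruct (H3 eps He) as [n0 Hn0]. exists n0. intros n z Hn Hz. rewrite <- H by assumption. auto.
Qed.

Lemma unif_holo_of_bounded K F B : (forall z, K z -> cdiff F z) -> (forall z, K z -> Cmod (F z) <= B)%R -> unif_holo K F.
Proof.
intros H1 H2. exists (fun _ => F). repeat split; auto.
- now exists B.
- intros eps He. exists O. intros n z _ _. replace (F z - F z) with (RtoC 0) by ring. rewrite Cmod_0. lra.
Qed.

Lemma unif_holo_const K c : unif_holo K (fun _ => c).
Proof. apply (unif_holo_of_bounded K _ (Cmod c)); intros z _; [apply cdiff_const|lra]. Qed.

Lemma unif_holo_plus K F G : unif_holo K F -> unif_holo K G -> unif_holo K (fun z => F z + G z).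
Proof.
intros [Fn [H1 [[B1 H2] H3]]] [Gn [H4 [[B2 H5] H6]]]. exists (fun n z => Fn n z + Gn n z). repeat split.
- intros n z Hz. apply cdiff_plus; auto.
- exists (B1 + B2)%R. intros n z Hz. eapply Rle_trans; [apply Cmod_triangle|]. apply Rplus_le_compat; auto.
- intros eps He. destruct (H3 (eps / 2)%R ltac:(lra)) as [n1 Hn1]. destruct (H6 (eps / 2)%R ltac:(lra)) as [n2 Hn2].
  exists (Nat.max n1 n2). intros n z Hn Hz.
  replace (Fn n z + Gn n z - (F z + G z)) with ((Fn n z - F z) + (Gn n z - G z)) by ring.
  eapply Rle_trans; [apply Cmod_triangle|].
  specialize (Hn1 n z ltac:(lia) Hz). specialize (Hn2 n z ltac:(lia) Hz). lra.
Qed.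

Lemma unif_holo_mult K F G : unif_holo K F -> unif_holo K G -> unif_holo K (fun z => F z * G z).
Proof.
intros HF HG. destruct (unif_holo_bounded K F HF) as [BF HBF].
destruct HF as [Fn [H1 [[B1 H2] H3]]], HG as [Gn [H4 [[B2 H5] H6]]]. exists (fun n z => Fn n z * Gn n z). repeat split.
- intros n z Hz. apply cdiff_mult; auto.
- exists (B1 * B2)%R. intros n z Hz. rewrite Cmod_mult. apply Rmult_le_compat; auto using Cmod_ge_0.
- intros eps He. set (M := (Rabs BF + Rabs B2 + 1)%R).
  assert (HM : (0 < M)%R) by (unfold M; assert (H := Rabs_pos BF); assert (H' := Rabs_pos B2); lra).
  destruct (H3 (eps / (2 * M))%R) as [n1 Hn1]; [apply Rdiv_lt_0_compat; lra|].
  destruct (H6 (eps / (2 * M))%R) as [n2 Hn2]; [apply Rdiv_lt_0_compat; lra|].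
  exists (Nat.max n1 n2). intros n z Hn Hz.
  specialize (Hn1 n z ltac:(lia) Hz). specialize (Hn2 n z ltac:(lia) Hz).
  replace (Fn n z * Gn n z - F z * G z) with ((Fn n z - F z) * Gn n z + F z * (Gn n z - G z)) by ring.
  eapply Rle_trans; [apply Cmod_triangle|]. rewrite !Cmod_mult.
  assert (X1 : (Cmod (Gn n z) <= M)%R).
  { eapply Rle_trans; [apply H5; auto|]. unfold M. assert (H := Rle_abs B2). assert (H' := Rabs_pos BF). lra. }
  assert (X2 : (Cmod (F z) <= M)%R).
  { eapply Rle_trans; [apply HBF; auto|]. unfold M. assert (H := Rle_abs BF). assert (H' := Rabs_pos B2). lra. }
  assert (E : (eps / (2 * M) * M + M * (eps / (2 * M)) = eps)%R) by (field; lra).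
  assert (Y1 : (Cmod (Fn n z - F z) * Cmod (Gn n z) <= eps / (2 * M) * M)%R) by (apply Rmult_le_compat; auto using Cmod_ge_0).
  assert (Y2 : (Cmod (F z) * Cmod (Gn n z - G z) <= M * (eps / (2 * M)))%R) by (apply Rmult_le_compat; auto using Cmod_ge_0).
  lra.
Qed.

Lemma unif_holo_minus K F G : unif_holo K F -> unif_holo K G -> unif_holo K (fun z => F z - G z).
Proof.
intros HF HG. apply (unif_holo_ext K (fun z => F z + (- (1)) * G z)); [intros; ring|].
apply unif_holo_plus; [exact HF|]. apply (unif_holo_mult K (fun _ => - (1))); [apply unif_holo_const|exact HG].
Qed.

Lemma unif_holo_pow K F n : unif_holo K F -> unif_holo K (fun z => F z ^ n).
Proof.
intros HF. induction n as [|n IH].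
- apply (unif_holo_const K 1).
- exact (unif_holo_mult K F _ HF IH).
Qed.

Lemma unif_holo_continuous K F z0 : unif_holo K F -> K z0 -> forall eps : R, (0 < eps)%R -> exists d : R, (0 < d)%R /\
  forall z, K z -> (Cmod (z - z0) < d)%R -> (Cmod (F z - F z0) <= eps)%R.
Proof.
intros [Fn [H1 [_ H3]]] Hz0 eps He. destruct (H3 (eps / 3)%R ltac:(lra)) as [n0 Hn0].
destruct (cdiff_continuous (Fn n0) z0 (H1 n0 z0 Hz0) (eps / 3)%R ltac:(lra)) as [d [Hd1 Hd]].
exists d. split; [exact Hd1|]. intros z Hz Hzd.
specialize (Hd _ Hzd). replace (z0 + (z - z0)) with z in Hd by ring.
replace (F z - F z0) with (- (Fn n0 z - F z) + (Fn n0 z - Fn n0 z0) + (Fn n0 z0 - F z0)) by ring.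
eapply Rle_trans; [apply Cmod_triangle|]. eapply Rle_trans; [apply Rplus_le_compat_r, Cmod_triangle|].
rewrite Cmod_opp. assert (A := Hn0 n0 z (Nat.le_refl _) Hz). assert (A' := Hn0 n0 z0 (Nat.le_refl _) Hz0). lra.
Qed.

Lemma cdiff_rect_bounded (f : C -> C) (x y w h : R) : (0 < w)%R -> (0 < h)%R ->
  (forall z, in_rect x (x + w) y (y + h) z -> cdiff f z) ->
  exists B : R, forall z, in_rect x (x + w) y (y + h) z -> (Cmod (f z) <= B)%R.
Proof.
intros Hw Hh Hf.
set (Q := fun x' y' w' h' : R => exists B : R, forall z, in_rect x' (x' + w') y' (y' + h') z ->
  in_rect x (x + w) y (y + h) z -> (Cmod (f z) <= B)%R).
assert (HQ : Q x y w h).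
{ apply rect_bisection; auto.
  - intros a b u v [B1 Q1] [B2 Q2] [B3 Q3] [B4 Q4].
    exists (Rmax (Rmax B1 B2) (Rmax B3 B4)). intros z Hz Hz'.
    unfold in_rect in Hz, Q1, Q2, Q3, Q4.
    assert (M1 := Rmax_l B1 B2). assert (M2 := Rmax_r B1 B2). assert (M3 := Rmax_l B3 B4). assert (M4 := Rmax_r B3 B4).
    assert (M5 := Rmax_l (Rmax B1 B2) (Rmax B3 B4)). assert (M6 := Rmax_r (Rmax B1 B2) (Rmax B3 B4)).
    destruct (Rle_dec (Re z) (a + u / 2)), (Rle_dec (Im z) (b + v / 2)).
    + assert (Cmod (f z) <= B1)%R by (apply Q1; auto; lra). lra.
    + assert (Cmod (f z) <= B3)%R by (apply Q3; auto; lra). lra.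
    + assert (Cmod (f z) <= B2)%R by (apply Q2; auto; lra). lra.
    + assert (Cmod (f z) <= B4)%R by (apply Q4; auto; lra). lra.
  - intros p q Hp Hq.
    destruct (cdiff_continuous f (p, q) (Hf (p, q) ltac:(unfold in_rect; simpl; lra)) 1%R Rlt_0_1) as [d [Hd1 Hd]].
    exists (d / (w + h))%R. split; [apply Rdiv_lt_0_compat; lra|].
    intros a b k Hk Hpa Hqb. exists (Cmod (f (p, q)) + 1)%R. intros z Hz _. unfold in_rect in Hz.
    assert (Hkd : (k * (w + h) < d)%R) by (apply Rlt_div_r; lra).
    assert (Hh' : (Cmod (z - (p, q)) < d)%R).
    { eapply Rle_lt_trans; [apply Cmod_le_abs|]. eapply Rle_lt_trans; [|exact Hkd].
      assert (Rabs (Re (z - (p, q))) <= k * w)%R by (apply Rabs_le; unfold Re in *; simpl; lra).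
      assert (Rabs (Im (z - (p, q))) <= k * h)%R by (apply Rabs_le; unfold Im in *; simpl; lra). lra. }
    specialize (Hd _ Hh').
    assert (E : forall u v : C, u + (v - u) = v) by (intros; ring). rewrite E in Hd.
    replace (f z) with ((f z - f (p, q)) + f (p, q)) by ring.
    eapply Rle_trans; [apply Cmod_triangle|]. lra. }
destruct HQ as [B HB]. exists B. intros z Hz. apply HB; exact Hz.
Qed.

Lemma unif_holo_model_rect F : (forall z, model_rect z -> cdiff F z) -> unif_holo model_rect F.
Proof.
intros H. destruct (cdiff_rect_bounded F (-2) (-1) 4 1 ltac:(lra) ltac:(lra)) as [B HB].
- replace (-2 + 4)%R with 2%R by ring. replace (-1 + 1)%R with 0%R by ring. exact H.
- replace (-2 + 4)%R with 2%R in HB by ring. replace (-1 + 1)%R with 0%R in HB by ring.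
  now apply (unif_holo_of_bounded model_rect F B).
Qed.

Lemma is_series_CR (u : nat -> C) (l : C) : is_cseries u l <->
  forall eps : R, (0 < eps)%R -> exists n0, forall n, (n0 <= n)%nat -> (Cmod (csum u n - l) < eps)%R.
Proof.
split.
- intros H eps He.
  assert (He2 : (0 < eps / 2)%R) by lra.
  destruct (proj1 (filterlim_locally (F := eventually) (U := CR) (csum u) l) H (mkposreal _ He2)) as [n0 Hn0].
  exists n0. intros n Hn. destruct (Hn0 n Hn) as [H1 H2].
  change (Rabs (Re (csum u n) - Re l) < eps / 2)%R in H1.
  change (Rabs (Im (csum u n) - Im l) < eps / 2)%R in H2.
  eapply Rle_lt_trans; [apply Cmod_le_abs|].
  change (Rabs (Re (csum u n) - Re l) + Rabs (Im (csum u n) - Im l) < eps)%R. lra.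
- intros H. apply (filterlim_locally (F := eventually) (U := CR)). intros eps.
  destruct (H eps (cond_pos eps)) as [n0 Hn0].
  exists n0. intros n Hn. specialize (Hn0 n Hn). split.
  + change (Rabs (Re (csum u n - l)) < eps)%R. eapply Rle_lt_trans; [apply re_le_Cmod|exact Hn0].
  + change (Rabs (Im (csum u n - l)) < eps)%R. eapply Rle_lt_trans; [apply im_le_Cmod|exact Hn0].
Qed.

Lemma geom_partial (u : nat -> C) (D rho : R) : (0 <= rho < 1)%R -> (forall k, Cmod (u k) <= D * rho ^ k)%R ->
  forall N k, (Cmod (csum u (N + k) - csum u N) <= D / (1 - rho) * (rho ^ S N - rho ^ S (N + k)))%R.
Proof.
intros Hr Hu N k. induction k as [|k IH].
- rewrite Nat.add_0_r.
  match goal with |- (Cmod ?x <= _)%R => replace x with (RtoC 0) by ring end. rewrite Cmod_0.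
  right. ring.
- rewrite Nat.add_succ_r, sum_Sn.
  match goal with |- (Cmod ?x <= _)%R => replace x with
    ((csum u (N + k) - csum u N) + u (S (N + k)))
    by (change (csum u (N + k) - csum u N + u (S (N + k)) = csum u (N + k) + u (S (N + k)) - csum u N); ring) end.
  eapply Rle_trans; [apply Cmod_triangle|].
  specialize (Hu (S (N + k))).
  replace (D / (1 - rho) * (rho ^ S N - rho ^ S (S (N + k))))%R with
    (D / (1 - rho) * (rho ^ S N - rho ^ S (N + k)) + D * rho ^ S (N + k))%R by (simpl; field; lra).
  lra.
Qed.

(** Domination by a geometric series is the only source of uniform convergence
    below. *)
Lemma geom_tail (u : nat -> C) (l : C) (D rho : R) : (0 <= rho < 1)%R -> (forall k, Cmod (u k) <= D * rho ^ k)%R ->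
  is_cseries u l -> forall N, (Cmod (csum u N - l) <= D / (1 - rho) * rho ^ S N)%R.
Proof.
intros Hr Hu Hl N. apply le_epsilon. intros eps He. rewrite is_series_CR in Hl.
destruct (Hl eps He) as [n0 Hn0]. specialize (Hn0 (N + n0)%nat ltac:(lia)).
assert (H := geom_partial u D rho Hr Hu N n0).
replace (csum u N - l) with (- (csum u (N + n0) - csum u N) + (csum u (N + n0) - l)) by ring.
eapply Rle_trans; [apply Cmod_triangle|]. rewrite Cmod_opp.
assert (HD : (0 <= D)%R).
{ specialize (Hu O). simpl in Hu. assert (H1 := Cmod_ge_0 (u O)). lra. }
assert (Hp : (0 <= D / (1 - rho) * rho ^ S (N + n0))%R).
{ apply Rmult_le_pos; [apply Rdiv_le_0_compat; lra|apply pow_le; lra]. }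
rewrite Rmult_minus_distr_l in H. lra.
Qed.

Lemma geom_ex (u : nat -> C) (D rho : R) : (0 <= rho < 1)%R -> (forall k, Cmod (u k) <= D * rho ^ k)%R ->
  exists l, is_cseries u l.
Proof.
intros Hr Hu. apply (ex_series_le (V := CRc) u (fun k => D * rho ^ k)%R).
- intros n. change (norm (V := CR) (u n) <= D * rho ^ n)%R. rewrite norm_CR. apply Hu.
- apply (ex_series_scal (V := R_NormedModule) D (fun k => rho ^ k)%R). apply ex_series_geom. rewrite Rabs_pos_eq; lra.
Qed.

Lemma Zseries_geom_ex (T : Z -> C) (D rho : R) : (0 <= rho < 1)%R ->
  (forall n, Cmod (T n) <= D * rho ^ Z.abs_nat n)%R -> exists l, is_Zseries T l.
Proof.
intros Hr HT. 
assert (HD : (0 <= D)%R).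
{ specialize (HT 0%Z). simpl in HT. assert (H1 := Cmod_ge_0 (T 0%Z)). lra. }
destruct (geom_ex (fun n => T (Z.of_nat n)) D rho Hr) as [l1 H1].
{ intros k. specialize (HT (Z.of_nat k)). now rewrite Zabs2Nat.id in HT. }
destruct (geom_ex (fun n => T (- Z.of_nat (S n))%Z) D rho Hr) as [l2 H2].
{ intros k. specialize (HT (- Z.of_nat (S k))%Z). replace (Z.abs_nat (- Z.of_nat (S k))) with (S k) in HT by lia.
  eapply Rle_trans; [exact HT|]. apply Rmult_le_compat_l; [lra|]. simpl.
  assert (H := pow_le rho k (proj1 Hr)). nra. }
exists (l1 + l2), l1, l2. auto.
Qed.

Lemma sum_n_cdiff (T : nat -> C -> C) (z : C) N : (forall n, cdiff (T n) z) ->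
  cdiff (fun z => csum (fun n => T n z) N) z.
Proof.
intros H. induction N as [|N IH].
- destruct (H O) as [l Hl]. exists l. apply (is_cderive_ext (T O)); [|exact Hl].
  intros t. now rewrite sum_O.
- destruct (cdiff_plus _ _ z IH (H (S N))) as [l Hl]. exists l.
  refine (is_cderive_ext _ _ _ _ _ Hl).
  intros t. rewrite sum_Sn. reflexivity.
Qed.

Lemma unif_holo_series (K : C -> Prop) (T : nat -> C -> C) (S : C -> C) (D rho : R) : (0 <= rho < 1)%R ->
  (forall n z, K z -> cdiff (T n) z) -> (forall n z, K z -> Cmod (T n z) <= D * rho ^ n)%R ->
  (forall z, K z -> is_cseries (fun n => T n z) (S z)) -> unif_holo K S.
Proof.
intros Hr HT HD HS.
assert (Htail : forall z, K z -> forall N, (Cmod (csum (fun n => T n z) N - S z) <= D / (1 - rho) * rho ^ (Datatypes.S N))%R).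
{ intros z Hz. apply geom_tail; auto. }
exists (fun N z => csum (fun n => T n z) N). repeat split.
- intros N z Hz. apply sum_n_cdiff. auto.
- exists (Rabs D + Rabs D / (1 - rho))%R. intros n z Hz.
  assert (H := geom_partial (fun n => T n z) D rho Hr (fun k => HD k z Hz) 0 n).
  rewrite Nat.add_0_l, sum_O in H. assert (H0 := HD O z Hz). simpl in H, H0.
  replace (csum (fun n => T n z) n) with ((csum (fun n => T n z) n - T O z) + T O z)
    by (generalize (T O z); generalize (csum (fun n => T n z) n : C); intros c1 c2; ring).
  eapply Rle_trans; [apply Cmod_triangle|].
  assert (HD0 : (0 <= D)%R) by (assert (H1 := Cmod_ge_0 (T O z)); lra).
  rewrite (Rabs_pos_eq D) by exact HD0.
  assert (Hp : (D / (1 - rho) * (rho * 1 - rho * rho ^ n) <= D / (1 - rho))%R).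
  { rewrite <- (Rmult_1_r (D / (1 - rho))) at 2. apply Rmult_le_compat_l; [apply Rdiv_le_0_compat; lra|].
    assert (H2 := pow_le rho n (proj1 Hr)). nra. }
  lra.
- intros eps He.
  destruct (classic (exists z, K z)) as [[z1 Hz1]|HN].
  2:{ exists O. intros n z _ Hz. exfalso. apply HN. now exists z. }
  assert (HD0 : (0 <= D)%R) by (assert (H1 := Cmod_ge_0 (T O z1)); assert (H0 := HD O z1 Hz1); simpl in H0; lra).
  assert (HC : (0 < D / (1 - rho) + 1)%R) by (assert (0 <= D / (1 - rho))%R by (apply Rdiv_le_0_compat; lra); lra).
  destruct (pow_lt_1_zero rho ltac:(rewrite Rabs_pos_eq; lra) (eps / (D / (1 - rho) + 1))%R) as [n0 Hn0].
  { apply Rdiv_lt_0_compat; lra. }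
  exists n0. intros n z Hn Hz. eapply Rle_trans; [apply (Htail z Hz)|].
  specialize (Hn0 (Datatypes.S n) ltac:(lia)). rewrite Rabs_pos_eq in Hn0 by (apply pow_le; lra).
  apply Rlt_div_r in Hn0; [|lra]. assert (H2 := pow_le rho (Datatypes.S n) (proj1 Hr)). nra.
Qed.

Lemma unif_holo_Zseries (K : C -> Prop) (T : Z -> C -> C) (S : C -> C) (D rho : R) : (0 <= rho < 1)%R ->
  (forall n z, K z -> cdiff (T n) z) -> (forall n z, K z -> Cmod (T n z) <= D * rho ^ Z.abs_nat n)%R ->
  (forall z, K z -> is_Zseries (fun n => T n z) (S z)) -> unif_holo K S.
Proof.
intros Hr HT HD HS.
set (S1 := fun z => epsilon (inhabits (RtoC 0)) (fun l => is_cseries (fun n => T (Z.of_nat n) z) l)).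
set (S2 := fun z => epsilon (inhabits (RtoC 0)) (fun l => is_cseries (fun n => T (- Z.of_nat (Datatypes.S n))%Z z) l)).
assert (U : forall u a b, is_cseries u a -> is_cseries u b -> a = b).
{ intros u a b Ha Hb. exact (filterlim_locally_unique (V := CR) (F := eventually) _ _ _ Ha Hb). }
apply (unif_holo_ext K (fun z => S1 z + S2 z)).
- intros z Hz. destruct (HS z Hz) as [l1 [l2 [H1 [H2 ->]]]]. f_equal.
  + apply (U _ _ _ (epsilon_spec (inhabits (RtoC 0)) _ (ex_intro _ l1 H1)) H1).
  + apply (U _ _ _ (epsilon_spec (inhabits (RtoC 0)) _ (ex_intro _ l2 H2)) H2).
- apply unif_holo_plus.
  + apply (unif_holo_series K (fun n => T (Z.of_nat n)) S1 D rho Hr); [intros; now apply HT| |].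
    * intros n z Hz. specialize (HD (Z.of_nat n) z Hz). now rewrite Zabs2Nat.id in HD.
    * intros z Hz. destruct (HS z Hz) as [l1 [l2 [H1 [H2 E]]]].
      exact (epsilon_spec (inhabits (RtoC 0)) _ (ex_intro _ l1 H1)).
  + apply (unif_holo_series K (fun n => T (- Z.of_nat (Datatypes.S n))%Z) S2 D rho Hr); [intros; now apply HT| |].
    * intros n z Hz. assert (HD' := HD (- Z.of_nat (Datatypes.S n))%Z z Hz).
      replace (Z.abs_nat (- Z.of_nat (Datatypes.S n))) with (Datatypes.S n) in HD' by lia. eapply Rle_trans; [exact HD'|].
      assert (H0 := HD 0%Z z Hz). simpl in H0. assert (H1 := Cmod_ge_0 (T 0%Z z)).
      apply Rmult_le_compat_l; [lra|]. simpl.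
      assert (H := pow_le rho n (proj1 Hr)). nra.
    * intros z Hz. destruct (HS z Hz) as [l1 [l2 [H1 [H2 E]]]].
      exact (epsilon_spec (inhabits (RtoC 0)) _ (ex_intro _ l2 H2)).
Qed.

(** * The theta series *)

Lemma Cmod_qexp (n : Z) (z : C) : Cmod (qexp n z) = exp (- (2 * PI * IZR n * Im z)).
Proof.
unfold qexp. rewrite Cmod_Cexp. f_equal. unfold Ci, RtoC, Cmult, Re, Im; simpl. ring.
Qed.

Lemma cdiff_qexp (n : Z) (f : C -> C) (z : C) : cdiff f z -> cdiff (fun t => qexp n (f t)) z.
Proof. intros [l Hl]. unfold qexp. cdiff. exact Hl. Qed.

Lemma is_series_components (u : nat -> C) (l : C) : is_cseries u l ->
  is_series (fun n => Re (u n)) (Re l) /\ is_series (fun n => Im (u n)) (Im l).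
Proof.
intros H. rewrite is_series_CR in H.
assert (E1 : forall n, sum_n (fun n => Re (u n)) n = Re (csum u n)).
{ induction n as [|n IH]; [now rewrite !sum_O|]. rewrite !sum_Sn, IH. reflexivity. }
assert (E2 : forall n, sum_n (fun n => Im (u n)) n = Im (csum u n)).
{ induction n as [|n IH]; [now rewrite !sum_O|]. rewrite !sum_Sn, IH. reflexivity. }
split.
- apply (filterlim_locally (F := eventually) (U := R_UniformSpace)). intros eps.
  destruct (H eps (cond_pos eps)) as [n0 Hn0]. exists n0. intros n Hn.
  change (Rabs (sum_n (fun n => Re (u n)) n - Re l) < eps)%R. rewrite E1.
  eapply Rle_lt_trans; [|exact (Hn0 n Hn)]. apply (re_le_Cmod (csum u n - l)).
- apply (filterlim_locally (F := eventually) (U := R_UniformSpace)). intros eps.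
  destruct (H eps (cond_pos eps)) as [n0 Hn0]. exists n0. intros n Hn.
  change (Rabs (sum_n (fun n => Im (u n)) n - Im l) < eps)%R. rewrite E2.
  eapply Rle_lt_trans; [|exact (Hn0 n Hn)]. apply (im_le_Cmod (csum u n - l)).
Qed.

Lemma CSeries_correct (u : nat -> C) : (exists l, is_cseries u l) -> is_cseries u (CSeries u).
Proof.
intros [l Hl]. replace (CSeries u) with l; [exact Hl|].
destruct (is_series_components u l Hl) as [H1 H2].
unfold CSeries. rewrite (is_series_unique _ _ H1), (is_series_unique _ _ H2). now destruct l.
Qed.

Definition theta_index (n : nat) : Z := (Z.of_nat (S n) * Z.of_nat (S n))%Z.

Lemma theta_term_le (d : R) (z : C) (n : nat) : (0 < d)%R -> (d <= Im z)%R ->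
  (Cmod (qexp (theta_index n) z) <= exp (- (2 * PI * d)) * exp (- (2 * PI * d)) ^ n)%R.
Proof.
intros Hd Hz. rewrite Cmod_qexp.
assert (E : (exp (- (2 * PI * d)) ^ n = exp (INR n * (- (2 * PI * d))))%R).
{ induction n as [|n IH]; [simpl; now rewrite Rmult_0_l, exp_0|].
  rewrite S_INR, Rmult_plus_distr_r, exp_plus, <- IH. simpl. rewrite Rmult_1_l. ring. }
rewrite E, <- exp_plus. apply exp_le_le.
unfold theta_index. rewrite mult_IZR, <- INR_IZR_INZ, S_INR. assert (H := pos_INR n). assert (HP := PI_RGT_0).
set (x := INR n) in *.
assert (H1 : (d * (x + 1) <= (x + 1) * (x + 1) * Im z)%R).
{ apply Rle_trans with (Im z * (x + 1))%R; [apply Rmult_le_compat_r; lra|].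
  assert (0 <= Im z * x * (x + 1))%R by (apply Rmult_le_pos; [apply Rmult_le_pos|]; lra). nra. }
assert (H2 := Rmult_le_compat_l (2 * PI) _ _ ltac:(lra) H1). lra.
Qed.

Lemma rho_lt_1 (d : R) : (0 < d)%R -> (0 <= exp (- (2 * PI * d)) < 1)%R.
Proof.
intros Hd. split; [left; apply exp_pos|]. rewrite <- exp_0. apply exp_increasing.
assert (HP := PI_RGT_0). nra.
Qed.

Lemma theta_series (z : C) : upper_half_plane z ->
  is_cseries (fun n => qexp (theta_index n) z) (CSeries (fun n => qexp (theta_index n) z)).
Proof.
intros Hz. apply CSeries_correct.
apply (geom_ex _ (exp (- (2 * PI * Im z))) (exp (- (2 * PI * Im z)))); [now apply rho_lt_1|].
intros k. apply theta_term_le; [exact Hz|lra].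
Qed.

Lemma unif_holo_theta (K : C -> Prop) (psi : C -> C) (d : R) : (0 < d)%R ->
  (forall z, K z -> cdiff psi z) -> (forall z, K z -> d <= Im (psi z))%R -> unif_holo K (fun z => theta (psi z)).
Proof.
intros Hd Hpsi HIm. unfold theta. apply unif_holo_plus; [apply unif_holo_const|]. apply (unif_holo_mult K (fun _ => 2)); [apply unif_holo_const|].
apply (unif_holo_series K (fun n z => qexp (theta_index n) (psi z)) _ (exp (- (2 * PI * d))) (exp (- (2 * PI * d)))).
- now apply rho_lt_1.
- intros n z Hz. apply cdiff_qexp. auto.
- intros n z Hz. apply theta_term_le; auto.
- intros z Hz. apply theta_series. unfold upper_half_plane. specialize (HIm z Hz). lra.
Qed.

(** For Im z >= 1 one has |q| <= e^{-2 pi} < 1/7, so 2 sum |q^{n^2}| < 1. *)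
Lemma theta_nz (z : C) : (1 <= Im z)%R -> theta z <> 0.
Proof.
intros Hz H.
set (rho := exp (- (2 * PI * 1))).
assert (Hrho : (0 <= rho <= 1 / 7)%R).
{ split; [left; apply exp_pos|]. unfold rho. rewrite exp_Ropp.
  assert (HP := PI2_3_2). assert (HP' := exp_ineq1_le (2 * PI * 1)).
  rewrite <- (Rinv_inv (1 / 7)). apply Rinv_le_contravar; [|]. 
  - apply Rinv_0_lt_compat; lra.
  - replace (/ (1 / 7))%R with 7%R by field. lra. }
assert (Hs := theta_series z ltac:(unfold upper_half_plane; lra)).
assert (Hb : forall k, (Cmod (qexp (theta_index k) z) <= rho * rho ^ k)%R) by (intros; apply theta_term_le; lra).
assert (Ht := geom_tail _ _ rho rho ltac:(lra) Hb Hs O). rewrite sum_O in Ht. specialize (Hb O).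
set (s := CSeries (fun n => qexp (theta_index n) z)) in *. simpl in Ht, Hb.
change (1 + 2 * s = 0) in H.
assert (Hs1 : (Cmod s <= 2 / 7)%R).
{ replace s with (qexp (theta_index 0) z + - (qexp (theta_index 0) z - s)) by ring.
  eapply Rle_trans; [apply Cmod_triangle|]. rewrite Cmod_opp.
  assert (Hr : (rho / (1 - rho) * (rho * 1) <= 1 / 7)%R).
  { assert (H1 : (rho / (1 - rho) <= 1)%R) by (apply Rle_div_l; lra).
    assert (H0 : (0 <= rho / (1 - rho))%R) by (apply Rdiv_le_0_compat; lra). nra. }
  lra. }
assert (H1 : Cmod (2 * s) = 1%R).
{ replace (2 * s) with (- (1)) ; [apply Cmod_m1|]. replace (2 * s) with ((1 + 2 * s) - 1) by ring. rewrite H. ring. }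
rewrite Cmod_mult, Cmod_R, Rabs_pos_eq in H1 by lra. lra.
Qed.

Lemma Cconj_Cexp (z : C) : Cconj (Cexp z) = Cexp (Cconj z).
Proof.
unfold Cexp, Cconj, Cmult, RtoC, Re, Im; simpl. rewrite cos_neg, sin_neg. f_equal; ring.
Qed.

(** The coefficients are real. *)
Lemma theta_conj (z : C) : Cconj (theta z) = theta (- Cconj z).
Proof.
assert (E : forall n, qexp (theta_index n) (- Cconj z) = Cconj (qexp (theta_index n) z)).
{ intros n. unfold qexp. rewrite Cconj_Cexp. f_equal. destruct z as [a b].
  unfold Cconj, Ci, RtoC, Cmult, Copp; simpl. f_equal; ring. }
change (Cconj (1 + 2 * CSeries (fun n => qexp (theta_index n) z)) = 1 + 2 * CSeries (fun n => qexp (theta_index n) (- Cconj z))).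
unfold CSeries.
rewrite (Series_ext (fun n => Re (qexp (theta_index n) (- Cconj z))) (fun n => Re (qexp (theta_index n) z))) by (intros n; now rewrite E).
rewrite (Series_ext (fun n => Im (qexp (theta_index n) (- Cconj z))) (fun n => - Im (qexp (theta_index n) z))%R) by (intros n; now rewrite E).
rewrite Series_opp.
unfold theta_index. unfold Cconj, RtoC, Cplus, Cmult; simpl. f_equal; ring.
Qed.

(** The Cayley transform sends the unit disc to the upper half plane; the imaginary
    part is a Poisson kernel. *)
Lemma cayley_im (x y : R) (c : C) : 1 - c <> 0 ->
  Im (RtoC x + Ci * RtoC y * ((1 + c) / (1 - c))) = (y * ((1 - Cmod c ^ 2) / Cmod (1 - c) ^ 2))%R.
Proof.
intros Hn. rewrite Cmod_gt_0 in Hn.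
assert (Hn2 : (0 < Cmod (1 - c) ^ 2)%R) by (apply pow_lt; exact Hn). clear Hn.
rewrite Cmod2_alt in Hn2 |- *. rewrite Cmod2_alt.
destruct c as [a b]. unfold Cdiv, Cinv, Cminus, Cplus, Cmult, Copp, Ci, RtoC, Re, Im in *; simpl in *.
field. intros H0. lra.
Qed.

(** A zero segment on a vertical line would propagate to arbitrarily high points.
    The map t -> e exp(-K t^2) sends the real axis to ]0, e] and -i to e exp(K) = 1 - d;
    followed by the Cayley transform scaled by y1, it maps the top side of the
    rectangle into the segment and -i to height at least 1, where theta has no zero. *)
Lemma theta_vertical (x0 y1 y2 : R) : (0 < y1 < y2)%R -> (forall y, y1 <= y <= y2 -> theta (x0, y) = 0)%R -> False.
Proof.
intros Hy H.
set (d := Rmin y1 (1 / 2)). assert (Hd : (0 < d)%R) by (apply Rmin_pos; lra).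
assert (Hd1 := Rmin_l y1 (1 / 2)). assert (Hd2 := Rmin_r y1 (1 / 2)). fold d in Hd1, Hd2.
set (e := Rmin ((y2 - y1) / (y2 + y1)) (1 / 2)).
assert (He : (0 < e)%R) by (apply Rmin_pos; [apply Rdiv_lt_0_compat|]; lra).
assert (He1 := Rmin_l ((y2 - y1) / (y2 + y1)) (1 / 2)). assert (He2 := Rmin_r ((y2 - y1) / (y2 + y1)) (1 / 2)). fold e in He1, He2.
apply Rle_div_r in He1; [|lra].
set (K := ln ((1 - d) / e)).
assert (Hde : (1 <= (1 - d) / e)%R) by (apply Rle_div_r; lra).
assert (HK : (0 <= K)%R).
{ unfold K. rewrite <- ln_1. destruct (Rle_lt_or_eq_dec _ _ Hde) as [Hl|<-]; [left; apply ln_increasing; lra|lra]. }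
assert (HeK : (e * exp K = 1 - d)%R) by (unfold K; rewrite exp_ln by lra; field; lra).
set (f := fun t : C => RtoC e * Cexp (- (RtoC K * (t * t)))).
set (psi := fun t : C => RtoC x0 + Ci * RtoC y1 * ((1 + f t) / (1 - f t))).
assert (Hf : forall z, model_rect z -> (Cmod (f z) <= 1 - d)%R).
{ intros z Hz. unfold f. rewrite Cmod_mult, Cmod_R, Rabs_pos_eq, Cmod_Cexp by lra. rewrite <- HeK.
  apply Rmult_le_compat_l; [lra|]. apply exp_le_le. destruct z as [p q]. unfold model_rect, in_rect in Hz.
  unfold Cmult, Copp, RtoC, Re, Im in *; simpl in *.
  assert (q * q <= 1)%R by nra. nra. }
assert (Hnz : forall c : C, (Cmod c <= 1 - d)%R -> 1 - c <> 0).
{ intros c Hc Hc0. assert (c = 1) by (replace c with (1 - (1 - c)) by ring; rewrite Hc0; ring). subst c.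
  rewrite Cmod_1 in Hc. lra. }
assert (Hcd : forall z, model_rect z -> cdiff psi z).
{ intros z Hz. unfold psi, f. cdiff. apply (Hnz (f z)), Hf, Hz. }
assert (Him : forall c : C, (Cmod c <= 1 - d)%R ->
   Im (RtoC x0 + Ci * RtoC y1 * ((1 + c) / (1 - c))) = (y1 * ((1 - Cmod c ^ 2) / Cmod (1 - c) ^ 2))%R).
{ intros c Hc. now apply cayley_im, Hnz. }
assert (Hlow : forall z, model_rect z -> (y1 * (d / 4) <= Im (psi z))%R).
{ intros z Hz. unfold psi. specialize (Hf z Hz). rewrite Him by exact Hf. apply Rmult_le_compat_l; [lra|].
  assert (H0 := Cmod_ge_0 (f z)).
  assert (Hn := Hnz _ Hf). rewrite Cmod_gt_0 in Hn.
  assert (H1 : (Cmod (1 - f z) <= 2)%R).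
  { unfold Cminus. eapply Rle_trans; [apply Cmod_triangle|]. rewrite Cmod_opp, Cmod_1. lra. }
  apply (proj1 (Rle_div_r _ _ _ (pow_lt _ 2 Hn))).
  assert (Cmod (1 - f z) ^ 2 <= 4)%R by nra. assert (Cmod (f z) ^ 2 <= (1 - d) ^ 2)%R by (apply pow_incr; lra). nra. }
assert (HUL : unif_holo model_rect (fun z => theta (psi z))).
{ apply (unif_holo_theta model_rect psi (y1 * (d / 4))); auto. nra. }
assert (Hreal : forall r : R, (0 < r <= 1 - d)%R -> RtoC x0 + Ci * RtoC y1 * ((1 + RtoC r) / (1 - RtoC r)) = (x0, (y1 * ((1 + r) / (1 - r)))%R)).
{ intros r Hr. unfold Cdiv. rewrite <- RtoC_minus, <- RtoC_plus, <- RtoC_inv, <- RtoC_mult by lra.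
  unfold Ci, RtoC, Cmult, Cplus; simpl. f_equal; unfold Rdiv; ring. }
assert (Hz0 := vanishing_propagates _ HUL). lapply Hz0; clear Hz0.
- intros Hz0. cbv beta in Hz0. revert Hz0. apply theta_nz.
  unfold psi. replace (f (0, (-1)%R)) with (RtoC (1 - d)).
  + rewrite Hreal by lra. simpl. replace (1 - (1 - d))%R with d by ring.
    rewrite <- (Rmult_1_r 1) at 1. 
    replace (y1 * ((1 + (1 - d)) / d))%R with ((y1 / d) * (2 - d))%R by (field; lra).
    assert (1 <= y1 / d)%R by (apply Rle_div_r; lra). nra.
  + unfold f. replace (- (RtoC K * ((0, (-1)%R) * (0, (-1)%R)))) with (RtoC K)
      by (unfold RtoC, Cmult, Copp; simpl; f_equal; ring).
    now rewrite Cexp_RtoC, <- RtoC_mult, HeK.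
- intros x Hx. unfold psi. replace (f (x, 0%R)) with (RtoC (e * exp (- (K * (x * x))))).
  2:{ unfold f. rewrite RtoC_mult, <- Cexp_RtoC. do 2 f_equal. unfold RtoC, Cmult, Copp; simpl; f_equal; ring. }
  set (r := (e * exp (- (K * (x * x))))%R).
  assert (Hr : (0 < r <= e)%R).
  { assert (H1 := exp_pos (- (K * (x * x)))). split; [unfold r; nra|].
    rewrite <- (Rmult_1_r e). unfold r. apply Rmult_le_compat_l; [lra|]. rewrite <- exp_0. apply exp_le_le. nra. }
  rewrite Hreal by lra. apply H.
  replace (y1 * ((1 + r) / (1 - r)))%R with ((y1 * (1 + r)) / (1 - r))%R by (field; lra).
  split; [apply Rle_div_r; nra|apply Rle_div_l; nra].
Qed.

(** * Primitives of entire functions and the mean value inequality *)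

Lemma is_cderive_scal (c z : C) : is_cderive (fun t => c * t) z c.
Proof. eapply is_cderive_eq; [cder|cbv beta; ring]. Qed.

Section Primitive.
Variable f : C -> C.
Hypothesis Hf : forall z, cdiff f z.

Lemma ex_hint_entire (y a b : R) : ex_RInt (V := CRc) (fun t => f (t, y)) a b.
Proof. apply (ex_RInt_continuous (V := CRc)). intros t _. now apply cdiff_cont_h. Qed.

Lemma ex_vint_entire (x a b : R) : ex_RInt (V := CRc) (fun t => Ci * f (x, t)) a b.
Proof. apply (ex_RInt_continuous (V := CRc)). intros t _. now apply cdiff_cont_v. Qed.

Lemma hint_swap (y a b : R) : hint f y b a = - hint f y a b.
Proof. symmetry. exact (opp_RInt_swap (V := CRc) _ a b (ex_hint_entire y a b)). Qed.

Lemma vint_swap (x a b : R) : vint f x b a = - vint f x a b.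
Proof. symmetry. exact (opp_RInt_swap (V := CRc) _ a b (ex_vint_entire x a b)). Qed.

Lemma hint_point (y a : R) : hint f y a a = 0.
Proof. exact (RInt_point (V := CRc) a _). Qed.

Lemma vint_point (x a : R) : vint f x a a = 0.
Proof. exact (RInt_point (V := CRc) a _). Qed.

(** Degenerate and reversed rectangles are included so that the primitive below
    needs no case distinction. *)
Lemma bdry_entire (a b c d : R) : bdry f a b c d = 0.
Proof.
assert (H0 : forall a b c d, (a < b -> c < d -> bdry f a b c d = 0)%R).
{ clear a b c d. intros a b c d H1 H2. assert (H := goursat f a c (b - a) (d - c) ltac:(lra) ltac:(lra) (fun z _ => Hf z)).
  replace (a + (b - a))%R with b in H by ring. now replace (c + (d - c))%R with d in H by ring. }
assert (H1 : forall a b c d, (a < b -> bdry f a b c d = 0)%R).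
{ clear a b c d. intros a b c d Hab. destruct (Rtotal_order c d) as [H|[->|H]]; [now apply H0| |].
  - unfold bdry. rewrite !vint_point. ring.
  - specialize (H0 a b d c Hab H). unfold bdry in *. rewrite (vint_swap b d c), (vint_swap a d c).
    match goal with |- ?x = _ => replace x with (- 0) by (rewrite <- H0; ring) end. ring. }
destruct (Rtotal_order a b) as [H|[->|H]]; [now apply H1| |].
- unfold bdry. rewrite !hint_point. ring.
- specialize (H1 b a c d H). unfold bdry in *. rewrite (hint_swap c b a), (hint_swap d b a).
  match goal with |- ?x = _ => replace x with (- 0) by (rewrite <- H1; ring) end. ring.
Qed.

(** The integral along the horizontal and then the vertical side. *)
Definition cprimitive (z : C) : C := hint f 0 0 (Re z) + vint f (Re z) 0 (Im z).

(** Closing up with a rectangle replaces the difference of two integrals from the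
    origin by the integral along a short path. *)
Lemma primitive_step (x y u v : R) :
  cprimitive ((x, y) + (u, v)) - cprimitive (x, y) = hint f y x (x + u) + vint f (x + u) y (y + v).
Proof.
unfold cprimitive; simpl. 
replace (hint f 0 0 (x + u)) with (hint f 0 0 x + hint f 0 x (x + u))
  by exact (RInt_Chasles (V := CRc) _ 0 x (x + u) (ex_hint_entire 0 0 x) (ex_hint_entire 0 x (x + u))).
replace (vint f (x + u) 0 (y + v)) with (vint f (x + u) 0 y + vint f (x + u) y (y + v))
  by exact (RInt_Chasles (V := CRc) _ 0 y (y + v) (ex_vint_entire (x + u) 0 y) (ex_vint_entire (x + u) y (y + v))).
assert (H := bdry_entire x (x + u) 0 y). unfold bdry in H.
match goal with |- ?l = ?r => replace l with ((l - r) + r) by ring end.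
match goal with |- ?l + ?r = ?r => replace l with (RtoC 0); [ring|] end.
rewrite <- H. ring.
Qed.

Lemma hint_dev (c : C) (y a u M : R) : (forall t, Rabs (t - a) <= Rabs u -> Cmod (f (t, y) - c) <= M)%R ->
  (Cmod (hint f y a (a + u) - RtoC u * c) <= Rabs u * M)%R.
Proof.
intros H.
assert (P : forall a b, (a <= b)%R -> (forall t, a <= t <= b -> Cmod (f (t, y) - c) <= M)%R ->
   (Cmod (hint f y a b - RtoC (b - a) * c) <= (b - a) * M)%R).
{ clear a u H. intros a b Hab H.
  assert (E : RtoC (b - a) * c = hint (fun _ => c) y a b).
  { rewrite (hint_prim (fun z => c * z) (fun _ => c) y a b Hab).
    - replace ((b, y) : C) with (RtoC b + (0, y)%R) by (unfold RtoC, Cplus; simpl; f_equal; ring).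
      replace ((a, y) : C) with (RtoC a + (0, y)%R) by (unfold RtoC, Cplus; simpl; f_equal; ring).
      cbv beta. rewrite RtoC_minus. ring.
    - intros t _. apply is_cderive_scal.
    - intros t _. apply cdiff_const. }
  rewrite E, <- hint_minus; [|exact Hab|intros; apply Hf|intros; apply cdiff_const].
  apply hint_le; [exact Hab| |exact H]. intros t _. apply cdiff_minus; [apply Hf|apply cdiff_const]. }
destruct (Rle_dec 0 u) as [Hu|Hu].
- specialize (P a (a + u)%R ltac:(lra)). replace (a + u - a)%R with u in P by ring.
  rewrite Rabs_pos_eq by lra. apply P. intros t Ht. apply H. rewrite !Rabs_pos_eq; lra.
- specialize (P (a + u)%R a ltac:(lra)). replace (a - (a + u))%R with (- u)%R in P by ring.
  rewrite Rabs_left1 by lra. rewrite hint_swap.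
  replace (- hint f y (a + u) a - RtoC u * c) with (- (hint f y (a + u) a - RtoC (- u) * c)) by (rewrite RtoC_opp; ring).
  rewrite Cmod_opp. apply P. intros t Ht. apply H. rewrite !Rabs_left1; lra.
Qed.

Lemma vint_dev (c : C) (x a u M : R) : (forall t, Rabs (t - a) <= Rabs u -> Cmod (f (x, t) - c) <= M)%R ->
  (Cmod (vint f x a (a + u) - Ci * RtoC u * c) <= Rabs u * M)%R.
Proof.
intros H.
assert (P : forall a b, (a <= b)%R -> (forall t, a <= t <= b -> Cmod (f (x, t) - c) <= M)%R ->
   (Cmod (vint f x a b - Ci * RtoC (b - a) * c) <= (b - a) * M)%R).
{ clear a u H. intros a b Hab H.
  assert (E : Ci * RtoC (b - a) * c = vint (fun _ => c) x a b).
  { rewrite (vint_prim (fun z => c * z) (fun _ => c) x a b Hab).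
    - replace ((x, b) : C) with (Ci * RtoC b + RtoC x) by (unfold Ci, RtoC, Cmult, Cplus; simpl; f_equal; ring).
      replace ((x, a) : C) with (Ci * RtoC a + RtoC x) by (unfold Ci, RtoC, Cmult, Cplus; simpl; f_equal; ring).
      cbv beta. rewrite RtoC_minus. ring.
    - intros t _. apply is_cderive_scal.
    - intros t _. apply cdiff_const. }
  rewrite E, <- vint_minus; [|exact Hab|intros; apply Hf|intros; apply cdiff_const].
  apply vint_le; [exact Hab| |exact H]. intros t _. apply cdiff_minus; [apply Hf|apply cdiff_const]. }
destruct (Rle_dec 0 u) as [Hu|Hu].
- specialize (P a (a + u)%R ltac:(lra)). replace (a + u - a)%R with u in P by ring.
  rewrite Rabs_pos_eq by lra. apply P. intros t Ht. apply H. rewrite !Rabs_pos_eq; lra.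
- specialize (P (a + u)%R a ltac:(lra)). replace (a - (a + u))%R with (- u)%R in P by ring.
  rewrite Rabs_left1 by lra. rewrite vint_swap.
  replace (- vint f x (a + u) a - Ci * RtoC u * c) with (- (vint f x (a + u) a - Ci * RtoC (- u) * c)) by (rewrite RtoC_opp; ring).
  rewrite Cmod_opp. apply P. intros t Ht. apply H. rewrite !Rabs_left1; lra.
Qed.

Lemma is_cderive_cprimitive (z : C) : is_cderive cprimitive z (f z).
Proof.
apply is_cderive_spec. intros eps He.
destruct (cdiff_continuous f z (Hf z) (eps / 2)%R ltac:(lra)) as [d [Hd1 Hd]].
exists (d / 2)%R. split; [lra|]. intros h Hh. destruct z as [x y], h as [u v].
rewrite primitive_step.
assert (Hu := re_le_Cmod (u, v)). assert (Hv := im_le_Cmod (u, v)). simpl in Hu, Hv.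
replace (hint f y x (x + u) + vint f (x + u) y (y + v) - f (x, y) * (u, v)) with
  ((hint f y x (x + u) - RtoC u * f (x, y)) + (vint f (x + u) y (y + v) - Ci * RtoC v * f (x, y))).
2:{ replace ((u, v) : C) with (RtoC u + Ci * RtoC v) by (unfold Ci, RtoC, Cmult, Cplus; simpl; f_equal; ring). ring. }
eapply Rle_trans; [apply Cmod_triangle|].
assert (B1 : (Cmod (hint f y x (x + u) - RtoC u * f (x, y)) <= Rabs u * (eps / 2))%R).
{ apply hint_dev. intros t Ht. 
  replace ((t, y) : C) with ((x, y) + RtoC (t - x)) by (unfold RtoC, Cplus; simpl; f_equal; ring).
  apply Hd. rewrite Cmod_R. lra. }
assert (B2 : (Cmod (vint f (x + u) y (y + v) - Ci * RtoC v * f (x, y)) <= Rabs v * (eps / 2))%R).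
{ apply vint_dev. intros t Ht.
  replace (((x + u)%R, t) : C) with ((x, y) + (u, (t - y)%R)) by (unfold Cplus; simpl; f_equal; ring).
  apply Hd. eapply Rle_lt_trans; [apply Cmod_le_abs|]. simpl. lra. }
nra.
Qed.
End Primitive.

Lemma is_rderive_Re (F : R -> C) (t : R) (l : C) : is_rderive F t l -> is_derive (fun s => Re (F s)) t (Re l).
Proof.
intros H. exact (filterdiff_comp' _ _ _ _ _ H (filterdiff_linear _ (is_linear_fst (K := R_AbsRing) (U := R_NormedModule) (V := R_NormedModule)))).
Qed.

Lemma is_rderive_Im (F : R -> C) (t : R) (l : C) : is_rderive F t l -> is_derive (fun s => Im (F s)) t (Im l).
Proof.
intros H. exact (filterdiff_comp' _ _ _ _ _ H (filterdiff_linear _ (is_linear_snd (K := R_AbsRing) (U := R_NormedModule) (V := R_NormedModule)))).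
Qed.

(** The mean value theorem for the component of F in the direction of F b - F a. *)
Lemma mean_value_ineq (F : R -> C) (phi : R -> R) (dF : R -> C) (dphi : R -> R) (a b : R) : (a <= b)%R ->
  (forall t, (a <= t <= b)%R -> is_rderive F t (dF t)) ->
  (forall t, (a <= t <= b)%R -> is_derive phi t (dphi t)) ->
  (forall t, a <= t <= b -> Cmod (dF t) <= dphi t)%R ->
  (Cmod (F b - F a) <= phi b - phi a)%R.
Proof.
intros Hab HF Hphi Hle.
destruct (Req_dec (Cmod (F b - F a)) 0) as [H0|H0].
{ rewrite H0. assert (H := MVT_gen phi a b dphi). rewrite Rmin_left, Rmax_right in H by lra.
  destruct H as [c [Hc1 Hc2]].
  - intros t Ht. apply Hphi. lra.
  - intros t Ht. apply derivable_continuous_pt. exists (dphi t). apply is_derive_Reals, Hphi. lra.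
  - rewrite Hc2. specialize (Hle c Hc1). assert (H1 := Cmod_ge_0 (dF c)). nra. }
set (L := F b - F a) in *. set (l := Cmod L) in *.
assert (Hl : (0 < l)%R) by (assert (H := Cmod_ge_0 L); fold l in H; lra).
set (p := Re L). set (q := Im L).
set (g := fun t => (p * Re (F t) + q * Im (F t))%R).
assert (Hg : forall t, (a <= t <= b)%R -> is_derive g t (p * Re (dF t) + q * Im (dF t))%R).
{ intros t Ht. specialize (HF t Ht).
  assert (H1 : is_derive (fun t => Re (F t)) t (Re (dF t))) by exact (is_rderive_Re _ _ _ HF).
  assert (H2 : is_derive (fun t => Im (F t)) t (Im (dF t))) by exact (is_rderive_Im _ _ _ HF).
  apply (is_derive_plus (V := R_NormedModule) (fun t => p * Re (F t))%R (fun t => q * Im (F t))%R);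
    apply is_derive_scal; assumption. }
assert (H := MVT_gen (fun t => g t - l * phi t)%R a b (fun t => (p * Re (dF t) + q * Im (dF t)) - l * dphi t)%R).
rewrite Rmin_left, Rmax_right in H by lra.
assert (Hd : forall t, (a <= t <= b)%R -> is_derive (fun t => g t - l * phi t)%R t ((p * Re (dF t) + q * Im (dF t)) - l * dphi t)%R).
{ intros t Ht. apply (is_derive_minus (V := R_NormedModule)); [now apply Hg|]. apply is_derive_scal. now apply Hphi. }
destruct H as [c [Hc1 Hc2]].
- intros t Ht. apply Hd. lra.
- intros t Ht. apply derivable_continuous_pt. eexists. apply is_derive_Reals, Hd. lra.
- specialize (Hle c Hc1).
  assert (Hcs : (p * Re (dF c) + q * Im (dF c) <= l * Cmod (dF c))%R).
  { assert (E : (p * Re (dF c) + q * Im (dF c))%R = Re (Cconj L * dF c)).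
    { unfold p, q, Cconj, Cmult, Re, Im; simpl. ring. }
    rewrite E. eapply Rle_trans; [apply Rle_abs|]. eapply Rle_trans; [apply re_le_Cmod|].
    rewrite Cmod_mult, Cmod_conj. fold l. lra. }
  assert (Hgl : (g b - g a = l * l)%R).
  { unfold g. transitivity (p * p + q * q)%R; [unfold p, q, L, Cminus, Cplus, Copp, Re, Im; simpl; ring|].
    assert (H2 := Cmod2_alt L). fold l p q in H2. simpl in H2. lra. }
  assert (H3 : (l * (l - (phi b - phi a)) <= 0)%R).
  { assert (Hx : (p * Re (dF c) + q * Im (dF c) - l * dphi c <= 0)%R) by nra. nra. }
  nra.
Qed.

Lemma cderive_zero_const (f : C -> C) : (forall z, is_cderive f z 0) -> forall z, f z = f 0.
Proof.
intros H z.
assert (H1 : (Cmod (f (0 + RtoC 1 * z)%C - f (0 + RtoC 0 * z)%C) <= 0 - 0)%R).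
{ apply (mean_value_ineq (fun s => f (0 + RtoC s * z)%C) (fun _ => 0%R) (fun _ => (0 * z)%C) (fun _ => 0%R)); [lra| | |].
  - intros t _. apply is_cderive_line, H.
  - intros t _. apply (is_derive_const (K := R_AbsRing) (V := R_NormedModule)).
  - intros t _. rewrite Cmult_0_l, Cmod_0. lra. }
replace (0 + RtoC 1 * z) with z in H1 by ring. replace (0 + RtoC 0 * z) with (RtoC 0) in H1 by ring.
assert (H2 := Cmod_ge_0 (f z - f 0)). assert (H3 : f z - f 0 = 0) by (apply Cmod_eq_0; lra).
replace (f z) with ((f z - f 0) + f 0) by ring. rewrite H3. ring.
Qed.

(** * Integer powers *)

Definition zpow (z : C) (j : Z) : C :=
  match j with
  | Z0 => 1
  | Zpos p => z ^ Pos.to_nat p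
  | Zneg p => (/ z) ^ Pos.to_nat p
  end.

Lemma zpow_nat (z : C) (n : nat) : zpow z (Z.of_nat n) = z ^ n.
Proof. destruct n as [|n]; [reflexivity|]. change (z ^ Pos.to_nat (Pos.of_succ_nat n) = z ^ S n). now rewrite SuccNat2Pos.id_succ. Qed.

Lemma zpow_neg_nat (z : C) (n : nat) : zpow z (- Z.of_nat n) = (/ z) ^ n.
Proof. destruct n as [|n]; [reflexivity|]. change ((/ z) ^ Pos.to_nat (Pos.of_succ_nat n) = (/ z) ^ S n). now rewrite SuccNat2Pos.id_succ. Qed.

Lemma Z_nat_cases (P : Z -> Prop) : (forall n, P (Z.of_nat n)) -> (forall n, P (- Z.of_nat (S n))%Z) -> forall j, P j.
Proof.
intros H1 H2 j. destruct (Z_lt_le_dec j 0) as [H|H].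
- replace j with (- Z.of_nat (S (Z.to_nat (- j - 1))))%Z by lia. apply H2.
- replace j with (Z.of_nat (Z.to_nat j)) by lia. apply H1.
Qed.

Lemma zpow_succ (z : C) (j : Z) : z <> 0 -> zpow z (j + 1) = z * zpow z j.
Proof.
intros Hz. revert j. apply Z_nat_cases; intros n.
- replace (Z.of_nat n + 1)%Z with (Z.of_nat (S n)) by lia. rewrite !zpow_nat. reflexivity.
- replace (- Z.of_nat (S n) + 1)%Z with (- Z.of_nat n)%Z by lia. rewrite !zpow_neg_nat, Cpow_S. field. exact Hz.
Qed.

Lemma zpow_nz (z : C) (j : Z) : z <> 0 -> zpow z j <> 0.
Proof.
intros Hz. revert j. apply Z_nat_cases; intros n.
- rewrite zpow_nat. now apply Cpow_nz.
- rewrite zpow_neg_nat, Cpow_inv by exact Hz. intros H. apply (Cpow_nz z (S n) Hz).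
  replace (z ^ S n) with (z ^ S n * (z ^ S n * / z ^ S n)) by (rewrite Cinv_r; [ring|now apply Cpow_nz]).
  rewrite H. ring.
Qed.

Lemma Z_bi_ind (P : Z -> Prop) (j0 : Z) : P j0 -> (forall j, P j -> P (j + 1)%Z) -> (forall j, P j -> P (j - 1)%Z) ->
  forall j, P j.
Proof.
intros H0 H1 H2.
assert (Hp : forall n, P (j0 + Z.of_nat n)%Z).
{ induction n as [|n IH]; [now rewrite Z.add_0_r|]. replace (j0 + Z.of_nat (S n))%Z with (j0 + Z.of_nat n + 1)%Z by lia. auto. }
assert (Hm : forall n, P (j0 - Z.of_nat n)%Z).
{ induction n as [|n IH]; [now rewrite Z.sub_0_r|]. replace (j0 - Z.of_nat (S n))%Z with (j0 - Z.of_nat n - 1)%Z by lia. auto. }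
intros j. destruct (Z_lt_le_dec j j0) as [H|H].
- replace j with (j0 - Z.of_nat (Z.to_nat (j0 - j)))%Z by lia. apply Hm.
- replace j with (j0 + Z.of_nat (Z.to_nat (j - j0)))%Z by lia. apply Hp.
Qed.

Lemma zpow_pred (z : C) (j : Z) : z <> 0 -> zpow z (j - 1) = / z * zpow z j.
Proof.
intros Hz. replace j with (j - 1 + 1)%Z at 2 by lia. rewrite zpow_succ by exact Hz. field. exact Hz.
Qed.

Lemma zpow_add (z : C) (i j : Z) : z <> 0 -> zpow z (i + j) = zpow z i * zpow z j.
Proof.
intros Hz. revert i. apply (Z_bi_ind _ 0%Z).
- rewrite Z.add_0_l. simpl. ring.
- intros i IH. replace (i + 1 + j)%Z with (i + j + 1)%Z by lia. rewrite !zpow_succ, IH by exact Hz. ring.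
- intros i IH. replace (i - 1 + j)%Z with (i + j - 1)%Z by lia. rewrite !zpow_pred, IH by exact Hz. ring.
Qed.

Lemma zpow_opp_base (z : C) (j : Z) : z <> 0 -> zpow (- z) (2 * j) = zpow z (2 * j).
Proof.
intros Hz. assert (Hz' : - z <> 0) by (intros H; apply Hz; replace z with (- - z) by ring; rewrite H; ring).
revert j. apply (Z_bi_ind _ 0%Z).
- reflexivity.
- intros j IH. replace (2 * (j + 1))%Z with (2 * j + 1 + 1)%Z by lia. rewrite !zpow_succ, IH by assumption. ring.
- intros j IH. replace (2 * (j - 1))%Z with (2 * j - 1 - 1)%Z by lia. rewrite !zpow_pred, IH by assumption. field. auto.
Qed.

Lemma zpow_opp_odd (z : C) (j : Z) : z <> 0 -> zpow (- z) (2 * j - 1) = - zpow z (2 * j - 1).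
Proof.
intros Hz. assert (Hz' : - z <> 0) by (intros H; apply Hz; replace z with (- - z) by ring; rewrite H; ring).
rewrite !zpow_pred, zpow_opp_base by assumption. field. auto.
Qed.

Lemma zpow_mult (a b : C) (j : Z) : a <> 0 -> b <> 0 -> zpow (a * b) j = zpow a j * zpow b j.
Proof.
intros Ha Hb. revert j. apply (Z_bi_ind _ 0%Z).
- simpl. ring.
- intros j IH. rewrite !zpow_succ, IH; auto using Cmult_neq_0. ring.
- intros j IH. rewrite !zpow_pred, IH; auto using Cmult_neq_0. field. auto.
Qed.

Lemma is_cderive_zpow (z : C) (j : Z) : z <> 0 -> is_cderive (fun t => zpow t j) z (RtoC (IZR j) * zpow z (j - 1)).
Proof.
intros Hz. revert j. apply Z_nat_cases; intros n.
- apply (is_cderive_ext (fun t => t ^ n)); [intros t; now rewrite zpow_nat|].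
  destruct n as [|n].
  + eapply is_cderive_eq; [exact (is_cderive_const 1 z)|]. simpl IZR. ring.
  + eapply is_cderive_eq; [cder|]. cbv beta. replace (Z.of_nat (S n) - 1)%Z with (Z.of_nat n) by lia.
    rewrite zpow_nat, INR_IZR_INZ. ring.
- apply (is_cderive_ext (fun t => (/ t) ^ S n)); [intros t; now rewrite zpow_neg_nat|].
  eapply is_cderive_eq; [cder; exact Hz|]. cbv beta.
  replace (- Z.of_nat (S n) - 1)%Z with (- Z.of_nat (S (S n)))%Z by lia.
  rewrite zpow_neg_nat, opp_IZR, <- INR_IZR_INZ, RtoC_opp, !Cpow_S. field. exact Hz.
Qed.

Lemma zpow_RtoC (x : R) (j : Z) : x <> 0%R -> zpow (RtoC x) j = RtoC (powerRZ x j).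
Proof.
intros Hx. revert j. apply Z_nat_cases; intros n.
- now rewrite zpow_nat, <- pow_powerRZ, RtoC_pow.
- rewrite zpow_neg_nat, <- RtoC_inv, <- RtoC_pow by exact Hx. f_equal.
  rewrite powerRZ_neg', <- pow_powerRZ, pow_inv. reflexivity.
Qed.

(** * The error function *)

Definition gexp (z : C) : C := 2 * Cexp (- (z * z)).
Definition erf_prim (z : C) : C := cprimitive gexp z.

Lemma gexp_cdiff (z : C) : cdiff gexp z.
Proof. unfold gexp. cdiff. Qed.

Lemma is_cderive_erf (z : C) : is_cderive erf_prim z (gexp z).
Proof. apply is_cderive_cprimitive. exact gexp_cdiff. Qed.

Lemma erf_0 : erf_prim 0 = 0.
Proof. unfold erf_prim, cprimitive. simpl. rewrite hint_point, vint_point. ring. Qed.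

(** The sum of the values at z and -z has derivative zero. *)
Lemma erf_odd (z : C) : erf_prim (- z) = - erf_prim z.
Proof.
assert (H := cderive_zero_const (fun t => erf_prim t + erf_prim (- t))).
lapply H.
- clear H. intros H. specialize (H z). cbv beta in H.
  replace (- (0)) with (RtoC 0) in H by ring. rewrite erf_0 in H.
  replace (erf_prim (- z)) with ((erf_prim z + erf_prim (- z)) - erf_prim z) by ring. rewrite H. ring.
- intros t. eapply is_cderive_eq.
  + apply is_cderive_plus; [apply is_cderive_erf|].
    apply (is_cderive_comp erf_prim (fun t => - t) t); [apply is_cderive_erf|cder].
  + unfold gexp. replace (- t * - t) with (t * t) by ring. ring.
Qed.

Lemma gexp_mod (z : C) : Cmod (gexp z) = (2 * exp (- (Re (z * z))))%R.
Proof.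
unfold gexp. rewrite Cmod_mult, Cmod_R, Rabs_pos_eq, Cmod_Cexp by lra. f_equal.
Qed.

(** On the ray v + s, s >= 0, the derivative is at most 2 e^{-Re v^2} / (1 + s^2)
    because Re v >= 0; the arctangent bounds the integral. *)
Lemma erf_shift (v : C) (r : R) : (0 <= Re v)%R -> (0 <= r)%R ->
  (Cmod (erf_prim (v + RtoC r) - erf_prim v) <= PI * exp (- Re (v * v)))%R.
Proof.
intros Hv Hr. set (A := exp (- Re (v * v))). assert (HA : (0 < A)%R) by apply exp_pos.
assert (H : (Cmod (erf_prim (v + RtoC r * 1)%C - erf_prim (v + RtoC 0 * 1)%C) <= 2 * A * atan r - 2 * A * atan 0)%R).
{ apply (mean_value_ineq (fun s => erf_prim (v + RtoC s * 1)%C) (fun s => 2 * A * atan s)%R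
    (fun s => (gexp (v + RtoC s * 1) * 1)%C) (fun s => 2 * A * / (1 + s * s))%R); [exact Hr| | |].
  - intros t _. apply is_cderive_line, is_cderive_erf.
  - intros t _. auto_derive; [trivial|]. unfold Rsqr. field. nra.
  - intros t Ht. rewrite Cmult_1_r, gexp_mod, Rmult_assoc. apply Rmult_le_compat_l; [lra|].
    replace (- Re ((v + RtoC t * 1) * (v + RtoC t * 1)))%R with (- Re (v * v) + (- (2 * t * Re v + t * t)))%R.
    2:{ destruct v as [a b]. unfold Cmult, Cplus, RtoC, Re, Im; simpl. ring. }
    rewrite exp_plus. fold A. apply Rmult_le_compat_l; [lra|].
    rewrite exp_Ropp. apply Rinv_le_contravar; [nra|].
    eapply Rle_trans; [|apply exp_ineq1_le]. assert (0 <= t * Re v)%R by (apply Rmult_le_pos; lra). lra. }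
replace (v + RtoC r * 1) with (v + RtoC r) in H by ring. replace (v + RtoC 0 * 1) with v in H by ring.
rewrite atan_0 in H. assert (Hat := atan_bound r). nra.
Qed.

(** The limit c along the positive reals exists by monotonicity and is positive.
    By erf_shift it bounds the distance from v to the far point v + r, and the
    vertical step from v + r to the real axis costs little when r is large. *)
Lemma erf_limit : exists c : C, c <> 0 /\ forall v : C, (0 <= Re v)%R ->
  (Cmod (c - erf_prim v) <= PI * exp (- Re (v * v)))%R.
Proof.
set (e := fun r : R => Re (erf_prim (RtoC r))).
assert (Hline : forall t : R, is_rderive (fun s : R => erf_prim (RtoC s)) t (gexp (RtoC t))).
{ intros t. apply (is_cderive_hline erf_prim t 0%R). apply is_cderive_erf. }
assert (Hg : forall t : R, gexp (RtoC t) = RtoC (2 * exp (- (t * t)))).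
{ intros t. unfold gexp. now rewrite RtoC_mult, <- Cexp_RtoC, RtoC_opp, RtoC_mult. }
assert (He : forall t : R, is_derive e t (2 * exp (- (t * t)))%R).
{ intros t. specialize (Hline t). rewrite Hg in Hline.
  exact (is_rderive_Re _ _ _ Hline). }
assert (Hmono : forall a b, (a < b)%R -> (e a < e b)%R).
{ intros a b Hab. destruct (MVT_gen e a b (fun t => 2 * exp (- (t * t)))%R) as [c [_ Hc]].
  - intros t _. apply He.
  - intros t _. apply derivable_continuous_pt. eexists. apply is_derive_Reals, He.
  - assert (Hx := exp_pos (- (c * c))). nra. }
assert (H0 : e 0%R = 0%R) by (unfold e; now rewrite erf_0).
(* the imaginary part has zero derivative on the real axis *)
assert (Him : forall r : R, (0 <= r)%R -> Im (erf_prim (RtoC r)) = 0%R).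
{ intros r Hr. destruct (MVT_gen (fun t => Im (erf_prim (RtoC t))) 0 r (fun t => 0%R)) as [c [_ Hc]].
  - intros t _. specialize (Hline t). rewrite Hg in Hline.
    exact (is_rderive_Im _ _ _ Hline).
  - intros t _. apply derivable_continuous_pt. exists 0%R. apply is_derive_Reals. specialize (Hline t). rewrite Hg in Hline.
    exact (is_rderive_Im _ _ _ Hline).
  - rewrite erf_0 in Hc. change (Im (erf_prim (RtoC r)) - 0 = 0 * (r - 0))%R in Hc. lra. }
assert (Hreal : forall r, (0 <= r)%R -> erf_prim (RtoC r) = RtoC (e r)).
{ intros r Hr. unfold e. specialize (Him r Hr). destruct (erf_prim (RtoC r)) as [a b]. simpl in *. subst b. reflexivity. }
destruct (completeness (fun s => exists r, (0 <= r)%R /\ s = e r)) as [c [Hc1 Hc2]].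
{ exists PI. intros s [r [Hr ->]]. assert (H := erf_shift 0 r ltac:(simpl; lra) Hr).
  rewrite erf_0 in H. replace (0 + RtoC r) with (RtoC r) in H by ring. rewrite (Hreal r Hr) in H.
  replace (RtoC (e r) - 0) with (RtoC (e r)) in H by ring. rewrite Cmod_R in H.
  replace (- Re (0 * 0))%R with 0%R in H by (simpl; ring). rewrite exp_0 in H. assert (Hx := Rle_abs (e r)). lra. }
{ exists (e 0%R), 0%R. split; [lra|reflexivity]. }
exists (RtoC c). split.
{ assert (e 1%R <= c)%R by (apply Hc1; exists 1%R; split; [lra|reflexivity]).
  assert (H1 := Hmono 0%R 1%R ltac:(lra)). intros H2. apply RtoC_inj in H2. lra. }
intros v Hv. apply le_epsilon. intros eps Heps.
set (a := Re v). set (b := Im v).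
assert (Hlim : exists R0, (0 <= R0)%R /\ forall r, (R0 <= r)%R -> (Cmod (RtoC c - erf_prim (RtoC r)) <= eps / 2)%R).
{ destruct (classic (exists r, (0 <= r)%R /\ (c - eps / 2 <= e r)%R)) as [[R0 [H1 H2]]|HN].
  - exists R0. split; [exact H1|]. intros r Hr. rewrite (Hreal r ltac:(lra)), <- RtoC_minus, Cmod_R.
    assert (e r <= c)%R by (apply Hc1; exists r; split; [lra|reflexivity]).
    assert (e R0 <= e r)%R by (destruct (Rle_lt_or_eq_dec _ _ Hr) as [Hlt|<-]; [left; now apply Hmono|lra]).
    rewrite Rabs_pos_eq; lra.
  - exfalso. assert (c <= c - eps / 2)%R.
    { apply Hc2. intros s [r [Hr ->]]. apply Rnot_lt_le. intros Hlt. apply HN. exists r. split; lra. }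
    lra. }
destruct Hlim as [R0 [HR0 Hlim]].
set (M := (2 * Rabs b * exp (b * b))%R).
assert (HM : (0 <= M)%R) by (unfold M; assert (H1 := Rabs_pos b); assert (H2 := exp_pos (b * b)); nra).
set (r := (R0 + 1 + 2 * M / eps)%R).
assert (HMe : (0 <= 2 * M / eps)%R) by (apply Rdiv_le_0_compat; lra).
assert (Hr : (1 <= r)%R) by (unfold r; lra).
assert (B1 := Hlim (a + r)%R ltac:(unfold a, r; lra)).
assert (B2 := erf_shift v r Hv ltac:(lra)).
assert (B3 : (Cmod (erf_prim (RtoC (a + r)) - erf_prim (v + RtoC r)) <= eps / 2)%R).
{ assert (H : (Cmod (erf_prim (RtoC (a + r) + RtoC 1 * (Ci * RtoC b))%C - erf_prim (RtoC (a + r) + RtoC 0 * (Ci * RtoC b))%C)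
     <= M * exp (- r) * 1 - M * exp (- r) * 0)%R).
  { apply (mean_value_ineq (fun s => erf_prim (RtoC (a + r) + RtoC s * (Ci * RtoC b))%C) (fun s => M * exp (- r) * s)%R
      (fun s => (gexp (RtoC (a + r) + RtoC s * (Ci * RtoC b)) * (Ci * RtoC b))%C) (fun s => M * exp (- r))%R); [lra| | |].
    - intros t _. apply is_cderive_line, is_cderive_erf.
    - intros t _. auto_derive; [trivial|ring].
    - intros t Ht. rewrite !Cmod_mult, Cmod_Ci, Cmod_R, gexp_mod.
      replace (- Re ((RtoC (a + r) + RtoC t * (Ci * RtoC b)) * (RtoC (a + r) + RtoC t * (Ci * RtoC b))))%R
        with (t * b * (t * b) - (a + r) * (a + r))%R by (unfold Cmult, Cplus, Ci, RtoC, Re; simpl; ring).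
      unfold M. replace (2 * exp (t * b * (t * b) - (a + r) * (a + r)) * (1 * Rabs b))%R
        with (2 * Rabs b * exp (t * b * (t * b) - (a + r) * (a + r)))%R by ring.
      rewrite (Rmult_assoc (2 * Rabs b)). apply Rmult_le_compat_l; [assert (H1 := Rabs_pos b); lra|].
      rewrite <- exp_plus. apply exp_le_le. unfold a.
      assert (t * b * (t * b) <= b * b)%R.
      { assert (t * t <= 1)%R by nra. assert (0 <= b * b)%R by nra. nra. }
      assert (r <= (Re v + r) * (Re v + r))%R by nra. lra. }
  replace (RtoC (a + r) + RtoC 1 * (Ci * RtoC b)) with (v + RtoC r) in H.
  2:{ unfold a, b. destruct v as [x y]. unfold Cplus, Cmult, Ci, RtoC, Re, Im; simpl. f_equal; ring. }
  replace (RtoC (a + r) + RtoC 0 * (Ci * RtoC b)) with (RtoC (a + r)) in H by ring.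
  rewrite <- Cmod_opp. match goal with |- (Cmod ?x <= _)%R => replace x with (erf_prim (v + RtoC r) - erf_prim (RtoC (a + r))) by ring end.
  eapply Rle_trans; [exact H|].
  assert (Hx : (exp (- r) <= / r)%R).
  { rewrite exp_Ropp. apply Rinv_le_contravar; [lra|]. assert (H1 := exp_ineq1_le r). lra. }
  assert (Hy : (M * / r <= eps / 2)%R).
  { apply (Rmult_le_reg_r r); [lra|]. rewrite Rmult_assoc, Rinv_l, Rmult_1_r by lra.
    assert (H1 : (M = (2 * M / eps) * (eps / 2))%R) by (field; lra). 
    rewrite H1 at 1. rewrite (Rmult_comm (eps / 2)). apply Rmult_le_compat_r; [lra|unfold r; lra]. }
  assert (M * exp (- r) <= M * / r)%R by (apply Rmult_le_compat_l; lra). lra. }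
replace (RtoC c - erf_prim v) with ((RtoC c - erf_prim (RtoC (a + r))) + (erf_prim (RtoC (a + r)) - erf_prim (v + RtoC r)) + (erf_prim (v + RtoC r) - erf_prim v)) by ring.
eapply Rle_trans; [apply Cmod_triangle|]. eapply Rle_trans; [apply Rplus_le_compat_r, Cmod_triangle|]. lra.
Qed.

(** * The incomplete gamma integrals *)

Lemma filterlim_CR {T : Type} (F : (T -> Prop) -> Prop) {FF : Filter F} (f : T -> C) (l : C) :
  (forall eps : R, (0 < eps)%R -> F (fun t => (Cmod (f t - l) < eps)%R)) ->
  filterlim f F (clocally l).
Proof.
intros H. apply (filterlim_locally (F := F) (U := CR)). intros eps.
apply (filter_imp (fun t => (Cmod (f t - l) < eps)%R)); [|apply H, cond_pos].
intros t Ht. split.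
- change (Rabs (Re (f t - l)) < eps)%R. eapply Rle_lt_trans; [apply re_le_Cmod|exact Ht].
- change (Rabs (Im (f t - l)) < eps)%R. eapply Rle_lt_trans; [apply im_le_Cmod|exact Ht].
Qed.

(** The fundamental theorem of calculus between two limiting endpoints. *)
Lemma ftc_gen (G g : R -> C) (Fa Fb : (R -> Prop) -> Prop) {FFa : Filter Fa} {FFb : Filter Fb} (la lb : C) :
  filter_prod Fa Fb (fun ab => forall x, (Rmin (fst ab) (snd ab) <= x <= Rmax (fst ab) (snd ab))%R ->
     is_rderive G x (g x) /\ continuous (U := CR) g x) ->
  filterlim G Fa (clocally la) -> filterlim G Fb (clocally lb) ->
  is_cRInt_gen g Fa Fb (lb - la).
Proof.
intros H Ha Hb P HP.
assert (Hm : filterlim (fun ab => minus (G (snd ab)) (G (fst ab)) : CR) (filter_prod Fa Fb) (clocally (minus lb la))).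
{ unfold minus.
  apply (filterlim_comp_2 (F := filter_prod Fa Fb) (G := clocally lb) (H := clocally (opp la))).
  - eapply filterlim_comp; [apply filterlim_snd|exact Hb].
  - eapply filterlim_comp; [|apply (filterlim_opp (V := CR))]. eapply filterlim_comp; [apply filterlim_fst|exact Ha].
  - apply (filterlim_plus (V := CR)). }
specialize (Hm P HP). unfold filtermapi.
change (filter_prod Fa Fb (fun ab => P (minus (G (snd ab)) (G (fst ab)) : CR))) in Hm.
assert (HH := filter_and _ _ H Hm). revert HH. apply filter_imp. intros [a b] [H1 H2]. simpl fst in *; simpl snd in *.
exists (minus (G b) (G a) : CR). split; [|exact H2].
apply (is_RInt_derive (V := CRc) G g); intros x Hx; apply H1, Hx.
Qed.

Lemma is_derive_RtoC_mult (g : R -> R) (u : C) (t l : R) : is_derive g t l ->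
  is_rderive (fun s => RtoC (g s) * u) t (RtoC l * u).
Proof.
intros H. rewrite <- (scal_R_Cmult l u).
apply (is_derive_ext (K := R_AbsRing) (V := CR) (fun s => scal (g s) (u : CR))).
- intros s. exact (scal_R_Cmult (g s) u).
- exact (is_derive_scal_l (K := R_AbsRing) (V := CR) g t l u H).
Qed.

Lemma Clog_pos (t : R) : (0 < t)%R -> Clog (RtoC t) = RtoC (ln t).
Proof.
intros Ht. unfold Clog, Carg. rewrite Cmod_R, Rabs_pos_eq by lra. simpl.
destruct (Rle_dec 0 0) as [_|H]; [|lra].
unfold RtoC, Re; simpl. f_equal. replace (t / t)%R with 1%R by (field; lra). apply acos_1.
Qed.

Lemma Clog_neg (t : R) : (t < 0)%R -> Clog (RtoC t) = (ln (- t), PI).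
Proof.
intros Ht. unfold Clog, Carg. rewrite Cmod_R, Rabs_left by lra. simpl.
destruct (Rle_dec 0 0) as [_|H]; [|lra].
unfold Re; simpl. f_equal. replace (t / - t)%R with (- (1))%R by (field; lra). rewrite acos_opp, acos_1. ring.
Qed.

(** The value of (-1)^p for the branch arg(-1) = pi. *)
Definition Cphase (p : R) : C := Cexp (0, (p * PI)%R).

Lemma Cpowc_pos (t p : R) : (0 < t)%R -> Cpowc (RtoC t) (RtoC p) = RtoC (Rpower t p).
Proof.
intros Ht. unfold Cpowc. rewrite Clog_pos by exact Ht. rewrite <- RtoC_mult, Cexp_RtoC. reflexivity.
Qed.

Lemma Cpowc_neg (t p : R) : (t < 0)%R -> Cpowc (RtoC t) (RtoC p) = RtoC (Rpower (- t) p) * Cphase p.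
Proof.
intros Ht. unfold Cpowc, Cphase, Rpower. rewrite Clog_neg by exact Ht. rewrite <- Cexp_RtoC, <- Cexp_plus. f_equal.
unfold RtoC, Cmult, Cplus; simpl. f_equal; ring.
Qed.

Lemma Cphase_mod (p : R) : Cmod (Cphase p) = 1%R.
Proof. unfold Cphase. rewrite Cmod_Cexp. apply exp_0. Qed.

Lemma Cphase_pred (p : R) : Cphase (p - 1) = - Cphase p.
Proof.
unfold Cphase. replace ((p * PI)%R) with ((p - 1) * PI + PI)%R by ring.
unfold Cexp, RtoC, Cmult, Copp, Re, Im; simpl. rewrite neg_cos, neg_sin. f_equal; ring.
Qed.

Definition gamma_integrand (s t : R) : C := RtoC (exp (- t)) * Cpowc (RtoC t) (- RtoC s).
(** The boundary term e^{-t} t^p of the integration by parts. *)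
Definition gamma_boundary (p t : R) : C := RtoC (exp (- t)) * Cpowc (RtoC t) (RtoC p).

Lemma Rpower_pred (t p : R) : (0 < t)%R -> (Rpower t (p - 1) = Rpower t p / t)%R.
Proof. intros Ht. unfold Rminus. rewrite Rpower_plus, Rpower_Ropp, Rpower_1 by exact Ht. reflexivity. Qed.

Lemma gamma_boundary_derive_pos (p t : R) : (0 < t)%R ->
  is_rderive (gamma_boundary p) t (RtoC p * gamma_integrand (1 - p) t - gamma_integrand (- p) t).
Proof.
intros Ht.
apply (is_derive_ext_loc (K := R_AbsRing) (V := CR) (fun s => RtoC (exp (- s) * Rpower s p) * 1)).
- exists (mkposreal t Ht). intros s Hs. change (Rabs (s - t) < t)%R in Hs. apply Rabs_lt_between in Hs.
  unfold gamma_boundary. rewrite Cpowc_pos, RtoC_mult by lra. Cring.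
- unfold gamma_integrand. rewrite <- !RtoC_opp, !Cpowc_pos by exact Ht.
  match goal with |- is_derive _ _ ?x => replace x with
    (RtoC (- exp (- t) * Rpower t p + exp (- t) * (p * Rpower t (p - 1))) * 1) end.
  + apply is_derive_RtoC_mult. unfold Rpower. auto_derive; [exact Ht|].
    replace (exp ((p - 1) * ln t))%R with (Rpower t p / t)%R by (rewrite <- Rpower_pred by exact Ht; reflexivity).
    unfold Rpower. field. lra.
  + replace (- (1 - p))%R with (p - 1)%R by ring. rewrite Ropp_involutive.
    rewrite RtoC_plus, !RtoC_mult, RtoC_opp. Cring.
Qed.

Lemma gamma_boundary_derive_neg (p t : R) : (t < 0)%R ->
  is_rderive (gamma_boundary p) t (RtoC p * gamma_integrand (1 - p) t - gamma_integrand (- p) t).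
Proof.
intros Ht. assert (Ht' : (0 < - t)%R) by lra.
apply (is_derive_ext_loc (K := R_AbsRing) (V := CR) (fun s => RtoC (exp (- s) * Rpower (- s) p) * Cphase p)).
- exists (mkposreal _ Ht'). intros s Hs. change (Rabs (s - t) < - t)%R in Hs. apply Rabs_lt_between in Hs.
  unfold gamma_boundary. rewrite Cpowc_neg, RtoC_mult by lra. Cring.
- unfold gamma_integrand. rewrite <- !RtoC_opp, !Cpowc_neg by exact Ht.
  match goal with |- is_derive _ _ ?x => replace x with
    (RtoC (- exp (- t) * Rpower (- t) p - exp (- t) * (p * Rpower (- t) (p - 1))) * Cphase p) end.
  + apply is_derive_RtoC_mult. unfold Rpower. auto_derive; [exact Ht'|].
    replace (exp ((p - 1) * ln (- t)))%R with (Rpower (- t) p / (- t))%R by (rewrite <- Rpower_pred by exact Ht'; reflexivity).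
    unfold Rpower. field. lra.
  + replace (- (1 - p))%R with (p - 1)%R by ring. rewrite Ropp_involutive, Cphase_pred.
    rewrite RtoC_minus, !RtoC_mult, RtoC_opp. Cring.
Qed.

Lemma gamma_integrand_boundary (s t : R) : gamma_integrand s t = gamma_boundary (- s) t.
Proof. unfold gamma_integrand, gamma_boundary. now rewrite RtoC_opp. Qed.

Lemma gamma_integrand_continuous (s t : R) : t <> 0%R -> continuous (U := CR) (gamma_integrand s) t.
Proof.
intros Ht. apply (ex_derive_continuous (K := R_AbsRing) (V := CR)).
destruct (Rlt_le_dec 0 t) as [H|H].
- eexists. apply (is_derive_ext (K := R_AbsRing) (V := CR) (gamma_boundary (- s))); [intros; symmetry; apply gamma_integrand_boundary|].
  now apply gamma_boundary_derive_pos.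
- eexists. apply (is_derive_ext (K := R_AbsRing) (V := CR) (gamma_boundary (- s))); [intros; symmetry; apply gamma_integrand_boundary|].
  apply gamma_boundary_derive_neg. lra.
Qed.

Lemma gamma_boundary_mod (p t : R) : t <> 0%R -> Cmod (gamma_boundary p t) = (exp (- t) * Rpower (Rabs t) p)%R.
Proof.
intros Ht. unfold gamma_boundary. rewrite Cmod_mult, Cmod_R, (Rabs_pos_eq (exp _)) by (left; apply exp_pos). f_equal.
destruct (Rlt_le_dec 0 t) as [H|H].
- rewrite Cpowc_pos, Cmod_R by exact H. rewrite (Rabs_pos_eq t) by lra. apply Rabs_pos_eq. left. apply exp_pos.
- rewrite Cpowc_neg, Cmod_mult, Cmod_R, Cphase_mod, Rmult_1_r by lra. rewrite (Rabs_left1 t) by lra.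
  apply Rabs_pos_eq. left. apply exp_pos.
Qed.

Lemma gamma_boundary_small (p eps : R) : (0 < p)%R -> (0 < eps)%R -> exists d, (0 < d)%R /\
  forall t, t <> 0%R -> (Rabs t < d)%R -> (Cmod (gamma_boundary p t) < eps)%R.
Proof.
intros Hp He. exists (Rmin 1 (exp (ln (eps / exp 1) / p))).
assert (Hx : (0 < eps / exp 1)%R) by (apply Rdiv_lt_0_compat; [lra|apply exp_pos]).
split; [apply Rmin_pos; [lra|apply exp_pos]|].
intros t Ht Hd. rewrite gamma_boundary_mod by exact Ht.
assert (H1 : (Rabs t < 1)%R) by (eapply Rlt_le_trans; [exact Hd|apply Rmin_l]).
assert (H2 : (Rabs t < exp (ln (eps / exp 1) / p))%R) by (eapply Rlt_le_trans; [exact Hd|apply Rmin_r]).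
assert (Hpos : (0 < Rabs t)%R) by now apply Rabs_pos_lt.
assert (H3 : (Rpower (Rabs t) p < eps / exp 1)%R).
{ unfold Rpower. rewrite <- (exp_ln (eps / exp 1)) by exact Hx. apply exp_increasing.
  apply ln_increasing in H2; [|exact Hpos]. rewrite ln_exp in H2.
  apply (Rmult_lt_compat_l p) in H2; [|exact Hp]. replace (p * (ln (eps / exp 1) / p))%R with (ln (eps / exp 1)) in H2 by (field; lra). exact H2. }
assert (H4 : (exp (- t) <= exp 1)%R) by (apply exp_le_le; apply Rabs_lt_between in H1; lra).
assert (H5 : (0 < Rpower (Rabs t) p)%R) by apply exp_pos.
apply Rle_lt_trans with (exp 1 * Rpower (Rabs t) p)%R; [apply Rmult_le_compat_r; lra|].
apply (Rmult_lt_compat_l (exp 1)) in H3; [|apply exp_pos].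
replace (exp 1 * (eps / exp 1))%R with eps in H3; [exact H3|]. field. assert (H6 := exp_pos 1). lra.
Qed.

Lemma ln_le_sub (x : R) : (0 < x)%R -> (ln x <= x - 1)%R.
Proof. intros Hx. assert (H := exp_ineq1_le (ln x)). rewrite exp_ln in H by exact Hx. lra. Qed.

(** The tangent of ln at 2p bounds p ln t by t/2 plus a constant. *)
Lemma gamma_boundary_infty (p eps : R) : (0 < p)%R -> (0 < eps)%R -> exists T, forall t, (T < t)%R -> (Cmod (gamma_boundary p t) < eps)%R.
Proof.
intros Hp He.
set (c := (p * ln (2 * p))%R).
exists (Rmax 0 (2 * (c - ln eps)))%R. intros t Ht.
assert (H1 := Rmax_l 0 (2 * (c - ln eps))). assert (H2 := Rmax_r 0 (2 * (c - ln eps))).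
rewrite gamma_boundary_mod, Rabs_pos_eq by lra. unfold Rpower. rewrite <- exp_plus, <- (exp_ln eps) by exact He.
apply exp_increasing.
assert (H3 : (p * ln t <= t / 2 - p + c)%R).
{ assert (H4 := ln_le_sub (t / (2 * p)) ltac:(apply Rdiv_lt_0_compat; lra)).
  rewrite ln_div in H4 by lra. unfold c.
  apply (Rmult_le_compat_l p) in H4; [|lra].
  replace (p * (t / (2 * p) - 1))%R with (t / 2 - p)%R in H4 by (field; lra). lra. }
lra.
Qed.

Lemma filterlim_at_point (G : R -> C) (w : R) : filterlim G (at_point w) (clocally (G w)).
Proof. unfold filterlim, filter_le, filtermap, at_point. intros P HP. exact (locally_singleton (T := CR) (G w) P HP). Qed.

Lemma lim_p_infty (G : R -> C) (l : C) : (forall eps, (0 < eps)%R -> exists T, forall t, (T < t)%R -> (Cmod (G t - l) < eps)%R) ->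
  filterlim G (Rbar_locally p_infty) (clocally l).
Proof. intros H. refine (filterlim_CR (Rbar_locally p_infty) _ _ _). intros eps He. destruct (H eps He) as [T HT]. exists T. exact HT. Qed.

Lemma lim_zero (G : R -> C) (l : C) : (forall eps, (0 < eps)%R -> exists d, (0 < d)%R /\
    forall t, t <> 0%R -> (Rabs t < d)%R -> (Cmod (G t - l) < eps)%R) ->
  filterlim G (at_left 0) (clocally l) /\ filterlim G (at_right 0) (clocally l).
Proof.
intros H. split; [refine (filterlim_CR (at_left 0) _ _ _)|refine (filterlim_CR (at_right 0) _ _ _)]; intros eps He; destruct (H eps He) as [d [Hd1 Hd]];
  exists (mkposreal d Hd1); intros t Ht Ht0; apply Hd; try lra;
  change (Rabs (t - 0) < d)%R in Ht; now rewrite Rminus_0_r in Ht.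
Qed.

(** The three kinds of rays that occur in the integral from w to +oo: it is
    improper at 0 as well when w < 0. *)
Lemma ftc_ray_pos (G g : R -> C) (w : R) (l : C) : (0 < w)%R ->
  (forall t, (0 < t)%R -> is_rderive G t (g t) /\ continuous (U := CR) g t) ->
  filterlim G (Rbar_locally p_infty) (clocally l) ->
  is_cRInt_gen g (at_point w) (Rbar_locally p_infty) (l - G w).
Proof.
intros Hw H Hl. refine (ftc_gen G g _ _ _ _ _ (filterlim_at_point G w) Hl).
exists (fun a => a = w) (fun b => (w < b)%R); [reflexivity|now exists w|].
intros a b -> Hb x Hx. simpl in Hx. rewrite Rmin_left, Rmax_right in Hx by lra. apply H. lra.
Qed.

Lemma ftc_ray_neg (G g : R -> C) (w : R) (l : C) : (w < 0)%R ->
  (forall t, (t < 0)%R -> is_rderive G t (g t) /\ continuous (U := CR) g t) ->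
  filterlim G (at_left 0) (clocally l) ->
  is_cRInt_gen g (at_point w) (at_left 0) (l - G w).
Proof.
intros Hw H Hl. refine (ftc_gen G g _ _ _ _ _ (filterlim_at_point G w) Hl).
exists (fun a => a = w) (fun b => (b < 0)%R); [reflexivity|exists (mkposreal 1 Rlt_0_1); auto|].
intros a b -> Hb x Hx. apply H. simpl in Hx. assert (H1 := proj2 Hx). revert H1. unfold Rmax. destruct (Rle_dec w b); lra.
Qed.

Lemma ftc_ray_0 (G g : R -> C) (l0 l : C) :
  (forall t, (0 < t)%R -> is_rderive G t (g t) /\ continuous (U := CR) g t) ->
  filterlim G (at_right 0) (clocally l0) ->
  filterlim G (Rbar_locally p_infty) (clocally l) ->
  is_cRInt_gen g (at_right 0) (Rbar_locally p_infty) (l - l0).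
Proof.
intros H H0 Hl. refine (ftc_gen G g _ _ _ _ _ H0 Hl).
exists (fun a => (0 < a)%R) (fun b => (0 < b)%R); [exists (mkposreal 1 Rlt_0_1); auto|now exists 0%R|].
intros a b Ha Hb x Hx. apply H. simpl in Hx. assert (H1 := proj1 Hx). revert H1. unfold Rmin. destruct (Rle_dec a b); lra.
Qed.

Lemma RInt_gen_eq (f : R -> C) (Fa Fb : (R -> Prop) -> Prop) {FFa : ProperFilter' Fa} {FFb : ProperFilter' Fb} (l l' : C) :
  is_cRInt_gen f Fa Fb l -> is_cRInt_gen f Fa Fb l' -> l = l'.
Proof.
intros H1 H2. rewrite <- (is_RInt_gen_unique (V := CRc) f l H1). exact (is_RInt_gen_unique (V := CRc) f l' H2).
Qed.

Lemma by_parts_gen (p : R) (Fa Fb : (R -> Prop) -> Prop) {FFa : ProperFilter' Fa} {FFb : ProperFilter' Fb} (I1 I2 l : C) :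
  is_cRInt_gen (gamma_integrand (- p)) Fa Fb I1 -> is_cRInt_gen (gamma_integrand (1 - p)) Fa Fb I2 ->
  is_cRInt_gen (fun t => RtoC p * gamma_integrand (1 - p) t - gamma_integrand (- p) t) Fa Fb l -> l = RtoC p * I2 - I1.
Proof.
intros H1 H2 H. apply (RInt_gen_eq _ Fa Fb _ _ H).
assert (FA : Filter Fa) by apply filter_filter'. assert (FB : Filter Fb) by apply filter_filter'.
assert (H3 := is_RInt_gen_minus (V := CR) _ _ _ _ (is_RInt_gen_scal (V := CR) _ p _ H2) H1).
refine (is_RInt_gen_ext (V := CR) _ _ _ _ _).
2:{ assert (E : minus (scal p (I2 : CR)) (I1 : CR) = RtoC p * I2 - I1).
    { exact (f_equal (fun c : C => c - I1) (scal_R_Cmult p I2)). }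
    rewrite <- E. exact H3. }
apply filter_forall. intros ab x _.
exact (f_equal (fun c : C => c - gamma_integrand (- p) x) (scal_R_Cmult p (gamma_integrand (1 - p) x))).
Qed.

(** Integration by parts: Gamma(p + 1, w) = p Gamma(p, w) + w^p e^{-w}, on either
    side of the cut.  The boundary term vanishes at 0 since p > 0. *)
Lemma gamma_recursion (p w : R) (I1 I2 : C) : (0 < p)%R ->
  is_integral_to_infty (gamma_integrand (- p)) w I1 -> is_integral_to_infty (gamma_integrand (1 - p)) w I2 ->
  I1 = RtoC p * I2 + gamma_boundary p w.
Proof.
intros Hp.
set (g := fun t => RtoC p * gamma_integrand (1 - p) t - gamma_integrand (- p) t).
assert (Hc : forall t, t <> 0%R -> continuous (U := CR) g t).
{ intros t Ht. apply (continuous_minus (V := CR)); [|now apply gamma_integrand_continuous].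
  apply (continuous_ext (fun t => scal p (gamma_integrand (1 - p) t : CR))).
  { intros s. exact (scal_R_Cmult p (gamma_integrand (1 - p) s)). }
  apply (continuous_scal_r (V := CR)). now apply gamma_integrand_continuous. }
assert (Hpos : forall t, (0 < t)%R -> is_rderive (gamma_boundary p) t (g t) /\ continuous (U := CR) g t).
{ intros t Ht. split; [now apply gamma_boundary_derive_pos|apply Hc; lra]. }
assert (Hneg : forall t, (t < 0)%R -> is_rderive (gamma_boundary p) t (g t) /\ continuous (U := CR) g t).
{ intros t Ht. split; [now apply gamma_boundary_derive_neg|apply Hc; lra]. }
assert (E0 : forall z : C, z - 0 = z) by (intros; ring).
assert (Hinf : filterlim (gamma_boundary p) (Rbar_locally p_infty) (clocally (RtoC 0))).
{ apply lim_p_infty. intros eps He. destruct (gamma_boundary_infty p eps Hp He) as [T HT]. exists T. intros t Ht. rewrite E0. auto. }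
assert (H0 : filterlim (gamma_boundary p) (at_left 0) (clocally (RtoC 0)) /\ filterlim (gamma_boundary p) (at_right 0) (clocally (RtoC 0))).
{ apply lim_zero. intros eps He. destruct (gamma_boundary_small p eps Hp He) as [d [Hd1 Hd]]. exists d. split; [exact Hd1|].
  intros t Ht Htd. rewrite E0. auto. }
destruct H0 as [Hl Hr].
intros [[Hw H1]|[Hw [I11 [I12 [H11 [H12 ->]]]]]] [[Hw' H2]|[Hw' [I21 [I22 [H21 [H22 ->]]]]]]; try (exfalso; lra).
- assert (H := by_parts_gen p _ _ _ _ _ H1 H2 (ftc_ray_pos (gamma_boundary p) g w 0 Hw Hpos Hinf)).
  replace I1 with (RtoC p * I2 - (RtoC p * I2 - I1)) by ring. rewrite <- H. ring.
- assert (H := by_parts_gen p _ _ _ _ _ H11 H21 (ftc_ray_neg (gamma_boundary p) g w 0 Hw Hneg Hl)).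
  assert (H' := by_parts_gen p _ _ _ _ _ H12 H22 (ftc_ray_0 (gamma_boundary p) g 0 0 Hpos Hr Hinf)).
  replace I11 with (RtoC p * I21 - (RtoC p * I21 - I11)) by ring. rewrite <- H.
  replace I12 with (RtoC p * I22 - (RtoC p * I22 - I12)) by ring. rewrite <- H'. ring.
Qed.

(** F is the entire continuation in the exponent used to define B_kappa(x). *)
Definition B_continuation (F : C -> C) (x : R) : Prop :=
  (forall s, cdiff F s) /\ forall s : R, (s < 1)%R -> exists I : C,
    is_integral_to_infty (gamma_integrand s) (-2 * x) I /\ F (RtoC s) = RtoC (exp (- x)) * I.

Lemma is_Bvalue_continuation (kappa x : R) (v : C) : is_Bvalue (RtoC kappa) x v -> exists F, B_continuation F x /\ F (RtoC kappa) = v.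
Proof.
intros [F [H1 [H2 H3]]]. exists F. split; [split|exact H3].
- intros s. destruct (H1 s) as [l Hl]. exists l. Transparent is_cderive. exact Hl.
- intros s Hs. apply (H2 (RtoC s)). exact Hs.
Qed.

(** For s < 1 this is gamma_recursion.  Both sides are entire in s; the map
    z -> -1 + exp(-K z^2) sends the top side of the rectangle into ]-1, 0] and -i to s
    when exp(K) = s + 1. *)
Lemma B_continuation_recursion (F : C -> C) (x s : R) : x <> 0%R -> B_continuation F x ->
  F (RtoC (s - 1)) = RtoC (1 - s) * F (RtoC s) + RtoC (exp (- x)) * gamma_boundary (1 - s) (-2 * x).
Proof.
intros Hx [HF HI]. set (w := (-2 * x)%R) in *.
assert (Hlt : forall r : R, (r < 1)%R ->
   F (RtoC (r - 1)) = RtoC (1 - r) * F (RtoC r) + RtoC (exp (- x)) * gamma_boundary (1 - r) w).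
{ intros r Hr. destruct (HI (r - 1)%R ltac:(lra)) as [I1 [H1 ->]]. destruct (HI r Hr) as [I2 [H2 ->]].
  replace (r - 1)%R with (- (1 - r))%R in H1 by ring. replace r with (1 - (1 - r))%R in H2 by ring.
  rewrite (gamma_recursion (1 - r) w I1 I2 ltac:(lra) H1 H2). ring. }
destruct (Rlt_le_dec s 1) as [Hs|Hs]; [now apply Hlt|].
set (D := fun z : C => F (z - 1) - ((1 - z) * F z + RtoC (exp (- x)) * (RtoC (exp (- w)) * Cexp ((1 - z) * Clog (RtoC w))))).
assert (HD : forall r : R, D (RtoC r) = F (RtoC (r - 1)) - (RtoC (1 - r) * F (RtoC r) + RtoC (exp (- x)) * gamma_boundary (1 - r) w)).
{ intros r. unfold D, gamma_boundary, Cpowc. now rewrite !RtoC_minus. }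
set (K := ln (s + 1)).
set (psi := fun z : C => -(1) + Cexp (- (RtoC K * (z * z)))).
assert (HK : (0 <= K)%R) by (unfold K; rewrite <- ln_1; left; apply ln_increasing; lra).
assert (Hcd : forall z, cdiff D z).
{ intros z. destruct (HF z) as [l1 Hl1]. destruct (HF (z - 1)) as [l2 Hl2]. unfold D.
  apply cdiff_minus; [|apply cdiff_plus].
  - apply (cdiff_comp F (fun t => t - 1)); [now exists l2|cdiff].
  - apply (cdiff_mult (fun t => 1 - t) F); [cdiff|now exists l1].
  - cdiff. }
assert (HUL : unif_holo model_rect (fun z => D (psi z))).
{ apply unif_holo_model_rect. intros z _. apply cdiff_comp; [apply Hcd|]. unfold psi. cdiff. }
assert (Hv := vanishing_propagates _ HUL). lapply Hv; clear Hv.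
- intros Hv. cbv beta in Hv. replace (psi (0, (-1)%R)) with (RtoC s) in Hv.
  + rewrite HD in Hv.
    match goal with |- ?a = ?b => replace a with ((a - b) + b) by ring end. rewrite Hv. ring.
  + unfold psi. replace (- (RtoC K * ((0, (-1)%R) * (0, (-1)%R)))) with (RtoC K)
      by (unfold RtoC, Cmult, Copp; simpl; f_equal; ring).
    unfold K. rewrite Cexp_RtoC, exp_ln, RtoC_plus by lra. ring.
- intros y Hy. unfold psi.
  replace (- (RtoC K * ((y, 0%R) * (y, 0%R)))) with (RtoC (- (K * (y * y))))
    by (unfold RtoC, Cmult, Copp; simpl; f_equal; ring).
  rewrite Cexp_RtoC, <- RtoC_opp, <- RtoC_plus, HD, Hlt.
  + ring.
  + assert (exp (- (K * (y * y))) <= 1)%R by (rewrite <- exp_0; apply exp_le_le; nra). lra.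
Qed.

(** Psi expresses B_kappa for kappa = 3/2 - m: B_kappa(x) = e^{-x} Psi(sqrt(-2x)), with
    the square root i sqrt(2x) for x > 0.  The last field
    holds for every continuation, so it also shows that B_kappa is well defined. *)
Record B_profile (m : Z) (Psi : C -> C) (C0 : C) (K : R) (J : nat) : Prop := {
  psi_const : C0 <> 0;
  psi_derive : forall v : C, v <> 0 -> is_cderive Psi v (- (2) * zpow v (2 * m - 2) * Cexp (- (v * v)));
  psi_sym : forall v : C, v <> 0 -> Psi v + Psi (- v) = 2 * C0;
  psi_K : (0 <= K)%R;
  psi_bound : forall v : C, v <> 0 -> (0 <= Re v)%R ->
    (Cmod (Psi v) <= K * (Cmod v + / Cmod v) ^ J * exp (- Re (v * v)))%R;
  psi_B : forall F x, x <> 0%R -> B_continuation F x ->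
    F (RtoC (3 / 2 - IZR m)) = RtoC (exp (- x)) * Psi (Cexp (RtoC (1 / 2) * Clog (RtoC (-2 * x))))
}.

(** * The special function of the nonholomorphic part *)

Lemma Cexp_zpow (L : C) (j : Z) : zpow (Cexp L) j = Cexp (RtoC (IZR j) * L).
Proof.
revert j. apply (Z_bi_ind _ 0%Z).
- rewrite Cmult_0_l, Cexp_0. reflexivity.
- intros j IH. rewrite zpow_succ, IH by apply Cexp_nz. rewrite <- Cexp_plus. f_equal. rewrite plus_IZR, RtoC_plus. ring.
- intros j IH. rewrite zpow_pred, IH by apply Cexp_nz. rewrite <- Cexp_opp, <- Cexp_plus. f_equal.
  rewrite minus_IZR, RtoC_minus. ring.
Qed.

Lemma half_log_pos (w : R) : (0 < w)%R -> Cexp (RtoC (1 / 2) * Clog (RtoC w)) = RtoC (sqrt w).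
Proof.
intros Hw. rewrite Clog_pos, <- RtoC_mult, Cexp_RtoC by exact Hw. f_equal.
rewrite <- Rpower_sqrt by exact Hw. unfold Rpower. f_equal. field.
Qed.

Lemma half_log_neg (w : R) : (w < 0)%R -> Cexp (RtoC (1 / 2) * Clog (RtoC w)) = Ci * RtoC (sqrt (- w)).
Proof.
intros Hw. rewrite Clog_neg by exact Hw. rewrite <- Rpower_sqrt by lra. unfold Rpower.
unfold Cexp, Ci, RtoC, Cmult, Re, Im; simpl.
replace (1 / 2 * PI + 0 * ln (- w))%R with (PI / 2)%R by field. rewrite cos_PI2, sin_PI2.
replace (1 / 2 * ln (- w) - 0 * PI)%R with (/ 2 * ln (- w))%R by field. f_equal; ring.
Qed.

Lemma half_log_sq (w : R) : w <> 0%R -> Cexp (RtoC (1 / 2) * Clog (RtoC w)) * Cexp (RtoC (1 / 2) * Clog (RtoC w)) = RtoC w.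
Proof.
intros Hw. destruct (Rlt_le_dec 0 w) as [H|H].
- rewrite half_log_pos, <- RtoC_mult, sqrt_sqrt by lra. reflexivity.
- rewrite half_log_neg by lra.
  replace (Ci * RtoC (sqrt (- w)) * (Ci * RtoC (sqrt (- w)))) with (- RtoC (sqrt (- w) * sqrt (- w))).
  + rewrite sqrt_sqrt by lra. rewrite <- RtoC_opp. f_equal. ring.
  + rewrite RtoC_mult. unfold Ci, RtoC, Cmult, Copp; simpl. f_equal; ring.
Qed.

Lemma gamma_boundary_half (m : Z) (w : R) : gamma_boundary (IZR m - 1 / 2) w =
  RtoC (exp (- w)) * zpow (Cexp (RtoC (1 / 2) * Clog (RtoC w))) (2 * m - 1).
Proof.
unfold gamma_boundary, Cpowc. rewrite Cexp_zpow. do 2 f_equal. rewrite Cmult_assoc, <- RtoC_mult. do 2 f_equal.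
rewrite minus_IZR, mult_IZR. field.
Qed.

Lemma erf_small (eps : R) : (0 < eps)%R -> exists d, (0 < d)%R /\ forall v, (Cmod v < d)%R -> (Cmod (erf_prim v) < eps)%R.
Proof.
intros He. destruct (cdiff_continuous erf_prim 0 (ex_intro _ _ (is_cderive_erf 0)) (eps / 2)%R ltac:(lra)) as [d [Hd1 Hd]].
exists d. split; [exact Hd1|]. intros v Hv. specialize (Hd v Hv).
rewrite erf_0 in Hd. replace (0 + v) with v in Hd by ring. replace (erf_prim v - 0) with (erf_prim v) in Hd by ring. lra.
Qed.

Lemma erf_pos_derive (t : R) : (0 < t)%R ->
  is_rderive (fun s => erf_prim (RtoC (sqrt s))) t (gamma_integrand (1 / 2) t).
Proof.
intros Ht. assert (Hs := sqrt_lt_R0 t Ht).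
assert (H1 : is_rderive (fun u : R => erf_prim (RtoC u)) (sqrt t) (gexp (RtoC (sqrt t)))).
{ exact (is_cderive_hline erf_prim (sqrt t) 0%R _ (is_cderive_erf _)). }
assert (H2 : is_derive sqrt t (/ (2 * sqrt t))%R) by (auto_derive; [exact Ht|field; lra]).
assert (H := is_derive_comp (K := R_AbsRing) (V := CR) (fun u : R => erf_prim (RtoC u)) sqrt t _ _ H1 H2).
replace (gamma_integrand (1 / 2) t) with (scal (/ (2 * sqrt t))%R (gexp (RtoC (sqrt t)) : CR)); [exact H|].
transitivity (RtoC (/ (2 * sqrt t)) * gexp (RtoC (sqrt t))); [exact (scal_R_Cmult _ _)|].
unfold gexp, gamma_integrand. rewrite <- RtoC_opp, Cpowc_pos by exact Ht.
rewrite <- RtoC_mult, sqrt_sqrt, <- RtoC_opp, Cexp_RtoC, <- !RtoC_mult by lra. f_equal.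
rewrite Rpower_Ropp. replace (1 / 2)%R with (/ 2)%R by field. rewrite Rpower_sqrt by exact Ht. field. lra.
Qed.

Lemma erf_neg_derive (t : R) : (t < 0)%R ->
  is_rderive (fun s => erf_prim (Ci * RtoC (sqrt (- s)))) t (gamma_integrand (1 / 2) t).
Proof.
intros Ht. assert (Ht' : (0 < - t)%R) by lra. assert (Hs := sqrt_lt_R0 _ Ht').
assert (H1 : is_rderive (fun u : R => erf_prim (Ci * RtoC u)) (sqrt (- t)) (gexp (Ci * RtoC (sqrt (- t))) * Ci)).
{ apply (is_derive_ext (K := R_AbsRing) (V := CR) (fun u : R => erf_prim (0 + RtoC u * Ci))); [intros u; f_equal; ring|].
  apply is_cderive_line. replace (0 + RtoC (sqrt (- t)) * Ci) with (Ci * RtoC (sqrt (- t))) by ring. apply is_cderive_erf. }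
assert (H2 : is_derive (fun s => sqrt (- s)) t (- / (2 * sqrt (- t)))%R) by (auto_derive; [exact Ht'|field; lra]).
assert (H := is_derive_comp (K := R_AbsRing) (V := CR) (fun u : R => erf_prim (Ci * RtoC u)) (fun s => sqrt (- s)) t _ _ H1 H2).
replace (gamma_integrand (1 / 2) t) with (scal (- / (2 * sqrt (- t)))%R (gexp (Ci * RtoC (sqrt (- t))) * Ci : CR)); [exact H|].
transitivity (RtoC (- / (2 * sqrt (- t))) * (gexp (Ci * RtoC (sqrt (- t))) * Ci)); [exact (scal_R_Cmult _ _)|].
assert (Ph : Cphase (- (1 / 2)) = - Ci).
{ unfold Cphase, Cexp, Ci, RtoC, Copp, Cmult, Re, Im; simpl. replace (- (1 / 2) * PI)%R with (- (PI / 2))%R by field.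
  rewrite cos_neg, sin_neg, cos_PI2, sin_PI2, exp_0. f_equal; ring. }
unfold gexp, gamma_integrand. rewrite <- RtoC_opp, Cpowc_neg, Ph by exact Ht.
replace (- (Ci * RtoC (sqrt (- t)) * (Ci * RtoC (sqrt (- t))))) with (RtoC (sqrt (- t) * sqrt (- t))).
2:{ rewrite RtoC_mult. unfold Ci, RtoC, Cmult, Copp; simpl. f_equal; ring. }
rewrite sqrt_sqrt, Cexp_RtoC by lra.
rewrite Rpower_Ropp. replace (1 / 2)%R with (/ 2)%R by field. rewrite Rpower_sqrt by exact Ht'.
rewrite RtoC_opp. replace (RtoC (/ sqrt (- t))) with (RtoC (/ (2 * sqrt (- t))) * 2); [Cring|].
rewrite <- RtoC_mult. f_equal. field. lra.
Qed.

(** The substitution t = u^2 turns t^{-1/2} e^{-t} dt into 2 e^{-u^2} du.  For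
    negative w the path runs from i sqrt(-w) to 0 and on to +oo. *)
Lemma gamma_half_integral (c : C) (w : R) (I : C) : w <> 0%R ->
  (forall v, (0 <= Re v)%R -> (Cmod (c - erf_prim v) <= PI * exp (- Re (v * v)))%R) ->
  is_integral_to_infty (gamma_integrand (1 / 2)) w I -> I = c - erf_prim (Cexp (RtoC (1 / 2) * Clog (RtoC w))).
Proof.
intros Hw0 Hc.
assert (E0 : forall z : C, z - 0 = z) by (intros; ring).
assert (Hpos : forall t, (0 < t)%R -> is_rderive (fun s => erf_prim (RtoC (sqrt s))) t (gamma_integrand (1 / 2) t) /\ continuous (U := CR) (gamma_integrand (1 / 2)) t).
{ intros t Ht. split; [now apply erf_pos_derive|apply gamma_integrand_continuous; lra]. }
assert (Hneg : forall t, (t < 0)%R -> is_rderive (fun s => erf_prim (Ci * RtoC (sqrt (- s)))) t (gamma_integrand (1 / 2) t) /\ continuous (U := CR) (gamma_integrand (1 / 2)) t).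
{ intros t Ht. split; [now apply erf_neg_derive|apply gamma_integrand_continuous; lra]. }
assert (HP := PI_RGT_0).
assert (Hinf : filterlim (fun s => erf_prim (RtoC (sqrt s))) (Rbar_locally p_infty) (clocally c)).
{ apply lim_p_infty. intros eps He. exists (Rmax 0 (PI / eps)). intros t Ht.
  assert (H1 := Rmax_l 0 (PI / eps)). assert (H2 := Rmax_r 0 (PI / eps)).
  rewrite <- Cmod_opp. replace (- (erf_prim (RtoC (sqrt t)) - c)) with (c - erf_prim (RtoC (sqrt t))) by ring.
  eapply Rle_lt_trans; [apply Hc; simpl; apply sqrt_pos|].
  rewrite <- RtoC_mult, sqrt_sqrt by lra. simpl Re. rewrite exp_Ropp.
  assert (H3 := exp_ineq1_le t). apply (Rmult_lt_reg_r (exp t)); [apply exp_pos|].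
  rewrite Rmult_assoc, Rinv_l, Rmult_1_r by (assert (H4 := exp_pos t); lra).
  assert (H5 : (PI / eps < exp t)%R) by lra. apply Rlt_div_l in H5; [|exact He]. lra. }
assert (Hr : filterlim (fun s => erf_prim (RtoC (sqrt s))) (at_right 0) (clocally (RtoC 0))).
{ apply lim_zero. intros eps He. destruct (erf_small eps He) as [d [Hd1 Hd]]. exists (d * d)%R. split; [nra|].
  intros t _ Ht. rewrite E0. apply Hd. rewrite Cmod_R, Rabs_pos_eq by apply sqrt_pos.
  apply Rle_lt_trans with (sqrt (Rabs t)); [apply sqrt_le_1_alt, Rle_abs|].
  rewrite <- (sqrt_square d) by lra. apply sqrt_lt_1_alt. split; [apply Rabs_pos|exact Ht]. }
assert (Hl : filterlim (fun s => erf_prim (Ci * RtoC (sqrt (- s)))) (at_left 0) (clocally (RtoC 0))).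
{ apply lim_zero. intros eps He. destruct (erf_small eps He) as [d [Hd1 Hd]]. exists (d * d)%R. split; [nra|].
  intros t _ Ht. rewrite E0. apply Hd. rewrite Cmod_mult, Cmod_Ci, Cmod_R, Rabs_pos_eq, Rmult_1_l by apply sqrt_pos.
  apply Rle_lt_trans with (sqrt (Rabs t)); [apply sqrt_le_1_alt; rewrite <- Rabs_Ropp; apply Rle_abs|].
  rewrite <- (sqrt_square d) by lra. apply sqrt_lt_1_alt. split; [apply Rabs_pos|exact Ht]. }
intros [[Hw H1]|[Hw [I1 [I2 [H1 [H2 ->]]]]]].
- rewrite half_log_pos by exact Hw. exact (RInt_gen_eq _ _ _ _ _ H1 (ftc_ray_pos _ _ w c Hw Hpos Hinf)).
- rewrite half_log_neg by exact Hw.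
  rewrite (RInt_gen_eq _ _ _ _ _ H1 (ftc_ray_neg _ _ w 0 Hw Hneg Hl)).
  rewrite (RInt_gen_eq _ _ _ _ _ H2 (ftc_ray_0 _ _ 0 c Hpos Hr Hinf)). ring.
Qed.

Lemma one_le_add_inv (r : R) : (0 < r)%R -> (1 <= r + / r)%R.
Proof.
intros Hr. assert (H := Rinv_0_lt_compat r Hr). destruct (Rle_dec 1 r); [lra|].
assert (1 <= / r)%R by (rewrite <- Rinv_1; apply Rinv_le_contravar; lra). lra.
Qed.

Lemma zpow_mod_le (v : C) (j : Z) : v <> 0 -> (Cmod (zpow v j) <= (Cmod v + / Cmod v) ^ Z.abs_nat j)%R.
Proof.
intros Hv. assert (Hm := proj1 (Cmod_gt_0 v) Hv). assert (Hi := Rinv_0_lt_compat _ Hm).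
revert j. apply Z_nat_cases; intros n.
- rewrite zpow_nat, Cmod_pow, Zabs2Nat.id. apply pow_incr. lra.
- rewrite zpow_neg_nat, Cmod_pow, Cmod_inv by exact Hv.
  replace (Z.abs_nat (- Z.of_nat (S n))) with (S n) by lia. apply pow_incr. lra.
Qed.

(** kappa = 1/2 lies in the half plane of convergence. *)
Lemma B_profile_base : exists Psi C0 K J, B_profile 1 Psi C0 K J.
Proof.
destruct erf_limit as [c [Hc0 Hc]].
exists (fun v => c - erf_prim v), c, PI, O. split.
- exact Hc0.
- intros v _. eapply is_cderive_eq; [apply is_cderive_minus; [apply is_cderive_const|apply is_cderive_erf]|].
  simpl zpow. unfold gexp. ring.
- intros v _. rewrite erf_odd. ring.
- left. apply PI_RGT_0.
- intros v _ Hv. simpl. rewrite Rmult_1_r. now apply Hc.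
- intros F x Hx [_ HI]. replace (3 / 2 - IZR 1)%R with (1 / 2)%R by (simpl; field).
  destruct (HI (1 / 2)%R ltac:(lra)) as [I [H1 ->]]. f_equal.
  apply gamma_half_integral; auto. lra.
Qed.

(** For a half-integral weight the recursion can be solved in both directions, and
    the logarithmic case kappa = 1 does not occur. *)
Lemma half_shift_nz (m : Z) : (IZR m - 1 / 2)%R <> 0%R.
Proof.
intros H. assert (H1 : IZR (2 * m) = IZR 1) by (rewrite mult_IZR; lra). apply eq_IZR in H1. lia.
Qed.

(** One integration by parts.  The boundary term v^{2m-1} e^{-v^2} is odd, so it
    disappears from Psi(v) + Psi(-v). *)
Lemma B_profile_succ (m : Z) : (exists Psi C0 K J, B_profile m Psi C0 K J) -> exists Psi C0 K J, B_profile (m + 1) Psi C0 K J.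
Proof.
intros [Psi [C0 [K [J [H1 H2 H3 H4 H5 H6]]]]].
set (a := (IZR m - 1 / 2)%R). assert (Ha : a <> 0%R) by apply half_shift_nz.
exists (fun v => RtoC a * Psi v + zpow v (2 * m - 1) * Cexp (- (v * v))), (RtoC a * C0), (Rabs a * K + 1)%R, (J + Z.abs_nat (2 * m - 1))%nat.
split.
- apply Cmult_neq_0; [|exact H1]. intros H. apply RtoC_inj in H. auto.
- intros v Hv. eapply is_cderive_eq.
  + apply is_cderive_plus.
    * apply (is_cderive_mult (fun _ => RtoC a) Psi); [apply is_cderive_const|now apply H2].
    * apply (is_cderive_mult (fun v => zpow v (2 * m - 1)) (fun v => Cexp (- (v * v)))); [exact (is_cderive_zpow v _ Hv)|cder].
  + cbv beta. replace (2 * (m + 1) - 2)%Z with (2 * m - 1 + 1)%Z by lia. replace (2 * m - 1 - 1)%Z with (2 * m - 2)%Z by lia.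
    rewrite zpow_succ by exact Hv.
    replace (IZR (2 * m - 1)) with (a + a)%R by (unfold a; rewrite minus_IZR, mult_IZR; field).
    rewrite RtoC_plus. ring.
- intros v Hv. replace (- v * - v) with (v * v) by ring. rewrite zpow_opp_odd by exact Hv.
  replace (RtoC a * Psi v + zpow v (2 * m - 1) * Cexp (- (v * v)) + (RtoC a * Psi (- v) + - zpow v (2 * m - 1) * Cexp (- (v * v))))
    with (RtoC a * (Psi v + Psi (- v))) by ring. rewrite H3 by exact Hv. ring.
- assert (H := Rabs_pos a). nra.
- intros v Hv Hre. set (X := (Cmod v + / Cmod v)%R).
  assert (Hm := proj1 (Cmod_gt_0 v) Hv). assert (HX : (1 <= X)%R) by now apply one_le_add_inv.
  set (e := exp (- Re (v * v))). assert (He : (0 < e)%R) by apply exp_pos.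
  eapply Rle_trans; [apply Cmod_triangle|]. rewrite !Cmod_mult, Cmod_R, Cmod_Cexp.
  assert (B1 := H5 v Hv Hre). fold X e in B1. assert (B2 := zpow_mod_le v (2 * m - 1) Hv). fold X in B2.
  replace (exp (Re (- (v * v)))) with e by reflexivity.
  rewrite pow_add. set (p := (X ^ J)%R) in *. set (q := (X ^ Z.abs_nat (2 * m - 1))%R) in *.
  assert (Hp : (1 <= p)%R) by now apply pow_R1_Rle. assert (Hq : (1 <= q)%R) by now apply pow_R1_Rle.
  assert (Habs := Rabs_pos a).
  assert (C1 : (Rabs a * Cmod (Psi v) <= Rabs a * K * (p * q) * e)%R).
  { apply Rle_trans with (Rabs a * (K * p * e))%R; [now apply Rmult_le_compat_l|].
    replace (Rabs a * (K * p * e))%R with (Rabs a * K * p * e * 1)%R by ring.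
    replace (Rabs a * K * (p * q) * e)%R with (Rabs a * K * p * e * q)%R by ring.
    apply Rmult_le_compat_l; [|exact Hq]. repeat apply Rmult_le_pos; lra. }
  assert (C2 : (Cmod (zpow v (2 * m - 1)) * e <= 1 * (p * q) * e)%R).
  { apply Rmult_le_compat_r; [lra|]. nra. }
  lra.
- intros F x Hx HF.
  replace (3 / 2 - IZR (m + 1))%R with (3 / 2 - IZR m - 1)%R by (rewrite plus_IZR; ring).
  rewrite (B_continuation_recursion F x _ Hx HF), (H6 F x Hx HF).
  replace (1 - (3 / 2 - IZR m))%R with (IZR m - 1 / 2)%R by field. fold a.
  set (v := Cexp (RtoC (1 / 2) * Clog (RtoC (-2 * x)))).
  replace (v * v) with (RtoC (-2 * x)) by (symmetry; apply half_log_sq; lra).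
  unfold a at 2. rewrite gamma_boundary_half. fold v. rewrite <- RtoC_opp, Cexp_RtoC. ring.
Qed.

(** The same recursion solved for the other term. *)
Lemma B_profile_pred (m : Z) : (exists Psi C0 K J, B_profile m Psi C0 K J) -> exists Psi C0 K J, B_profile (m - 1) Psi C0 K J.
Proof.
intros [Psi [C0 [K [J [H1 H2 H3 H4 H5 H6]]]]].
set (a := (IZR (m - 1) - 1 / 2)%R). assert (Ha : a <> 0%R) by apply half_shift_nz.
assert (HaC : RtoC a <> 0) by (intros H; apply RtoC_inj in H; auto).
set (j := (2 * (m - 1) - 1)%Z).
exists (fun v => / RtoC a * (Psi v - zpow v j * Cexp (- (v * v)))), (/ RtoC a * C0), (Rabs (/ a) * (K + 1))%R, (J + Z.abs_nat j)%nat.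
split.
- apply Cmult_neq_0; [|exact H1]. rewrite <- RtoC_inv by exact Ha. intros H. apply RtoC_inj in H. revert H. now apply Rinv_neq_0_compat.
- intros v Hv. eapply is_cderive_eq.
  + apply (is_cderive_mult (fun _ => / RtoC a) (fun v => Psi v - zpow v j * Cexp (- (v * v)))); [apply is_cderive_const|].
    apply is_cderive_minus; [now apply H2|].
    apply (is_cderive_mult (fun v => zpow v j) (fun v => Cexp (- (v * v)))); [exact (is_cderive_zpow v _ Hv)|cder].
  + cbv beta. replace (2 * m - 2)%Z with (j + 1)%Z by (unfold j; lia). replace (2 * (m - 1) - 2)%Z with (j - 1)%Z by (unfold j; lia).
    rewrite zpow_succ by exact Hv.
    replace (IZR j) with (a + a)%R by (unfold a, j; rewrite (minus_IZR (2 * (m - 1)) 1), mult_IZR; field).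
    rewrite RtoC_plus. field. exact HaC.
- intros v Hv. replace (- v * - v) with (v * v) by ring. unfold j. rewrite zpow_opp_odd by exact Hv. fold j.
  replace (/ RtoC a * (Psi v - zpow v j * Cexp (- (v * v))) + / RtoC a * (Psi (- v) - - zpow v j * Cexp (- (v * v))))
    with (/ RtoC a * (Psi v + Psi (- v))) by ring. rewrite H3 by exact Hv. ring.
- assert (H := Rabs_pos (/ a)). nra.
- intros v Hv Hre. set (X := (Cmod v + / Cmod v)%R).
  assert (Hm := proj1 (Cmod_gt_0 v) Hv). assert (HX : (1 <= X)%R) by now apply one_le_add_inv.
  set (e := exp (- Re (v * v))). assert (He : (0 < e)%R) by apply exp_pos.
  rewrite Cmod_mult, <- RtoC_inv, Cmod_R by exact Ha.
  assert (B1 := H5 v Hv Hre). fold X e in B1. assert (B2 := zpow_mod_le v j Hv). fold X in B2.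
  rewrite pow_add. set (p := (X ^ J)%R) in *. set (q := (X ^ Z.abs_nat j)%R) in *.
  assert (Hp : (1 <= p)%R) by now apply pow_R1_Rle. assert (Hq : (1 <= q)%R) by now apply pow_R1_Rle.
  assert (Habs := Rabs_pos (/ a)).
  assert (C1 : (Cmod (Psi v - zpow v j * Cexp (- (v * v))) <= (K + 1) * (p * q) * e)%R).
  { unfold Cminus. eapply Rle_trans; [apply Cmod_triangle|]. rewrite Cmod_opp, Cmod_mult, Cmod_Cexp.
    replace (exp (Re (- (v * v)))) with e by reflexivity.
    assert (D1 : (K * p * e <= K * (p * q) * e)%R).
    { replace (K * p * e)%R with (K * p * e * 1)%R by ring.
      replace (K * (p * q) * e)%R with (K * p * e * q)%R by ring.
      apply Rmult_le_compat_l; [|exact Hq]. repeat apply Rmult_le_pos; lra. }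
    assert (D2 : (Cmod (zpow v j) * e <= 1 * (p * q) * e)%R).
    { apply Rmult_le_compat_r; [lra|]. nra. }
    lra. }
  apply (Rmult_le_compat_l (Rabs (/ a))) in C1; [lra|exact Habs].
- intros F x Hx HF.
  assert (HR := B_continuation_recursion F x (3 / 2 - IZR (m - 1)) Hx HF).
  replace (3 / 2 - IZR (m - 1) - 1)%R with (3 / 2 - IZR m)%R in HR by (rewrite minus_IZR; ring).
  rewrite (H6 F x Hx HF) in HR.
  replace (1 - (3 / 2 - IZR (m - 1)))%R with (IZR (m - 1) - 1 / 2)%R in HR by field.
  rewrite gamma_boundary_half in HR. fold a j in HR.
  set (v := Cexp (RtoC (1 / 2) * Clog (RtoC (-2 * x)))) in *.
  replace (v * v) with (RtoC (-2 * x)) by (symmetry; apply half_log_sq; lra).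
  rewrite <- RtoC_opp, Cexp_RtoC.
  replace (F (RtoC (3 / 2 - IZR (m - 1)))) with (/ RtoC a * (RtoC a * F (RtoC (3 / 2 - IZR (m - 1))))) by (field; exact HaC).
  replace (RtoC a * F (RtoC (3 / 2 - IZR (m - 1)))) with
    (RtoC a * F (RtoC (3 / 2 - IZR (m - 1))) + RtoC (exp (- x)) * (RtoC (exp (- (-2 * x))) * zpow v j) - RtoC (exp (- x)) * (RtoC (exp (- (-2 * x))) * zpow v j)) by ring.
  rewrite <- HR. ring.
Qed.

Theorem B_profile_exists (m : Z) : exists Psi C0 K J, B_profile m Psi C0 K J.
Proof. revert m. apply (Z_bi_ind _ 1%Z); [exact B_profile_base|exact B_profile_succ|exact B_profile_pred]. Qed.

(** * Two-sided series *)

Lemma series_terms_bounded (u : nat -> C) (l : C) : is_cseries u l -> exists B : R, forall n, (Cmod (u n) <= B)%R.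
Proof.
intros H. rewrite is_series_CR in H. destruct (H 1%R Rlt_0_1) as [n0 Hn0].
assert (Hfin : forall N, exists B : R, forall n, (n <= N)%nat -> (Cmod (u n) <= B)%R).
{ induction N as [|N [B HB]].
  - exists (Cmod (u O)). intros n Hn. replace n with O by lia. lra.
  - exists (Rmax B (Cmod (u (S N)))). intros n Hn. destruct (Nat.eq_dec n (S N)) as [->|Hne]; [apply Rmax_r|].
    eapply Rle_trans; [apply HB; lia|apply Rmax_l]. }
destruct (Hfin n0) as [B HB]. exists (Rmax B 2). intros n. destruct (le_lt_dec n n0) as [Hn|Hn].
- eapply Rle_trans; [now apply HB|apply Rmax_l].
- destruct n as [|n]; [lia|]. assert (H1 := Hn0 (S n) ltac:(lia)). assert (H2 := Hn0 n ltac:(lia)).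
  rewrite sum_Sn in H1.
  change (Cmod (csum u n + u (S n) - l) < 1)%R in H1.
  eapply Rle_trans; [|apply Rmax_r].
  replace (u (S n)) with ((csum u n + u (S n) - l) + - (csum u n - l))
    by (generalize (u (S n)); generalize (csum u n : C); intros c1 c2; ring).
  eapply Rle_trans; [apply Cmod_triangle|]. rewrite Cmod_opp. lra.
Qed.

Lemma Zseries_bounded (T : Z -> C) (l : C) : is_Zseries T l -> exists B : R, forall n, (Cmod (T n) <= B)%R.
Proof.
intros [l1 [l2 [H1 [H2 _]]]]. destruct (series_terms_bounded _ _ H1) as [B1 HB1]. destruct (series_terms_bounded _ _ H2) as [B2 HB2].
exists (Rmax B1 B2). intros n. destruct (Z_lt_le_dec n 0) as [Hn|Hn].
- specialize (HB2 (Z.to_nat (- n - 1))). replace (- Z.of_nat (S (Z.to_nat (- n - 1))))%Z with n in HB2 by lia.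
  eapply Rle_trans; [exact HB2|apply Rmax_r].
- specialize (HB1 (Z.to_nat n)). rewrite Z2Nat.id in HB1 by exact Hn. eapply Rle_trans; [exact HB1|apply Rmax_l].
Qed.

Lemma is_Zseries_unique (T : Z -> C) (l l' : C) : is_Zseries T l -> is_Zseries T l' -> l = l'.
Proof.
intros [l1 [l2 [H1 [H2 ->]]]] [l3 [l4 [H3 [H4 ->]]]].
assert (U : forall u a b, is_cseries u a -> is_cseries u b -> a = b).
{ intros u a b Ha Hb. exact (filterlim_locally_unique (V := CR) (F := eventually) _ _ _ Ha Hb). }
f_equal; eapply U; eassumption.
Qed.

Lemma is_Zseries_ext (T T' : Z -> C) (l : C) : (forall n, T n = T' n) -> is_Zseries T l -> is_Zseries T' l.
Proof.
intros H [l1 [l2 [H1 [H2 ->]]]]. exists l1, l2. split; [|split; [|reflexivity]];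
  (eapply (is_series_ext (V := CR)); [|eassumption]); intros; apply H.
Qed.

Lemma is_Zseries_plus (T T' : Z -> C) (l l' : C) : is_Zseries T l -> is_Zseries T' l' -> is_Zseries (fun n => T n + T' n) (l + l').
Proof.
intros [l1 [l2 [H1 [H2 ->]]]] [l3 [l4 [H3 [H4 ->]]]]. exists (l1 + l3), (l2 + l4).
split; [|split; [|ring]]; apply (is_series_plus (V := CR)); assumption.
Qed.

Lemma sum_n_scal (c : C) (u : nat -> C) (n : nat) : csum (fun k => c * u k) n = c * csum u n.
Proof.
induction n as [|n IH]; [now rewrite !sum_O|]. rewrite !sum_Sn, IH.
change (c * csum u n + c * u (S n) = c * (csum u n + u (S n))).
generalize (csum u n : C). intros; ring.
Qed.

Lemma is_Zseries_scal (c : C) (T : Z -> C) (l : C) : is_Zseries T l -> is_Zseries (fun n => c * T n) (c * l).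
Proof.
assert (Hmul : forall (u : nat -> C) l, is_cseries u l -> is_cseries (fun n => c * u n) (c * l)).
{ clear. intros u l Hu. rewrite is_series_CR in *. intros eps He.
  assert (Hc := Cmod_ge_0 c).
  destruct (Hu (eps / (Cmod c + 1))%R) as [n0 Hn0]; [apply Rdiv_lt_0_compat; lra|].
  exists n0. intros n Hn. specialize (Hn0 n Hn). apply Rlt_div_r in Hn0; [|lra].
  rewrite sum_n_scal.
  replace (c * csum u n - c * l) with (c * (csum u n - l))
    by (generalize (csum u n : C); intros; ring).
  rewrite Cmod_mult. assert (H0 := Cmod_ge_0 (csum u n - l)). nra. }
intros [l1 [l2 [A1 [A2 ->]]]]. exists (c * l1), (c * l2). split; [now apply Hmul|split; [now apply Hmul|ring]].
Qed.

(** The sum when the series converges, an arbitrary number otherwise. *)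
Definition Zsum (T : Z -> C) : C := epsilon (inhabits (RtoC 0)) (fun l => is_Zseries T l).

Lemma Zsum_correct (T : Z -> C) : (exists l, is_Zseries T l) -> is_Zseries T (Zsum T).
Proof. exact (epsilon_spec (inhabits (RtoC 0)) _). Qed.

Lemma Zsum_unique (T : Z -> C) (l : C) : is_Zseries T l -> Zsum T = l.
Proof. intros H. eapply is_Zseries_unique; [apply Zsum_correct; now exists l|exact H]. Qed.

(** * Growth of the coefficients *)

Definition Zabs_R (n : Z) : R := IZR (Z.abs n).

Lemma exp_abs_nat (c : R) (n : Z) : (exp (- c) ^ Z.abs_nat n = exp (- (c * Zabs_R n)))%R.
Proof.
unfold Zabs_R. rewrite <- (Zabs2Nat.id_abs n). rewrite <- INR_IZR_INZ. generalize (Z.abs_nat n). intros k.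
induction k as [|k IH]; [simpl; now rewrite Rmult_0_r, Ropp_0, exp_0|].
rewrite S_INR. simpl. rewrite IH, <- exp_plus. f_equal. ring.
Qed.

Lemma Zabs_R_pos (n : Z) : (0 <= Zabs_R n)%R.
Proof. unfold Zabs_R. apply IZR_le. lia. Qed.

Lemma Zabs_R_neg (n : Z) : (n < 0)%Z -> IZR n = (- Zabs_R n)%R.
Proof. intros H. unfold Zabs_R. rewrite <- opp_IZR. f_equal. lia. Qed.

Lemma Zabs_R_nonneg (n : Z) : (0 <= n)%Z -> IZR n = Zabs_R n.
Proof. intros H. unfold Zabs_R. f_equal. lia. Qed.

Lemma Zabs_R_ge1 (n : Z) : n <> 0%Z -> (1 <= Zabs_R n)%R.
Proof. intros H. unfold Zabs_R. apply IZR_le. lia. Qed.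

Lemma pow_le_exp (J : nat) (e : R) : (0 < e)%R -> exists D, (0 < D)%R /\ forall x, (0 <= x)%R -> ((1 + x) ^ J <= D * exp (e * x))%R.
Proof.
intros He. set (J1 := (INR J + 1)%R). assert (HJ := pos_INR J).
set (c := (1 + J1 / e)%R).
assert (Hc : (1 <= c)%R). { unfold c. assert (0 <= J1 / e)%R by (apply Rdiv_le_0_compat; unfold J1; lra). lra. }
exists (c ^ J)%R. split; [apply pow_lt; lra|]. intros x Hx.
assert (H1 : (1 + x <= c * exp (e / J1 * x))%R).
{ assert (H := exp_ineq1_le (e / J1 * x)).
  assert (H2 : (1 <= c * (e / J1))%R).
  { unfold c. replace ((1 + J1 / e) * (e / J1))%R with (1 + e / J1)%R by (unfold J1; field; lra).
    assert (0 <= e / J1)%R by (apply Rdiv_le_0_compat; unfold J1; lra). lra. }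
  apply Rle_trans with (c * (1 + e / J1 * x))%R; [nra|apply Rmult_le_compat_l; lra]. }
apply Rle_trans with ((c * exp (e / J1 * x)) ^ J)%R; [apply pow_incr; lra|].
rewrite Rpow_mult_distr. apply Rmult_le_compat_l; [left; apply pow_lt; lra|].
rewrite <- exp_pow_INR. apply exp_le_le.
replace (e / J1 * x * INR J)%R with (e * x * (INR J / J1))%R by (field; unfold J1; lra).
rewrite <- (Rmult_1_r (e * x)) at 2. apply Rmult_le_compat_l; [nra|]. apply Rle_div_l; unfold J1; lra.
Qed.

(** The factor in sqrt(-2x) = mu_n sqrt(y) for x = 2 pi n y; it is real for n < 0 and
    purely imaginary for n > 0. *)
Definition mu (n : Z) : C := if Z_lt_le_dec n 0 then RtoC (sqrt (4 * PI * Zabs_R n)) else Ci * RtoC (sqrt (4 * PI * Zabs_R n)).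

Lemma mu_mod (n : Z) : Cmod (mu n) = sqrt (4 * PI * Zabs_R n).
Proof.
unfold mu. destruct (Z_lt_le_dec n 0); rewrite ?Cmod_mult, ?Cmod_Ci, Cmod_R, Rabs_pos_eq by apply sqrt_pos; ring.
Qed.

Lemma four_pi_abs (n : Z) : n <> 0%Z -> (1 <= 4 * PI * Zabs_R n)%R.
Proof. intros Hn. assert (H := Zabs_R_ge1 n Hn). assert (HP := PI2_3_2). nra. Qed.

Lemma mu_mod_ge1 (n : Z) : n <> 0%Z -> (1 <= Cmod (mu n))%R.
Proof. intros Hn. rewrite mu_mod, <- sqrt_1. now apply sqrt_le_1_alt, four_pi_abs. Qed.

Lemma mu_mod_le (n : Z) : n <> 0%Z -> (Cmod (mu n) <= 16 * (1 + Zabs_R n))%R.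
Proof.
intros Hn. rewrite mu_mod. assert (H := four_pi_abs n Hn). assert (H1 := Zabs_R_pos n). assert (HP := PI_4).
apply Rle_trans with (4 * PI * Zabs_R n)%R; [|nra].
rewrite <- (sqrt_square (4 * PI * Zabs_R n)) at 2 by lra. apply sqrt_le_1_alt. nra.
Qed.

Lemma mu_nz (n : Z) : n <> 0%Z -> mu n <> 0.
Proof. intros Hn. apply Cmod_gt_0. assert (H := mu_mod_ge1 n Hn). lra. Qed.

Lemma mu_sq (n : Z) : mu n * mu n = RtoC (- (4 * PI * IZR n)).
Proof.
unfold mu. assert (HP := PI_RGT_0). assert (H := Zabs_R_pos n).
assert (H4 : (0 <= 4 * PI * Zabs_R n)%R) by nra.
destruct (Z_lt_le_dec n 0) as [Hn|Hn].
- rewrite <- RtoC_mult, sqrt_sqrt, (Zabs_R_neg n Hn) by exact H4. f_equal. ring.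
- replace (Ci * RtoC (sqrt (4 * PI * Zabs_R n)) * (Ci * RtoC (sqrt (4 * PI * Zabs_R n)))) with
    (RtoC (- (sqrt (4 * PI * Zabs_R n) * sqrt (4 * PI * Zabs_R n))))
    by (unfold RtoC, Ci, Cmult; simpl; f_equal; ring).
  rewrite sqrt_sqrt, (Zabs_R_nonneg n Hn) by exact H4. reflexivity.
Qed.

Lemma mu_half_log (n : Z) (y : R) : n <> 0%Z -> (0 < y)%R ->
  Cexp (RtoC (1 / 2) * Clog (RtoC (-2 * (2 * PI * IZR n * y)))) = mu n * RtoC (sqrt y).
Proof.
intros Hn Hy. unfold mu. assert (HP := PI_RGT_0). assert (H := Zabs_R_ge1 n Hn).
assert (H4 : (0 < 4 * PI * Zabs_R n)%R) by nra.
destruct (Z_lt_le_dec n 0) as [Hn'|Hn'].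
- rewrite (Zabs_R_neg n Hn'). replace (-2 * (2 * PI * - Zabs_R n * y))%R with (4 * PI * Zabs_R n * y)%R by ring.
  rewrite half_log_pos by nra. rewrite sqrt_mult by lra. apply RtoC_mult.
- rewrite (Zabs_R_nonneg n Hn'). replace (-2 * (2 * PI * Zabs_R n * y))%R with (- (4 * PI * Zabs_R n * y))%R by ring.
  rewrite half_log_neg by nra. rewrite Ropp_involutive, sqrt_mult, RtoC_mult by lra. ring.
Qed.

Lemma zpow_mod_ge (v : C) (j : Z) : v <> 0 -> (/ (Cmod v + / Cmod v) ^ Z.abs_nat j <= Cmod (zpow v j))%R.
Proof.
intros Hv. assert (H := zpow_mod_le v (- j) Hv). replace (Z.abs_nat (- j)) with (Z.abs_nat j) in H by lia.
assert (E : zpow v j * zpow v (- j) = 1) by (rewrite <- zpow_add by exact Hv; now rewrite Z.add_opp_diag_r).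
assert (E1 : (Cmod (zpow v j) * Cmod (zpow v (- j)) = 1)%R) by (rewrite <- Cmod_mult, E; apply Cmod_1).
assert (H0 := Cmod_ge_0 (zpow v j)). assert (H1 := Cmod_ge_0 (zpow v (- j))).
assert (Hp : (0 < (Cmod v + / Cmod v) ^ Z.abs_nat j)%R).
{ apply pow_lt. assert (Hm := proj1 (Cmod_gt_0 v) Hv). assert (Hi := Rinv_0_lt_compat _ Hm). lra. }
apply (Rmult_le_reg_r ((Cmod v + / Cmod v) ^ Z.abs_nat j)); [exact Hp|]. rewrite Rinv_l by lra. nra.
Qed.

Section CoefficientBounds.
Variables (m : Z) (Psi : C -> C) (C0 : C) (KP : R) (JP : nat).
Hypothesis HPsi : B_profile m Psi C0 KP JP.

(** As s varies, Psi(mu_n s) moves in a fixed direction: its derivative is a constant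
    times a positive function.  So a difference of two values, unlike a single
    value, is bounded from below. *)
Lemma psi_increment (n : Z) (s1 s2 : R) : n <> 0%Z -> (0 < s1 < s2)%R -> exists s, (s1 <= s <= s2)%R /\
  (2 * Cmod (mu n) * Cmod (zpow (mu n) (2 * m - 2)) * Cmod (zpow (RtoC s) (2 * m - 2)) * exp (4 * PI * IZR n * (s * s)) * (s2 - s1)
    <= Cmod (Psi (mu n * RtoC s2) - Psi (mu n * RtoC s1)))%R.
Proof.
intros Hn Hs. assert (Hmu := mu_nz n Hn).
assert (Hz : forall s : R, (0 < s)%R -> RtoC s <> 0) by (intros s H1 H2; apply RtoC_inj in H2; lra).
set (c := - (2) * mu n * zpow (mu n) (2 * m - 2)).
assert (Hc : c <> 0).
{ unfold c. apply Cmult_neq_0; [apply Cmult_neq_0; [|exact Hmu]|now apply zpow_nz].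
  intros H. assert (H2 : RtoC 2 = 0) by (replace (RtoC 2) with (- - (2)) by ring; rewrite H; ring). apply RtoC_inj in H2. lra. }
set (h := fun s : R => (powerRZ s (2 * m - 2) * exp (4 * PI * IZR n * (s * s)))%R).
assert (Hder : forall s : R, (0 < s)%R -> is_rderive (fun s => Psi (0 + RtoC s * mu n)) s (c * RtoC (h s))).
{ intros s Hs0. assert (Hv : 0 + RtoC s * mu n <> 0) by (rewrite Cplus_0_l; auto using Cmult_neq_0).
  assert (H := is_cderive_line Psi 0 (mu n) _ s (psi_derive _ _ _ _ _ HPsi _ Hv)).
  match type of H with is_derive _ _ ?x => replace (c * RtoC (h s)) with x; [exact H|] end.
  rewrite !Cplus_0_l, zpow_mult, zpow_RtoC by (auto; lra).
  replace (- (RtoC s * mu n * (RtoC s * mu n))) with (RtoC (4 * PI * IZR n * (s * s))).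
  2:{ replace (- (RtoC s * mu n * (RtoC s * mu n))) with (- (RtoC s * RtoC s * (mu n * mu n))) by ring.
      rewrite mu_sq, <- !RtoC_mult, <- RtoC_opp. f_equal. ring. }
  rewrite Cexp_RtoC. unfold c, h. rewrite RtoC_mult. Cring. }
set (G := fun s : R => Psi (0 + RtoC s * mu n)).
(* Re (conj c * G) has the derivative |c|^2 h *)
set (g := fun s : R => (Re c * Re (G s) + Im c * Im (G s))%R).
assert (Hg : forall s, (0 < s)%R -> is_derive g s (Cmod c * Cmod c * h s)%R).
{ intros s Hs0. specialize (Hder s Hs0).
  assert (H1 : is_derive (fun t => Re (G t)) s (Re (c * RtoC (h s)))) by exact (is_rderive_Re _ _ _ Hder).
  assert (H2 : is_derive (fun t => Im (G t)) s (Im (c * RtoC (h s)))) by exact (is_rderive_Im _ _ _ Hder).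
  assert (H3 := is_derive_plus (V := R_NormedModule) _ _ _ _ _ (is_derive_scal _ s (Re c) _ H1) (is_derive_scal _ s (Im c) _ H2)).
  match type of H3 with is_derive _ _ ?x => replace (Cmod c * Cmod c * h s)%R with x; [exact H3|] end.
  replace (Cmod c * Cmod c * h s)%R with ((Re c * Re c + Im c * Im c) * h s)%R
    by (f_equal; transitivity (Cmod c ^ 2)%R; [rewrite Cmod2_alt; ring|ring]).
  change (Re c * Re (c * RtoC (h s)) + Im c * Im (c * RtoC (h s)) = (Re c * Re c + Im c * Im c) * h s)%R.
  destruct c as [c1 c2]. unfold Cmult, RtoC, Re, Im; simpl. ring. }
destruct (MVT_gen g s1 s2 (fun s => Cmod c * Cmod c * h s)%R) as [s [Hs1 Hs2]].
- intros t Ht. rewrite Rmin_left in Ht by lra. apply Hg. lra.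
- intros t Ht. rewrite Rmin_left in Ht by lra. apply derivable_continuous_pt. eexists. apply is_derive_Reals, Hg. lra.
- rewrite Rmin_left, Rmax_right in Hs1 by lra. exists s. split; [exact Hs1|].
  replace (mu n * RtoC s2) with (0 + RtoC s2 * mu n) by ring. replace (mu n * RtoC s1) with (0 + RtoC s1 * mu n) by ring.
  change (Psi (0 + RtoC s2 * mu n)) with (G s2). change (Psi (0 + RtoC s1 * mu n)) with (G s1).
  assert (Hcm := proj1 (Cmod_gt_0 c) Hc).
  assert (Hle : (g s2 - g s1 <= Cmod c * Cmod (G s2 - G s1))%R).
  { replace (g s2 - g s1)%R with (Re (Cconj c * (G s2 - G s1))).
    - eapply Rle_trans; [apply Rle_abs|]. eapply Rle_trans; [apply re_le_Cmod|]. rewrite Cmod_mult, Cmod_conj. lra.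
    - unfold g, Cconj, Cmult, Cminus, Cplus, Copp, Re, Im; simpl. ring. }
  rewrite Hs2 in Hle.
  assert (Hh : (Cmod c * h s * (s2 - s1) <= Cmod (G s2 - G s1))%R).
  { apply (Rmult_le_reg_l (Cmod c)); [exact Hcm|]. lra. }
  eapply Rle_trans; [|exact Hh]. right. unfold c, h. rewrite !Cmod_mult, Cmod_opp, Cmod_R, (Rabs_pos_eq 2) by lra.
  rewrite zpow_RtoC, Cmod_R by lra.
  rewrite (Rabs_pos_eq (powerRZ s (2 * m - 2))) by (apply powerRZ_le; lra). ring.
Qed.

Variable a : Z -> C.
Hypothesis Ha : forall y : R, (0 < y)%R -> exists B : R, forall n, n <> 0%Z ->
  (Cmod (a n) * Cmod (Psi (mu n * RtoC (sqrt y))) <= B * exp (2 * PI * IZR n * y))%R.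

(** The terms of the series at two heights bound a(n) times a difference of values
    of Psi, and psi_increment bounds this difference from below. *)
Lemma coeff_between_heights (y1 y2 e : R) : (0 < y1 < y2)%R -> (0 < e)%R -> exists D : R, (0 <= D)%R /\ forall n, n <> 0%Z -> exists y, (y1 <= y <= y2)%R /\
  (Cmod (a n) <= D * exp (e * Zabs_R n) * (exp (2 * PI * IZR n * y1) + exp (2 * PI * IZR n * y2)) * exp (- (4 * PI * IZR n * y)))%R.
Proof.
intros Hy He. destruct (Ha y1 ltac:(lra)) as [B1 HB1]. destruct (Ha y2 ltac:(lra)) as [B2 HB2].
set (s1 := sqrt y1). set (s2 := sqrt y2).
assert (Hs1 : (0 < s1)%R) by (apply sqrt_lt_R0; lra).
assert (Hs12 : (s1 < s2)%R) by (apply sqrt_lt_1_alt; lra).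
set (J := Z.abs_nat (2 * m - 2)).
destruct (pow_le_exp J e He) as [D0 [HD0 HD]].
set (X := ((s2 + / s1) ^ J)%R).
assert (Hi1 := Rinv_0_lt_compat _ Hs1).
assert (HX : (0 < X)%R) by (apply pow_lt; lra).
set (B := (Rabs B1 + Rabs B2)%R). assert (HB0 : (0 <= B)%R) by (unfold B; assert (H1 := Rabs_pos B1); assert (H2 := Rabs_pos B2); lra).
assert (H32 : (0 < 32 ^ J)%R) by (apply pow_lt; lra).
exists (B * 32 ^ J * D0 * X / (s2 - s1))%R. split.
{ apply Rdiv_le_0_compat; [|lra]. repeat apply Rmult_le_pos; lra. }
intros n Hn.
destruct (psi_increment n s1 s2 Hn ltac:(lra)) as [s [Hs Hinc]].
exists (s * s)%R.
assert (Hsq1 : (s1 * s1 = y1)%R) by (apply sqrt_sqrt; lra). assert (Hsq2 : (s2 * s2 = y2)%R) by (apply sqrt_sqrt; lra).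
split; [split; nra|].
specialize (HB1 n Hn). specialize (HB2 n Hn). fold s1 in HB1. fold s2 in HB2.
set (E1 := exp (2 * PI * IZR n * y1)) in *. set (E2 := exp (2 * PI * IZR n * y2)) in *.
assert (HE1 : (0 < E1)%R) by apply exp_pos. assert (HE2 : (0 < E2)%R) by apply exp_pos.
assert (Hup : (Cmod (a n) * Cmod (Psi (mu n * RtoC s2) - Psi (mu n * RtoC s1)) <= B * (E1 + E2))%R).
{ apply Rle_trans with (Cmod (a n) * (Cmod (Psi (mu n * RtoC s2)) + Cmod (Psi (mu n * RtoC s1))))%R.
  - apply Rmult_le_compat_l; [apply Cmod_ge_0|]. unfold Cminus. eapply Rle_trans; [apply Cmod_triangle|]. rewrite Cmod_opp. lra.
  - assert (A1 := Rle_abs B1). assert (A2 := Rle_abs B2). assert (A3 := Rabs_pos B1). assert (A4 := Rabs_pos B2).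
    assert (B1 * E1 <= Rabs B1 * E1)%R by (apply Rmult_le_compat_r; lra).
    assert (B2 * E2 <= Rabs B2 * E2)%R by (apply Rmult_le_compat_r; lra).
    assert (0 <= Rabs B1 * E2)%R by nra. assert (0 <= Rabs B2 * E1)%R by nra. unfold B. lra. }
set (Ex := exp (4 * PI * IZR n * (s * s))) in *. assert (HEx : (0 < Ex)%R) by apply exp_pos.
assert (Hmu1 := mu_mod_ge1 n Hn). assert (Hmu2 := mu_mod_le n Hn). assert (Hab := Zabs_R_pos n).
set (P := (32 ^ J * (D0 * exp (e * Zabs_R n)))%R).
assert (He0 := exp_pos (e * Zabs_R n)).
assert (HP : (0 < P)%R) by (unfold P; apply Rmult_lt_0_compat; [exact H32|nra]).
assert (Hz1 : (/ P <= Cmod (zpow (mu n) (2 * m - 2)))%R).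
{ eapply Rle_trans; [|apply zpow_mod_ge, mu_nz, Hn]. fold J.
  apply Rinv_le_contravar; [apply pow_lt; assert (H := Rinv_0_lt_compat (Cmod (mu n)) ltac:(lra)); lra|].
  apply Rle_trans with ((32 * (1 + Zabs_R n)) ^ J)%R.
  - apply pow_incr. assert (Hi : (/ Cmod (mu n) <= 1)%R) by (rewrite <- Rinv_1; apply Rinv_le_contravar; lra).
    assert (Hi' := Rinv_0_lt_compat (Cmod (mu n)) ltac:(lra)). lra.
  - rewrite Rpow_mult_distr. unfold P. apply Rmult_le_compat_l; [lra|]. now apply HD. }
assert (Hz2 : (/ X <= Cmod (zpow (RtoC s) (2 * m - 2)))%R).
{ eapply Rle_trans; [|apply zpow_mod_ge]. 2:{ intros H. apply RtoC_inj in H. lra. }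
  fold J. rewrite Cmod_R, Rabs_pos_eq by lra.
  assert (Hi := Rinv_0_lt_compat s ltac:(lra)).
  apply Rinv_le_contravar; [apply pow_lt; lra|]. apply pow_incr.
  assert (/ s <= / s1)%R by (apply Rinv_le_contravar; lra). lra. }
assert (HiP := Rinv_0_lt_compat P HP). assert (HiX := Rinv_0_lt_compat X HX).
assert (Hlow : (/ P * / X * Ex * (s2 - s1) <= Cmod (Psi (mu n * RtoC s2) - Psi (mu n * RtoC s1)))%R).
{ eapply Rle_trans; [|exact Hinc]. apply Rmult_le_compat_r; [lra|]. apply Rmult_le_compat_r; [lra|].
  apply Rmult_le_compat; [lra|lra| |exact Hz2].
  assert (Hz0 := Cmod_ge_0 (zpow (mu n) (2 * m - 2))). nra. }
assert (Hfin : (Cmod (a n) * (/ P * / X * Ex * (s2 - s1)) <= B * (E1 + E2))%R).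
{ eapply Rle_trans; [|exact Hup]. apply Rmult_le_compat_l; [apply Cmod_ge_0|exact Hlow]. }
rewrite exp_Ropp. fold Ex.
apply (Rmult_le_reg_r (/ P * / X * Ex * (s2 - s1))).
{ repeat apply Rmult_lt_0_compat; lra. }
eapply Rle_trans; [exact Hfin|]. right. unfold P. field. repeat split; lra.
Qed.

Lemma coeff_neg (e : R) : (0 < e)%R -> exists D : R, (0 <= D)%R /\ forall n, (n < 0)%Z -> (Cmod (a n) <= D * exp (e * Zabs_R n))%R.
Proof.
intros He. assert (HPI := PI_RGT_0).
set (y := (e / (16 * PI))%R). assert (Hy : (0 < y)%R) by (apply Rdiv_lt_0_compat; lra).
destruct (coeff_between_heights y (2 * y) (e / 2) ltac:(lra) ltac:(lra)) as [D [HD0 HD]].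
exists (2 * D)%R. split; [lra|]. intros n Hn.
destruct (HD n ltac:(lia)) as [u [Hu H]]. eapply Rle_trans; [exact H|]. clear H.
rewrite (Zabs_R_neg n Hn). set (x := Zabs_R n). assert (Hx : (0 <= x)%R) by apply Zabs_R_pos.
assert (Hpx : (0 <= PI * x)%R) by nra. assert (Hpxy : (0 <= PI * x * y)%R) by nra.
assert (H1 : (exp (2 * PI * - x * y) <= 1)%R) by (rewrite <- exp_0; apply exp_le_le; lra).
assert (H2 : (exp (2 * PI * - x * (2 * y)) <= 1)%R) by (rewrite <- exp_0; apply exp_le_le; lra).
assert (H3 : (exp (- (4 * PI * - x * u)) <= exp (e / 2 * x))%R).
{ apply exp_le_le. replace (- (4 * PI * - x * u))%R with (4 * PI * u * x)%R by ring. apply Rmult_le_compat_r; [exact Hx|].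
  replace (e / 2)%R with (4 * PI * (2 * y))%R by (unfold y; field; lra). apply Rmult_le_compat_l; lra. }
assert (P1 := exp_pos (2 * PI * - x * y)). assert (P2 := exp_pos (2 * PI * - x * (2 * y))). assert (P3 := exp_pos (- (4 * PI * - x * u))).
assert (P4 := exp_pos (e / 2 * x)).
replace (exp (e * x)) with (exp (e / 2 * x) * exp (e / 2 * x))%R by (rewrite <- exp_plus; f_equal; field).
apply Rle_trans with (D * exp (e / 2 * x) * 2 * exp (e / 2 * x))%R; [|right; ring].
assert (0 <= D * exp (e / 2 * x))%R by (apply Rmult_le_pos; lra).
apply Rmult_le_compat; [apply Rmult_le_pos; lra|lra|apply Rmult_le_compat_l; lra|exact H3].
Qed.

(** At height y the bound on the terms allows growth e^{2 pi n y}, but an increment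
    of Psi is of size e^{4 pi n y}; y is arbitrary. *)
Lemma coeff_pos (R0 : R) : (0 < R0)%R -> exists D : R, (0 <= D)%R /\ forall n, (0 < n)%Z -> (Cmod (a n) <= D * exp (- (R0 * Zabs_R n)))%R.
Proof.
intros HR. assert (HPI := PI_RGT_0).
(* with y2 = 3/2 y1 the growth exp(2 pi n y2) is beaten by the decay exp(-4 pi n y1) *)
set (y := (2 * R0 / PI)%R). assert (Hy : (0 < y)%R) by (apply Rdiv_lt_0_compat; lra).
destruct (coeff_between_heights y (3 / 2 * y) R0 ltac:(lra) ltac:(lra)) as [D [HD0 HD]].
exists (2 * D)%R. split; [lra|]. intros n Hn.
destruct (HD n ltac:(lia)) as [u [Hu H]]. eapply Rle_trans; [exact H|]. clear H.
rewrite (Zabs_R_nonneg n) by lia. set (x := Zabs_R n). assert (Hx : (0 <= x)%R) by apply Zabs_R_pos.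
assert (HyE : (PI * y = 2 * R0)%R) by (unfold y; field; lra).
assert (Hxy : (PI * x * y = 2 * R0 * x)%R) by (rewrite <- HyE; ring).
assert (Hrx : (0 <= R0 * x)%R) by nra.
assert (H1 : (exp (2 * PI * x * y) <= exp (6 * (R0 * x)))%R) by (apply exp_le_le; lra).
assert (H2 : (exp (2 * PI * x * (3 / 2 * y)) <= exp (6 * (R0 * x)))%R) by (apply exp_le_le; lra).
assert (H3 : (exp (- (4 * PI * x * u)) <= exp (- (8 * (R0 * x))))%R).
{ apply exp_le_le. apply Ropp_le_contravar. assert (H := Rmult_le_compat_l (4 * (PI * x)) y u ltac:(nra) (proj1 Hu)). lra. }
assert (P4 := exp_pos (R0 * x)). assert (P5 := exp_pos (6 * (R0 * x))).
assert (P1 := exp_pos (2 * PI * x * y)). assert (P2 := exp_pos (2 * PI * x * (3 / 2 * y))). assert (P3 := exp_pos (- (4 * PI * x * u))).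
apply Rle_trans with (D * exp (R0 * x) * (2 * exp (6 * (R0 * x))) * exp (- (8 * (R0 * x))))%R.
- assert (0 <= D * exp (R0 * x))%R by (apply Rmult_le_pos; lra).
  apply Rmult_le_compat; [apply Rmult_le_pos; lra|lra|apply Rmult_le_compat_l; lra|exact H3].
- right. replace (exp (- (R0 * x))) with (exp (R0 * x) * exp (6 * (R0 * x)) * exp (- (8 * (R0 * x))))%R
    by (rewrite <- !exp_plus; f_equal; ring). ring.
Qed.
End CoefficientBounds.

Section Sums.
Variables (m : Z) (Psi : C -> C) (C0 : C) (KP : R) (JP : nat).
Hypothesis HPsi : B_profile m Psi C0 KP JP.
Variable a : Z -> C.
Hypothesis Ha : forall y : R, (0 < y)%R -> exists B : R, forall n, n <> 0%Z ->
  (Cmod (a n) * Cmod (Psi (mu n * RtoC (sqrt y))) <= B * exp (2 * PI * IZR n * y))%R.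

(** A bound off the right half plane as well, by reflection. *)
Lemma psi_crude (v : C) : v <> 0 ->
  (Cmod (Psi v) <= 2 * Cmod C0 + KP * (Cmod v + / Cmod v) ^ JP * exp (Cmod v * Cmod v))%R.
Proof.
intros Hv.
assert (P : forall v : C, v <> 0 -> (0 <= Re v)%R -> (Cmod (Psi v) <= KP * (Cmod v + / Cmod v) ^ JP * exp (Cmod v * Cmod v))%R).
{ clear v Hv. intros v Hv Hre. eapply Rle_trans; [apply (psi_bound _ _ _ _ _ HPsi v Hv Hre)|].
  assert (Hm := proj1 (Cmod_gt_0 v) Hv). assert (Hi := Rinv_0_lt_compat _ Hm).
  apply Rmult_le_compat_l.
  - apply Rmult_le_pos; [apply (psi_K _ _ _ _ _ HPsi)|apply pow_le; lra].
  - apply exp_le_le. rewrite <- Cmod_mult. assert (H := re_le_Cmod (v * v)). apply Rabs_le_between in H. lra. }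
assert (HC := Cmod_ge_0 C0).
destruct (Rle_dec 0 (Re v)) as [Hre|Hre]; [specialize (P v Hv Hre); lra|].
assert (Hv' : - v <> 0) by (intros H; apply Hv; replace v with (- - v) by ring; rewrite H; ring).
specialize (P (- v) Hv'). rewrite Cmod_opp in P. specialize (P ltac:(destruct v; simpl in *; lra)).
replace (Psi v) with (2 * C0 + - Psi (- v)) by (rewrite <- (psi_sym _ _ _ _ _ HPsi v Hv); ring).
eapply Rle_trans; [apply Cmod_triangle|]. rewrite Cmod_opp, Cmod_mult, Cmod_R, Rabs_pos_eq by lra. lra.
Qed.

Variable a0 : C.

(** The terms of the expansion of h with sqrt(y) replaced by an independent V. *)
Definition ext_term (n : Z) (V z : C) : C :=
  if Z.eq_dec n 0 then a0 * zpow V (2 * m - 1) else a n * Psi (mu n * V) * qexp n z.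

Lemma mu_V_size (n : Z) (V : C) (c : R) : n <> 0%Z -> V <> 0 -> (Cmod V + / Cmod V <= c)%R ->
  (Cmod (mu n * V) + / Cmod (mu n * V) <= 16 * c * (1 + Zabs_R n))%R.
Proof.
intros Hn HV Hc. rewrite Cmod_mult. assert (H1 := mu_mod_ge1 n Hn). assert (H2 := mu_mod_le n Hn).
assert (Hm := proj1 (Cmod_gt_0 V) HV). assert (Hi := Rinv_0_lt_compat _ Hm).
rewrite Rinv_mult.
assert (H3 : (/ Cmod (mu n) <= 1)%R) by (rewrite <- Rinv_1; apply Rinv_le_contravar; lra).
assert (H4 : (/ Cmod (mu n) * / Cmod V <= Cmod (mu n) * / Cmod V)%R) by (apply Rmult_le_compat_r; lra).
apply Rle_trans with (Cmod (mu n) * (Cmod V + / Cmod V))%R; [lra|].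
apply Rle_trans with (16 * (1 + Zabs_R n) * c)%R; [|right; ring].
apply Rmult_le_compat; lra.
Qed.

(** For n < 0, Psi(mu_n V) q^n is of size e^{4 pi n Re V^2 - 2 pi n Im z}, which decays
    exactly when Im z < 2 Re V^2.  For n > 0 the decay of a(n) beats everything; there
    mu_n V may leave the right half plane, where psi_crude applies. *)
Lemma ext_term_bound (c d R0 : R) : (0 < d)%R -> exists D rho : R, (0 <= rho < 1)%R /\
  forall n (V z : C), V <> 0 -> (0 <= Re V)%R -> (Cmod V + / Cmod V <= c)%R -> (Im z - 2 * Re (V * V)%C <= - d)%R -> (Cmod z <= R0)%R ->
    (Cmod (ext_term n V z) <= D * rho ^ Z.abs_nat n)%R.
Proof.
intros Hd. assert (HPI := PI_RGT_0).
set (e := (PI * d / 2)%R). assert (He : (0 < e)%R) by (unfold e; nra).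
destruct (coeff_neg m Psi C0 KP JP HPsi a Ha e He) as [D1 [HD1 Hneg]].
set (R1 := (4 * PI * (c * c) + 2 * PI * Rabs R0 + e + PI * d + 1)%R).
assert (HR0 := Rabs_pos R0).
assert (HR1 : (0 < R1)%R).
{ unfold R1. assert (0 <= PI * Rabs R0)%R by nra. assert (0 <= PI * (c * c))%R by nra. assert (0 < PI * d)%R by nra. lra. }
destruct (coeff_pos m Psi C0 KP JP HPsi a Ha R1 HR1) as [D2 [HD2 Hpos]].
destruct (pow_le_exp JP e He) as [D3 [HD3 Hpoly]].
set (W := ((16 * Rabs c) ^ JP)%R).
assert (HW : (0 <= W)%R) by (apply pow_le; assert (H := Rabs_pos c); lra).
assert (HK := psi_K _ _ _ _ _ HPsi).
set (E1 := (D1 * (KP * (W * D3)))%R).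
set (E2 := (D2 * (2 * Cmod C0 + KP * (W * D3)))%R).
set (E3 := (Cmod a0 * (Rabs c) ^ Z.abs_nat (2 * m - 1))%R).
assert (HWD : (0 <= KP * (W * D3))%R) by (apply Rmult_le_pos; [lra|apply Rmult_le_pos; lra]).
assert (HE1 : (0 <= E1)%R) by (apply Rmult_le_pos; lra).
assert (HC := Cmod_ge_0 C0).
assert (HE2 : (0 <= E2)%R) by (apply Rmult_le_pos; lra).
assert (HE3 : (0 <= E3)%R) by (apply Rmult_le_pos; [apply Cmod_ge_0|apply pow_le, Rabs_pos]).
exists (E1 + E2 + E3)%R, (exp (- (PI * d))). split.
{ split; [left; apply exp_pos|]. rewrite <- exp_0. apply exp_increasing. nra. }
intros n V z HV Hre Hc Him Hz. rewrite exp_abs_nat. set (x := Zabs_R n). assert (Hx : (0 <= x)%R) by apply Zabs_R_pos.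
assert (Hm := proj1 (Cmod_gt_0 V) HV). assert (Hi := Rinv_0_lt_compat _ Hm).
assert (Hc0 : (0 < c)%R) by lra. assert (Hcabs : Rabs c = c) by (apply Rabs_pos_eq; lra).
assert (Hexp := exp_pos (- (PI * d * x))).
unfold ext_term. destruct (Z.eq_dec n 0) as [->|Hn].
- unfold x. replace (Zabs_R 0) with 0%R by reflexivity. rewrite Rmult_0_r, Ropp_0, exp_0, Rmult_1_r.
  apply Rle_trans with E3; [|lra]. rewrite Cmod_mult. unfold E3. apply Rmult_le_compat_l; [apply Cmod_ge_0|].
  eapply Rle_trans; [now apply zpow_mod_le|]. apply pow_incr. rewrite Hcabs. lra.
- assert (Hmu := mu_nz n Hn). assert (Hv : mu n * V <> 0) by now apply Cmult_neq_0.
  assert (Hsize := mu_V_size n V c Hn HV Hc). fold x in Hsize.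
  assert (Hmv := proj1 (Cmod_gt_0 _) Hv). assert (Hiv := Rinv_0_lt_compat _ Hmv).
  assert (HX : ((Cmod (mu n * V) + / Cmod (mu n * V)) ^ JP <= W * D3 * exp (e * x))%R).
  { apply Rle_trans with ((16 * c * (1 + x)) ^ JP)%R; [apply pow_incr; lra|].
    rewrite Rpow_mult_distr. unfold W. rewrite Hcabs, Rmult_assoc. apply Rmult_le_compat_l; [apply pow_le; lra|]. now apply Hpoly. }
  assert (HX0 : (0 <= (Cmod (mu n * V) + / Cmod (mu n * V)) ^ JP)%R) by (apply pow_le; lra).
  assert (Hex := exp_pos (e * x)).
  rewrite !Cmod_mult, Cmod_qexp.
  destruct (Z_lt_le_dec n 0) as [Hs|Hs].
  + apply Rle_trans with (E1 * exp (- (PI * d * x)))%R; [|apply Rmult_le_compat_r; lra].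
    specialize (Hneg n Hs). fold x in Hneg.
    assert (Hvr : (0 <= Re (mu n * V))%R).
    { unfold mu. destruct (Z_lt_le_dec n 0); [|lia]. destruct V as [p q]. unfold RtoC, Cmult, Re in *; simpl in *.
      assert (H := sqrt_pos (4 * PI * Zabs_R n)). nra. }
    assert (Hb := psi_bound _ _ _ _ _ HPsi _ Hv Hvr).
    replace (mu n * V * (mu n * V)) with (RtoC (4 * PI * x) * (V * V)) in Hb.
    2:{ replace (mu n * V * (mu n * V)) with (mu n * mu n * (V * V)) by ring. rewrite mu_sq, (Zabs_R_neg n Hs). do 2 f_equal. unfold x. ring. }
    replace (Re (RtoC (4 * PI * x) * (V * V))) with (4 * PI * x * Re (V * V))%R in Hb by (unfold RtoC, Cmult, Re; simpl; ring).
    set (r := Re (V * V)) in *.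
    assert (Hb2 : (Cmod (Psi (mu n * V)) <= KP * (W * D3 * exp (e * x)) * exp (- (4 * PI * x * r)))%R).
    { eapply Rle_trans; [exact Hb|]. apply Rmult_le_compat_r; [left; apply exp_pos|]. now apply Rmult_le_compat_l. }
    rewrite (Zabs_R_neg n Hs). fold x.
    apply Rle_trans with ((D1 * exp (e * x)) * (KP * (W * D3 * exp (e * x)) * exp (- (4 * PI * x * r))) * exp (- (2 * PI * - x * Im z)))%R.
    * apply Rmult_le_compat_r; [left; apply exp_pos|]. apply Rmult_le_compat; try apply Cmod_ge_0; assumption.
    * replace (D1 * exp (e * x) * (KP * (W * D3 * exp (e * x)) * exp (- (4 * PI * x * r))) * exp (- (2 * PI * - x * Im z)))%R
        with (E1 * (exp (e * x) * exp (e * x) * exp (- (4 * PI * x * r)) * exp (- (2 * PI * - x * Im z))))%R by (unfold E1; ring).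
      apply Rmult_le_compat_l; [exact HE1|]. rewrite <- !exp_plus. apply exp_le_le. unfold e.
      assert (H := Rmult_le_compat_l (2 * PI * x) _ _ ltac:(nra) Him). lra.
  + apply Rle_trans with (E2 * exp (- (PI * d * x)))%R; [|apply Rmult_le_compat_r; lra].
    specialize (Hpos n ltac:(lia)). fold x in Hpos.
    assert (Hb := psi_crude _ Hv).
    assert (Hvv : (Cmod (mu n * V) * Cmod (mu n * V) <= 4 * PI * (c * c) * x)%R).
    { rewrite Cmod_mult, mu_mod. fold x.
      replace (sqrt (4 * PI * x) * Cmod V * (sqrt (4 * PI * x) * Cmod V))%R with ((sqrt (4 * PI * x) * sqrt (4 * PI * x)) * (Cmod V * Cmod V))%R by ring.
      rewrite sqrt_sqrt by nra. assert (Cmod V * Cmod V <= c * c)%R by nra.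
      replace (4 * PI * (c * c) * x)%R with (4 * PI * x * (c * c))%R by ring. apply Rmult_le_compat_l; nra. }
    assert (Hb2 : (Cmod (Psi (mu n * V)) <= (2 * Cmod C0 + KP * (W * D3)) * exp (e * x + 4 * PI * (c * c) * x))%R).
    { eapply Rle_trans; [exact Hb|]. rewrite exp_plus.
      assert (H1 : (exp (Cmod (mu n * V) * Cmod (mu n * V)) <= exp (4 * PI * (c * c) * x))%R) by now apply exp_le_le.
      assert (H0 := exp_pos (Cmod (mu n * V) * Cmod (mu n * V))).
      assert (H2 : (1 <= exp (e * x))%R) by (rewrite <- exp_0; apply exp_le_le; nra).
      assert (H3 : (1 <= exp (4 * PI * (c * c) * x))%R).
      { rewrite <- exp_0; apply exp_le_le. assert (0 <= PI * (c * c))%R by nra. nra. }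
      assert (H4 : (KP * (Cmod (mu n * V) + / Cmod (mu n * V)) ^ JP * exp (Cmod (mu n * V) * Cmod (mu n * V)) <=
                    KP * (W * D3 * exp (e * x)) * exp (4 * PI * (c * c) * x))%R).
      { apply Rmult_le_compat; [now apply Rmult_le_pos|lra| |exact H1]. now apply Rmult_le_compat_l. }
      assert (H5 : (1 <= exp (e * x) * exp (4 * PI * (c * c) * x))%R) by nra.
      assert (H6 : (2 * Cmod C0 * 1 <= 2 * Cmod C0 * (exp (e * x) * exp (4 * PI * (c * c) * x)))%R) by (apply Rmult_le_compat_l; lra).
      lra. }
    rewrite (Zabs_R_nonneg n Hs). fold x.
    assert (Hq : (exp (- (2 * PI * x * Im z)) <= exp (2 * PI * Rabs R0 * x))%R).
    { apply exp_le_le. assert (H1 := im_le_Cmod z). apply Rabs_le_between in H1. assert (H2 := Rle_abs R0).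
      assert (H := Rmult_le_compat_l (2 * PI * x) (- Im z) (Rabs R0) ltac:(nra) ltac:(lra)). lra. }
    apply Rle_trans with ((D2 * exp (- (R1 * x))) * ((2 * Cmod C0 + KP * (W * D3)) * exp (e * x + 4 * PI * (c * c) * x)) * exp (2 * PI * Rabs R0 * x))%R.
    * apply Rmult_le_compat; [apply Rmult_le_pos; apply Cmod_ge_0|left; apply exp_pos| |exact Hq].
      apply Rmult_le_compat; try apply Cmod_ge_0; assumption.
    * replace (D2 * exp (- (R1 * x)) * ((2 * Cmod C0 + KP * (W * D3)) * exp (e * x + 4 * PI * (c * c) * x)) * exp (2 * PI * Rabs R0 * x))%R
        with (E2 * (exp (- (R1 * x)) * exp (e * x + 4 * PI * (c * c) * x) * exp (2 * PI * Rabs R0 * x)))%R by (unfold E2; ring).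
      apply Rmult_le_compat_l; [exact HE2|]. rewrite <- !exp_plus. apply exp_le_le. unfold R1. nra.
Qed.

Definition ext_sum (V z : C) : C := Zsum (fun n => ext_term n V z).

Lemma ext_sum_correct (V z : C) : V <> 0 -> (0 <= Re V)%R -> (Im z < 2 * Re (V * V)%C)%R -> is_Zseries (fun n => ext_term n V z) (ext_sum V z).
Proof.
intros HV Hre Him. apply Zsum_correct.
destruct (ext_term_bound (Cmod V + / Cmod V) (2 * Re (V * V)%C - Im z) (Cmod z) ltac:(lra)) as [D [rho [Hrho HD]]].
apply (Zseries_geom_ex _ D rho Hrho). intros n. apply HD; auto; lra.
Qed.

Lemma cdiff_ext_term (n : Z) (fV fz : C -> C) (t : C) : fV t <> 0 -> cdiff fV t -> cdiff fz t -> cdiff (fun s => ext_term n (fV s) (fz s)) t.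
Proof.
intros H0 HV Hz. unfold ext_term. destruct (Z.eq_dec n 0) as [->|Hn].
- apply (cdiff_mult (fun _ => a0)); [apply cdiff_const|]. apply (cdiff_comp (fun v => zpow v (2 * m - 1)) fV); [|exact HV].
  eexists. exact (is_cderive_zpow _ _ H0).
- apply (cdiff_mult (fun s => a n * Psi (mu n * fV s))); [|now apply cdiff_qexp].
  apply (cdiff_mult (fun _ => a n)); [apply cdiff_const|].
  apply (cdiff_comp Psi (fun s => mu n * fV s)).
  + eexists. apply (psi_derive _ _ _ _ _ HPsi). apply Cmult_neq_0; [now apply mu_nz|exact H0].
  + apply (cdiff_mult (fun _ => mu n)); [apply cdiff_const|exact HV].
Qed.

Lemma unif_holo_ext_sum (K : C -> Prop) (fV fz : C -> C) (c d R0 : R) : (0 < d)%R ->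
  (forall t, K t -> cdiff fV t /\ cdiff fz t) ->
  (forall t, K t -> fV t <> 0 /\ (0 <= Re (fV t))%R /\ (Cmod (fV t) + / Cmod (fV t) <= c)%R /\
     (Im (fz t) - 2 * Re (fV t * fV t)%C <= - d)%R /\ (Cmod (fz t) <= R0)%R) ->
  unif_holo K (fun t => ext_sum (fV t) (fz t)).
Proof.
intros Hd Hcd H. destruct (ext_term_bound c d R0 Hd) as [D [rho [Hrho HD]]].
apply (unif_holo_Zseries K (fun n t => ext_term n (fV t) (fz t)) _ D rho Hrho).
- intros n t Ht. destruct (Hcd t Ht). apply cdiff_ext_term; auto. apply (H t Ht).
- intros n t Ht. destruct (H t Ht) as [H1 [H2 [H3 [H4 H5]]]]. now apply HD.
- intros t Ht. destruct (H t Ht) as [H1 [H2 [H3 [H4 H5]]]]. apply ext_sum_correct; auto. lra.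
Qed.

(** A(z) is the q-series with the coefficients a(n), n <> 0; by the growth of the
    coefficients it converges on the lower half plane. *)
Definition lower_term (n : Z) (z : C) : C := if Z.eq_dec n 0 then 0 else a n * qexp n z.
Definition lower_sum (z : C) : C := Zsum (fun n => lower_term n z).

Lemma lower_term_bound (d R0 : R) : (0 < d)%R -> exists D rho : R, (0 <= rho < 1)%R /\
  forall n z, (Im z <= - d)%R -> (Cmod z <= R0)%R -> (Cmod (lower_term n z) <= D * rho ^ Z.abs_nat n)%R.
Proof.
intros Hd. assert (HPI := PI_RGT_0).
destruct (coeff_neg m Psi C0 KP JP HPsi a Ha (PI * d) ltac:(nra)) as [D1 [HD1 Hneg]].
assert (HR0 := Rabs_pos R0).
assert (HR1 : (0 < 2 * PI * Rabs R0 + PI * d)%R) by (assert (0 <= PI * Rabs R0)%R by nra; nra).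
destruct (coeff_pos m Psi C0 KP JP HPsi a Ha _ HR1) as [D2 [HD2 Hpos]].
exists (D1 + D2)%R, (exp (- (PI * d))). split.
{ split; [left; apply exp_pos|]. rewrite <- exp_0. apply exp_increasing. nra. }
intros n z Him Hz. rewrite exp_abs_nat. set (x := Zabs_R n). assert (Hx : (0 <= x)%R) by apply Zabs_R_pos.
assert (Hexp := exp_pos (- (PI * d * x))).
unfold lower_term. destruct (Z.eq_dec n 0) as [->|Hn]; [rewrite Cmod_0; apply Rmult_le_pos; lra|].
rewrite Cmod_mult, Cmod_qexp. destruct (Z_lt_le_dec n 0) as [Hs|Hs].
- apply Rle_trans with (D1 * exp (- (PI * d * x)))%R; [|apply Rmult_le_compat_r; lra].
  specialize (Hneg n Hs). fold x in Hneg. rewrite (Zabs_R_neg n Hs). fold x.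
  apply Rle_trans with (D1 * exp (PI * d * x) * exp (- (2 * PI * - x * Im z)))%R; [apply Rmult_le_compat_r; [left; apply exp_pos|exact Hneg]|].
  rewrite Rmult_assoc. apply Rmult_le_compat_l; [exact HD1|]. rewrite <- exp_plus. apply exp_le_le.
  assert (H := Rmult_le_compat_l (2 * PI * x) _ _ ltac:(nra) Him). lra.
- apply Rle_trans with (D2 * exp (- (PI * d * x)))%R; [|apply Rmult_le_compat_r; lra].
  specialize (Hpos n ltac:(lia)). fold x in Hpos. rewrite (Zabs_R_nonneg n Hs). fold x.
  eapply Rle_trans; [apply Rmult_le_compat_r; [left; apply exp_pos|exact Hpos]|].
  rewrite Rmult_assoc. apply Rmult_le_compat_l; [exact HD2|]. rewrite <- exp_plus. apply exp_le_le.
  assert (H1 := im_le_Cmod z). apply Rabs_le_between in H1. assert (H2 := Rle_abs R0).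
  assert (H := Rmult_le_compat_l (2 * PI * x) (- Im z) (Rabs R0) ltac:(nra) ltac:(lra)). lra.
Qed.

Lemma lower_sum_correct (z : C) : (Im z < 0)%R -> is_Zseries (fun n => lower_term n z) (lower_sum z).
Proof.
intros Him. apply Zsum_correct.
destruct (lower_term_bound (- Im z) (Cmod z) ltac:(lra)) as [D [rho [Hrho HD]]].
apply (Zseries_geom_ex _ D rho Hrho). intros n. apply HD; lra.
Qed.

Lemma unif_holo_lower_sum (K : C -> Prop) (fz : C -> C) (d R0 : R) : (0 < d)%R -> (forall t, K t -> cdiff fz t) ->
  (forall t, K t -> (Im (fz t) <= - d)%R /\ (Cmod (fz t) <= R0)%R) -> unif_holo K (fun t => lower_sum (fz t)).
Proof.
intros Hd Hcd H. destruct (lower_term_bound d R0 Hd) as [D [rho [Hrho HD]]].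
apply (unif_holo_Zseries K (fun n t => lower_term n (fz t)) _ D rho Hrho).
- intros n t Ht. unfold lower_term. destruct (Z.eq_dec n 0); [apply cdiff_const|].
  apply (cdiff_mult (fun _ => a n)); [apply cdiff_const|]. apply cdiff_qexp. auto.
- intros n t Ht. destruct (H t Ht). now apply HD.
- intros t Ht. destruct (H t Ht). apply lower_sum_correct. lra.
Qed.

(** The reflection formula of Psi makes the dependence on V cancel, and V^{2m-1} is
    odd. *)
Lemma ext_sum_sym (V z : C) : V <> 0 -> Re V = 0%R -> (Im z < 2 * Re (V * V)%C)%R -> (Im z < 0)%R ->
  ext_sum V z + ext_sum (- V) z = 2 * C0 * lower_sum z.
Proof.
intros HV Hre Him Hz.
assert (HV' : - V <> 0) by (intros H; apply HV; replace V with (- - V) by ring; rewrite H; ring).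
assert (H1 := ext_sum_correct V z HV ltac:(lra) Him).
assert (H2 := ext_sum_correct (- V) z HV' ltac:(destruct V; simpl in *; lra)).
replace (- V * - V) with (V * V) in H2 by ring. specialize (H2 Him).
assert (H3 := is_Zseries_plus _ _ _ _ H1 H2).
assert (H4 := lower_sum_correct z Hz).
apply (is_Zseries_unique _ _ _ H3).
apply (is_Zseries_ext (fun n => 2 * C0 * lower_term n z)).
- intros n. unfold ext_term, lower_term. destruct (Z.eq_dec n 0) as [->|Hn].
  + rewrite zpow_opp_odd by exact HV. ring.
  + rewrite <- (psi_sym _ _ _ _ _ HPsi (mu n * V)) by (apply Cmult_neq_0; [now apply mu_nz|exact HV]).
    replace (mu n * - V) with (- (mu n * V)) by ring. ring.
- now apply is_Zseries_scal.
Qed.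
End Sums.

(** * The transformation law without denominators *)

Lemma Cexp_Clog (z : C) : z <> 0 -> Cexp (Clog z) = z.
Proof.
intros Hz. assert (Hm := proj1 (Cmod_gt_0 z) Hz).
set (r := Cmod z) in *.
assert (Hsq : (Re z * Re z + Im z * Im z = r * r)%R).
{ transitivity (r ^ 2)%R; [unfold r; rewrite Cmod2_alt; ring|ring]. }
set (u := (Re z / r)%R). set (w := (Im z / r)%R).
assert (Hu : (u * u + w * w = 1)%R).
{ unfold u, w. replace (Re z / r * (Re z / r) + Im z / r * (Im z / r))%R with ((Re z * Re z + Im z * Im z) / (r * r))%R by (field; lra).
  rewrite Hsq. field. lra. }
assert (Hu1 : (-1 <= u <= 1)%R) by nra.
assert (Hs : sqrt (1 - Rsqr u) = Rabs w).
{ unfold Rsqr. replace (1 - u * u)%R with (Rsqr w) by (unfold Rsqr; lra). apply sqrt_Rsqr_abs. }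
unfold Cexp, Clog, Carg. simpl Re. simpl Im. fold r. rewrite exp_ln by exact Hm. fold u.
assert (Hz' : z = (r * u, r * w)%R).
{ unfold u, w. destruct z as [x y]. unfold Re, Im; simpl. f_equal; field; lra. }
assert (Hend : forall c s : R, c = u -> s = w -> RtoC r * (c, s) = z).
{ intros c s -> ->. rewrite Hz' at 1. unfold RtoC, Cmult; simpl. f_equal; ring. }
destruct (Rle_dec 0 (Im z)) as [Hi|Hi]; apply Hend.
- now apply cos_acos.
- rewrite sin_acos by exact Hu1. rewrite Hs. apply Rabs_pos_eq. unfold w. apply Rdiv_le_0_compat; lra.
- rewrite cos_neg. now apply cos_acos.
- rewrite sin_neg, sin_acos by exact Hu1. rewrite Hs, Rabs_left1; [ring|].
  unfold w. apply Rmult_le_reg_r with r; [exact Hm|]. unfold Rdiv. rewrite Rmult_assoc, Rinv_l by lra. lra.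
Qed.

Lemma Cpowc_IZR (z : C) (j : Z) : z <> 0 -> Cpowc z (RtoC (IZR j)) = zpow z j.
Proof. intros Hz. unfold Cpowc. rewrite <- Cexp_zpow, Cexp_Clog by exact Hz. reflexivity. Qed.

Lemma Cpowc_half_norm (z : C) : z <> 0 -> Cpowc z (RtoC (1 / 2)) * Cconj (Cpowc z (RtoC (1 / 2))) = RtoC (Cmod z).
Proof.
intros Hz. unfold Cpowc. rewrite Cconj_Cexp, <- Cexp_plus.
replace (RtoC (1 / 2) * Clog z + Cconj (RtoC (1 / 2) * Clog z)) with (RtoC (ln (Cmod z)))
  by (unfold Clog, Cconj, RtoC, Cmult, Cplus; simpl; f_equal; field).
rewrite Cexp_RtoC, exp_ln; [reflexivity|now apply Cmod_gt_0].
Qed.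

Lemma Cconj_nz (z : C) : z <> 0 -> Cconj z <> 0.
Proof. intros H. apply Cmod_gt_0. rewrite Cmod_conj. now apply Cmod_gt_0. Qed.

Lemma zpow_1_l (j : Z) : zpow 1 j = 1.
Proof.
revert j. apply Z_nat_cases; intros n.
- rewrite zpow_nat. apply Cpow_1_l.
- rewrite zpow_neg_nat, <- RtoC_inv, Rinv_1 by lra. apply Cpow_1_l.
Qed.

(** With j = 3 - 2m odd, conj(chi)^j (cz+d)^{-j/2} equals, up to conj(theta(gz))^j, the
    power of 1/(|cz+d| conj(theta z)).  Writing j as e1 - e2 keeps the relation
    polynomial, so that theta may be continued through its zeros. *)
Lemma slash_cleared (m : Z) (h : C -> C) (g : mat2) (z : C) (e1 e2 : nat) :
  autj g z <> 0 -> theta z <> 0 -> theta (moebius g z) <> 0 -> (Z.of_nat e1 - Z.of_nat e2 = 3 - 2 * m)%Z ->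
  slash (3 / 2 - IZR m) h g z = h z ->
  Cconj (theta (moebius g z)) ^ e1 * (RtoC (Cmod (autj g z)) * Cconj (theta z)) ^ e2 * h (moebius g z) =
  Cconj (theta (moebius g z)) ^ e2 * (RtoC (Cmod (autj g z)) * Cconj (theta z)) ^ e1 * h z.
Proof.
intros HD Ht Htg Hj Hsl. unfold slash, chi_theta in Hsl.
set (j := (3 - 2 * m)%Z) in *. set (D := autj g z) in *.
set (A := Cpowc D (RtoC (1 / 2))) in *.
assert (HA : A <> 0) by apply Cexp_nz.
set (U := Cconj (theta (moebius g z))). set (W := Cconj (theta z)).
assert (HU : U <> 0) by now apply Cconj_nz. assert (HW : W <> 0) by now apply Cconj_nz.
assert (HcA : Cconj A <> 0) by now apply Cconj_nz.
assert (Echi : Cconj (theta (moebius g z) / (A * theta z)) = U * / (Cconj A * W)).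
{ unfold Cdiv. rewrite Cmult_conj. f_equal.
  replace (Cconj A * W) with (Cconj (A * theta z)) by apply Cmult_conj.
  assert (HAt : A * theta z <> 0) by now apply Cmult_neq_0.
  assert (E : Cconj (/ (A * theta z)) * Cconj (A * theta z) = 1).
  { rewrite <- Cmult_conj, Cinv_l by exact HAt. unfold Cconj, RtoC; simpl. f_equal. ring. }
  assert (HAt' := Cconj_nz _ HAt).
  replace (Cconj (/ (A * theta z))) with (Cconj (/ (A * theta z)) * Cconj (A * theta z) * / Cconj (A * theta z)) by (field; exact HAt').
  rewrite E. ring. }
rewrite Echi in Hsl.
assert (HcAW : Cconj A * W <> 0) by now apply Cmult_neq_0.
replace (2 * (3 / 2 - IZR m))%R with (IZR j) in Hsl by (unfold j; rewrite minus_IZR, mult_IZR; field).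
assert (Hinv : / (Cconj A * W) <> 0).
{ intros H. assert (H1 : RtoC 1 = RtoC 0) by (rewrite <- (Cinv_l _ HcAW), H; ring). apply RtoC_inj in H1. lra. }
rewrite Cpowc_IZR in Hsl by now apply Cmult_neq_0.
assert (EA : Cpowc D (RtoC (- (3 / 2 - IZR m))) = / zpow A j).
{ unfold A, Cpowc. rewrite Cexp_zpow, <- Cexp_opp. f_equal. rewrite Cmult_assoc, <- RtoC_mult.
  replace (IZR j * (1 / 2))%R with (3 / 2 - IZR m)%R by (unfold j; rewrite minus_IZR, mult_IZR; field). rewrite RtoC_opp. ring. }
rewrite EA in Hsl.
assert (Hzinv : zpow (/ (Cconj A * W)) j = / zpow (Cconj A * W) j).
{ assert (E : zpow (/ (Cconj A * W)) j * zpow (Cconj A * W) j = 1).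
  { rewrite <- zpow_mult, Cinv_l by assumption. apply zpow_1_l. }
  assert (H := zpow_nz _ j HcAW).
  replace (zpow (/ (Cconj A * W)) j) with (zpow (/ (Cconj A * W)) j * zpow (Cconj A * W) j * / zpow (Cconj A * W) j) by (field; exact H).
  rewrite E. ring. }
rewrite zpow_mult, Hzinv, zpow_mult in Hsl by assumption.
set (Y := RtoC (Cmod D) * W).
assert (HY : Y <> 0).
{ apply Cmult_neq_0; [|exact HW]. intros H. apply RtoC_inj in H. revert H. apply Rgt_not_eq. now apply Cmod_gt_0. }
assert (EY : zpow Y j = zpow A j * zpow (Cconj A) j * zpow W j).
{ unfold Y. rewrite <- (Cpowc_half_norm D HD). fold A. rewrite !zpow_mult by auto using Cmult_neq_0. ring. }
assert (N1 := zpow_nz A j HA). assert (N2 := zpow_nz (Cconj A) j HcA). assert (N3 := zpow_nz W j HW).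
assert (Key : zpow U j * h (moebius g z) = zpow Y j * h z).
{ rewrite EY, <- Hsl. field. auto. }
assert (EU : U ^ e1 = zpow U j * U ^ e2).
{ rewrite <- !zpow_nat. rewrite <- zpow_add by exact HU. f_equal. lia. }
assert (EY1 : Y ^ e1 = zpow Y j * Y ^ e2).
{ rewrite <- !zpow_nat. rewrite <- zpow_add by exact HY. f_equal. lia. }
rewrite EU, EY1.
replace (zpow U j * U ^ e2 * Y ^ e2 * h (moebius g z)) with (zpow U j * h (moebius g z) * (U ^ e2 * Y ^ e2)) by ring.
rewrite Key. ring.
Qed.

(** The factor e^{-x} of B_kappa completes e^{2 pi i n Re z} to q^n. *)
Lemma nonholomorphic_term (m : Z) (Psi : C -> C) (C0 : C) (KP : R) (JP : nat) (B : R -> C) (am : Z -> C) (n : Z) (x y : R) :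
  B_profile m Psi C0 KP JP -> is_Bfun (3 / 2 - IZR m) B -> (0 < y)%R ->
  (if Z.eq_dec n 0 then am 0%Z * RtoC (cfun (3 / 2 - IZR m) y)
   else am n * B (2 * PI * IZR n * y)%R * qexp n (RtoC x)) = ext_term m Psi am (am 0%Z) n (RtoC (sqrt y)) (x, y).
Proof.
intros HPsi HB Hy. assert (HPI := PI_RGT_0). unfold ext_term. destruct (Z.eq_dec n 0) as [->|Hn].
- f_equal. unfold cfun. destruct (Req_dec_T (3 / 2 - IZR m) 1) as [H|_].
  { exfalso. apply (half_shift_nz m). lra. }
  rewrite <- (half_log_pos y Hy), Cexp_zpow, Cmult_assoc, <- RtoC_mult, Clog_pos, <- RtoC_mult, Cexp_RtoC by exact Hy.
  unfold Rpower. do 3 f_equal. rewrite minus_IZR, mult_IZR. field.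
- assert (Hx0 : (2 * PI * IZR n * y <> 0)%R).
  { apply Rmult_integral_contrapositive_currified; [|lra]. apply Rmult_integral_contrapositive_currified; [lra|].
    intros H. apply eq_IZR in H. auto. }
  destruct (is_Bvalue_continuation _ _ _ (HB _ Hx0)) as [F [HF <-]].
  rewrite (psi_B _ _ _ _ _ HPsi F _ Hx0 HF), mu_half_log by assumption.
  rewrite <- Cexp_RtoC. unfold qexp.
  replace (RtoC (2 * PI * IZR n) * Ci * (x, y)) with (RtoC (- (2 * PI * IZR n * y)) + RtoC (2 * PI * IZR n) * Ci * RtoC x)
    by (unfold RtoC, Ci, Cmult, Cplus; simpl; f_equal; ring).
  rewrite Cexp_plus. ring.
Qed.

Lemma nonholomorphic_expansion_ext (m : Z) (Psi : C -> C) (C0 : C) (KP : R) (JP : nat) (B : R -> C) (am : Z -> C) (h : C -> C) :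
  B_profile m Psi C0 KP JP -> is_Bfun (3 / 2 - IZR m) B ->
  (forall z : C, upper_half_plane z ->
      is_Zseries
        (fun n => if Z.eq_dec n 0 then am 0%Z * RtoC (cfun (3 / 2 - IZR m) (Im z))
                  else am n * B (2 * PI * IZR n * Im z)%R * qexp n (RtoC (Re z)))
        (h z)) ->
  (forall y : R, (0 < y)%R -> exists B : R, forall n, n <> 0%Z ->
    (Cmod (am n) * Cmod (Psi (mu n * RtoC (sqrt y))%C) <= B * exp (2 * PI * IZR n * y))%R) /\
  (forall z, upper_half_plane z -> is_Zseries (fun n => ext_term m Psi am (am 0%Z) n (RtoC (sqrt (Im z))) z) (h z)).
Proof.
intros HPsi HB Hexp.
assert (H2 : forall z, upper_half_plane z -> is_Zseries (fun n => ext_term m Psi am (am 0%Z) n (RtoC (sqrt (Im z))) z) (h z)).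
{ intros z Hz. eapply is_Zseries_ext; [|exact (Hexp z Hz)]. intros n. destruct z as [x y]. simpl.
  now apply (nonholomorphic_term m Psi C0 KP JP). }
split; [|exact H2].
intros y Hy. destruct (Zseries_bounded _ _ (H2 (0, y)%R Hy)) as [K HK]. exists K. intros n Hn.
specialize (HK n). unfold ext_term in HK. destruct (Z.eq_dec n 0) as [|_]; [contradiction|].
rewrite !Cmod_mult, Cmod_qexp in HK. simpl Im in HK.
set (E := exp (2 * PI * IZR n * y)) in *. assert (HE : (0 < E)%R) by apply exp_pos.
rewrite exp_Ropp in HK. fold E in HK.
apply (Rmult_le_reg_r (/ E)); [now apply Rinv_0_lt_compat|]. rewrite (Rmult_assoc K), Rinv_r by lra. lra.
Qed.

(** * Continuation of the transformation law to the cut *)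

Lemma Im_inv (z : C) : z <> 0 -> Im (/ z) = (- Im z / (Cmod z * Cmod z))%R.
Proof.
intros Hz. assert (Hm := proj1 (Cmod_gt_0 z) Hz).
assert (E : (Cmod z * Cmod z = Re z * Re z + Im z * Im z)%R) by (transitivity (Cmod z ^ 2)%R; [ring|rewrite Cmod2_alt; ring]).
rewrite E. assert (Hp : (0 < Re z * Re z + Im z * Im z)%R) by (rewrite <- E; nra).
destruct z as [x y]. unfold Cinv, Re, Im in *; simpl in *. field. lra.
Qed.

Lemma Re_inv (z : C) : z <> 0 -> Re (/ z) = (Re z / (Cmod z * Cmod z))%R.
Proof.
intros Hz. assert (Hm := proj1 (Cmod_gt_0 z) Hz).
assert (E : (Cmod z * Cmod z = Re z * Re z + Im z * Im z)%R) by (transitivity (Cmod z ^ 2)%R; [ring|rewrite Cmod2_alt; ring]).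
rewrite E. assert (Hp : (0 < Re z * Re z + Im z * Im z)%R) by (rewrite <- E; nra).
destruct z as [x y]. unfold Cinv, Re, Im in *; simpl in *. field. lra.
Qed.

Lemma model_rect_bounded (F : C -> C) : (forall z, model_rect z -> cdiff F z) -> exists B : R, (0 < B)%R /\ forall z, model_rect z -> (Cmod (F z) <= B)%R.
Proof.
intros H. destruct (cdiff_rect_bounded F (-2) (-1) 4 1 ltac:(lra) ltac:(lra)) as [B HB].
- replace (-2 + 4)%R with 2%R by ring. replace (-1 + 1)%R with 0%R by ring. exact H.
- replace (-2 + 4)%R with 2%R in HB by ring. replace (-1 + 1)%R with 0%R in HB by ring.
  exists (Rabs B + 1)%R. split; [assert (H0 := Rabs_pos B); lra|]. intros z Hz.
  specialize (HB z Hz). assert (H0 := Rle_abs B). lra.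
Qed.

Definition Cch (t : C) : C := RtoC (1 / 2) * (Cexp t + Cexp (- t)).
Definition Csh (t : C) : C := RtoC (1 / 2) * (Cexp t - Cexp (- t)).

Lemma Cch_Csh (t : C) : Cch t * Cch t = Csh t * Csh t + 1.
Proof.
unfold Cch, Csh. assert (E : Cexp t * Cexp (- t) = 1) by (rewrite <- Cexp_plus, <- Cexp_0; f_equal; ring).
assert (E4 : RtoC (1 / 2) * RtoC (1 / 2) * 4 = 1) by (rewrite <- !RtoC_mult; f_equal; field).
transitivity (RtoC (1 / 2) * RtoC (1 / 2) * ((Cexp t - Cexp (- t)) * (Cexp t - Cexp (- t))) + RtoC (1 / 2) * RtoC (1 / 2) * 4 * (Cexp t * Cexp (- t)));
  [ring|rewrite E4, E; ring].
Qed.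

Definition rch (p : R) : R := ((exp p + exp (- p)) / 2)%R.
Definition rsh (p : R) : R := ((exp p - exp (- p)) / 2)%R.

Lemma Cch_pair (p q : R) : Cch (p, q) = ((rch p * cos q)%R, (rsh p * sin q)%R).
Proof.
unfold Cch, rch, rsh, Cexp, RtoC, Cmult, Cplus, Copp, Re, Im; simpl. rewrite cos_neg, sin_neg. f_equal; field.
Qed.

Lemma Csh_pair (p q : R) : Csh (p, q) = ((rsh p * cos q)%R, (rch p * sin q)%R).
Proof.
unfold Csh, rch, rsh, Cexp, RtoC, Cmult, Cminus, Cplus, Copp, Re, Im; simpl. rewrite cos_neg, sin_neg. f_equal; field.
Qed.

Lemma rch_pos (p : R) : (0 < rch p)%R.
Proof. unfold rch. assert (H1 := exp_pos p). assert (H2 := exp_pos (- p)). lra. Qed.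

Lemma rch_opp (p : R) : rch (- p) = rch p.
Proof. unfold rch. rewrite Ropp_involutive. lra. Qed.

Lemma rsh_opp (p : R) : rsh (- p) = (- rsh p)%R.
Proof. unfold rsh. rewrite Ropp_involutive. lra. Qed.

Lemma rch_rsh (p : R) : (rch p * rch p = rsh p * rsh p + 1)%R.
Proof.
unfold rch, rsh. assert (E : (exp p * exp (- p) = 1)%R) by (rewrite <- exp_plus, Rplus_opp_r; apply exp_0). nra.
Qed.

Lemma rsh_nz (p : R) : p <> 0%R -> rsh p <> 0%R.
Proof.
intros Hp H. unfold rsh in H. assert (E : exp p = exp (- p)) by lra. apply exp_inv in E. lra.
Qed.

Lemma rch_gt_1 (p : R) : p <> 0%R -> (1 < rch p)%R.
Proof.
intros Hp. assert (H := rch_rsh p). assert (H1 := rch_pos p). assert (H2 := rsh_nz p Hp).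
assert (0 < rsh p * rsh p)%R by nra. nra.
Qed.

(** The path z(t) on the line Im z = eta/M.  The suffix conj marks the function of t
    that continues the conjugate of the unmarked one from the real t-axis. *)
Section Continuation.
Variables (m : Z) (Psi : C -> C) (C0 : C) (KP : R) (JP : nat).
Hypothesis HPsi : B_profile m Psi C0 KP JP.
Variable a : Z -> C.
Hypothesis Ha : forall y : R, (0 < y)%R -> exists B : R, forall n, n <> 0%Z ->
  (Cmod (a n) * Cmod (Psi (mu n * RtoC (sqrt y))) <= B * exp (2 * PI * IZR n * y))%R.
Variable a0 : C.
Variable h : C -> C.
Hypothesis Hexp : forall z, upper_half_plane z -> is_Zseries (fun n => ext_term m Psi a a0 n (RtoC (sqrt (Im z))) z) (h z).
Variable Mz : Z.
Hypothesis HMz : (0 < Mz)%Z.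
Let M : R := IZR Mz.
Let g0 : mat2 := Mat2 1 0 Mz 1.
Variables e1 e2 : nat.
Hypothesis He : (Z.of_nat e1 - Z.of_nat e2 = 3 - 2 * m)%Z.
Hypothesis Hmod : forall z, upper_half_plane z -> slash (3 / 2 - IZR m) h g0 z = h z.

Let S (V z : C) : C := ext_sum m Psi a a0 V z.

Lemma M_pos : (0 < M)%R.
Proof. apply IZR_lt. exact HMz. Qed.

Lemma h_ext_sum (x y : R) : (0 < y)%R -> h (x, y) = S (RtoC (sqrt y)) (x, y).
Proof. intros Hy. symmetry. apply Zsum_unique. exact (Hexp (x, y) Hy). Qed.

Lemma autj_g0 (z : C) : autj g0 z = RtoC M * z + 1.
Proof. reflexivity. Qed.

Lemma autj_g0_nz (z : C) : upper_half_plane z -> autj g0 z <> 0.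
Proof.
intros Hz H. rewrite autj_g0 in H. apply (f_equal Im) in H. unfold upper_half_plane in Hz.
destruct z as [x y]. unfold RtoC, Cmult, Cplus, Im in *; simpl in *. assert (HM := M_pos). nra.
Qed.

Lemma moebius_g0 (z : C) : autj g0 z <> 0 -> moebius g0 z = / RtoC M - / (RtoC M * autj g0 z).
Proof.
intros H. assert (HM : RtoC M <> 0) by (intros E; apply RtoC_inj in E; assert (HM := M_pos); lra).
unfold moebius. simpl ma. simpl mb. rewrite autj_g0 in *. field. auto.
Qed.

Variable eta : R.
Hypothesis Heta : (0 < eta)%R.
Let y0 : R := (eta / M)%R.

Definition jt (t : C) : C := RtoC eta * Csh t + Ci * RtoC eta.
Definition jt_conj (t : C) : C := RtoC eta * Csh t - Ci * RtoC eta.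
Definition zt (t : C) : C := / RtoC M * (jt t - 1).
Definition zt_conj (t : C) : C := / RtoC M * (jt_conj t - 1).
Definition gzt (t : C) : C := / RtoC M - / (RtoC M * jt t).
Definition gzt_conj (t : C) : C := / RtoC M - / (RtoC M * jt_conj t).
(** Continues the square root of Im(g z). *)
Definition root_gzt (t : C) : C := RtoC (sqrt y0) * / (RtoC eta * Cch t).

Lemma y0_pos : (0 < y0)%R.
Proof. apply Rdiv_lt_0_compat; [exact Heta|exact M_pos]. Qed.

Lemma MC_nz : RtoC M <> 0.
Proof. intros E; apply RtoC_inj in E; assert (HM := M_pos); lra. Qed.

Lemma etaC_nz : RtoC eta <> 0.
Proof. intros E; apply RtoC_inj in E; lra. Qed.

(** cosh^2 = sinh^2 + 1, that is, |Mz+1| = eta cosh t on the real axis. *)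
Lemma jt_norm (t : C) : jt t * jt_conj t = (RtoC eta * Cch t) * (RtoC eta * Cch t).
Proof.
assert (HC : Ci * Ci = - (1)) by (unfold Ci, RtoC, Cmult, Copp; simpl; f_equal; ring).
unfold jt, jt_conj. replace (RtoC eta * Cch t * (RtoC eta * Cch t)) with (RtoC eta * RtoC eta * (Cch t * Cch t)) by ring.
rewrite Cch_Csh.
transitivity (RtoC eta * RtoC eta * (Csh t * Csh t) - (Ci * Ci) * (RtoC eta * RtoC eta)); [ring|rewrite HC; ring].
Qed.

(** The closed strip -pi/2 <= Im t <= 0 without the imaginary axis, where cosh t
    has a zero. *)
Definition strip (t : C) : Prop := Re t <> 0%R /\ (- (PI / 2) <= Im t <= 0)%R.

Lemma strip_Cch (t : C) : strip t -> Cch t <> 0 /\ (0 <= Re (Cch t))%R.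
Proof.
destruct t as [p q]. intros [Hp Hq]. simpl in Hp, Hq. rewrite Cch_pair. split.
- intros H.
  assert (H1 := f_equal Re H). assert (H2 := f_equal Im H). unfold RtoC in H1, H2. simpl in H1, H2.
  assert (Hc : cos q = 0%R) by (assert (Hr := rch_pos p); apply Rmult_integral in H1; destruct H1; lra).
  assert (Hs : sin q = 0%R) by (assert (Hr := rsh_nz p Hp); apply Rmult_integral in H2; destruct H2; [contradiction|assumption]).
  assert (H3 := sin2_cos2 q). rewrite Hc, Hs in H3. unfold Rsqr in H3. lra.
- simpl. apply Rmult_le_pos; [left; apply rch_pos|]. apply cos_ge_0; lra.
Qed.

Lemma strip_jt_conj_im (t : C) : strip t -> (Im (jt_conj t) <= - eta)%R.
Proof.
destruct t as [p q]. intros [Hp Hq]. simpl in Hp, Hq. unfold jt_conj. rewrite Csh_pair.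
unfold RtoC, Ci, Cmult, Cminus, Cplus, Copp, Im; simpl.
assert (Hs : (sin q <= 0)%R).
{ assert (H := sin_ge_0 (- q) ltac:(lra) ltac:(assert (HP := PI_RGT_0); lra)). rewrite sin_neg in H. lra. }
assert (Hr := rch_pos p). assert (rch p * sin q <= 0)%R by nra. nra.
Qed.

Lemma strip_nz (t : C) : strip t -> jt t <> 0 /\ jt_conj t <> 0 /\ RtoC eta * Cch t <> 0.
Proof.
intros Ht. destruct (strip_Cch t Ht) as [Hc _].
assert (H : RtoC eta * Cch t <> 0) by (apply Cmult_neq_0; [apply etaC_nz|exact Hc]).
assert (H2 : jt t * jt_conj t <> 0) by (rewrite jt_norm; now apply Cmult_neq_0).
repeat split; [intros E; apply H2; rewrite E; ring|intros E; apply H2; rewrite E; ring|exact H].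
Qed.

(** On the real axis: g z = conj(g z) + 2 i Im(g z).  With V^2 in place of Im(g z) it
    gives Im(gzt) < 2 Re V^2 on the strip, because the continued conjugate
    stays in the lower half plane. *)
Lemma root_gzt_sq (t : C) : strip t -> gzt t = gzt_conj t + 2 * Ci * (root_gzt t * root_gzt t).
Proof.
intros Ht. destruct (strip_nz t Ht) as [H1 [H2 H3]]. assert (HM := MC_nz).
assert (E1 : root_gzt t * root_gzt t = RtoC y0 * / (jt t * jt_conj t)).
{ unfold root_gzt. rewrite jt_norm. rewrite <- (sqrt_sqrt y0) at 3 by (left; apply y0_pos). rewrite RtoC_mult.
  revert H3. generalize (RtoC eta * Cch t). intros X HX. field. exact HX. }
assert (E2 : RtoC y0 = RtoC eta * / RtoC M) by (unfold y0; rewrite RtoC_div by (assert (H := M_pos); lra); reflexivity).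
assert (E3 : 2 * Ci * RtoC eta = jt t - jt_conj t) by (unfold jt, jt_conj; ring).
rewrite E1, E2. unfold gzt, gzt_conj.
replace (2 * Ci * (RtoC eta * / RtoC M * / (jt t * jt_conj t))) with (2 * Ci * RtoC eta * (/ RtoC M * / (jt t * jt_conj t))) by ring.
rewrite E3. field. auto.
Qed.

(** A rectangle of the strip below the real segment around p; p = 5 keeps it away
    from the imaginary axis. *)
Definition strip_map (p : R) (z : C) : C := RtoC p + RtoC (PI / 2) * z.

Lemma strip_map_strip (p : R) (z : C) : (5 <= Rabs p)%R -> model_rect z -> strip (strip_map p z).
Proof.
intros Hp Hz. destruct z as [u v]. unfold model_rect, in_rect in Hz. unfold strip, strip_map, RtoC, Cmult, Cplus, Re, Im in *; simpl in *.
assert (HP := PI_4). assert (HP' := PI_RGT_0). split; [|nra].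
intros H. assert (E : p = (- (PI / 2 * u))%R) by lra. rewrite E, Rabs_Ropp, Rabs_mult, (Rabs_pos_eq (PI / 2)) in Hp by lra.
assert (Rabs u <= 2)%R by (apply Rabs_le; lra). nra.
Qed.

Lemma cdiff_strip_map (p : R) (z : C) : cdiff (strip_map p) z.
Proof. unfold strip_map. cdiff. Qed.

Lemma cdiff_Cch (t : C) : cdiff Cch t.
Proof. unfold Cch. cdiff. Qed.

Lemma cdiff_jt (t : C) : cdiff jt t.
Proof. unfold jt, Csh. cdiff. Qed.

Lemma cdiff_jt_conj (t : C) : cdiff jt_conj t.
Proof. unfold jt_conj, Csh. cdiff. Qed.

Lemma cdiff_zt (t : C) : cdiff zt t.
Proof. unfold zt, jt, Csh. cdiff. Qed.

Lemma cdiff_zt_conj (t : C) : cdiff zt_conj t.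
Proof. unfold zt_conj, jt_conj, Csh. cdiff. Qed.

Lemma cdiff_gzt (t : C) : jt t <> 0 -> cdiff gzt t.
Proof. intros H. unfold gzt, jt, Csh. cdiff. apply Cmult_neq_0; [apply MC_nz|exact H]. Qed.

Lemma cdiff_gzt_conj (t : C) : jt_conj t <> 0 -> cdiff gzt_conj t.
Proof. intros H. unfold gzt_conj, jt_conj, Csh. cdiff. apply Cmult_neq_0; [apply MC_nz|exact H]. Qed.

Lemma cdiff_root_gzt (t : C) : RtoC eta * Cch t <> 0 -> cdiff root_gzt t.
Proof. intros H. unfold root_gzt, Cch. cdiff. exact H. Qed.

Definition theta_gzt_conj (t : C) : C := theta (- gzt_conj t).
Definition theta_zt_conj (t : C) : C := theta (- zt_conj t).
Definition jtheta_zt_conj (t : C) : C := RtoC eta * Cch t * theta_zt_conj t.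
(** The difference of the two sides of the cleared transformation law, as a function
    of t.  The last two factors make it vanish at zeros of theta as well. *)
Definition slash_defect (t : C) : C :=
  (theta_gzt_conj t ^ e1 * jtheta_zt_conj t ^ e2 * S (root_gzt t) (gzt t) - theta_gzt_conj t ^ e2 * jtheta_zt_conj t ^ e1 * S (RtoC (sqrt y0)) (zt t)) * theta_gzt_conj t * theta_zt_conj t.

Lemma unif_holo_slash_defect (p : R) : (5 <= Rabs p)%R -> unif_holo model_rect (fun z => slash_defect (strip_map p z)).
Proof.
intros Hp. assert (HPI := PI_RGT_0). assert (HM := M_pos). assert (Hy0 := y0_pos).
assert (Hst : forall z, model_rect z -> strip (strip_map p z)) by (intros; now apply strip_map_strip).
assert (Hnz : forall z, model_rect z -> jt (strip_map p z) <> 0 /\ jt_conj (strip_map p z) <> 0 /\ RtoC eta * Cch (strip_map p z) <> 0).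
{ intros z Hz. apply strip_nz. auto. }
assert (Dal : forall z, model_rect z -> cdiff (fun z => jt (strip_map p z)) z).
{ intros z Hz. apply (cdiff_comp jt (strip_map p)); [apply cdiff_jt|apply cdiff_strip_map]. }
assert (Dbe : forall z, model_rect z -> cdiff (fun z => jt_conj (strip_map p z)) z).
{ intros z Hz. apply (cdiff_comp jt_conj (strip_map p)); [apply cdiff_jt_conj|apply cdiff_strip_map]. }
assert (Dzf : forall z, model_rect z -> cdiff (fun z => zt (strip_map p z)) z).
{ intros z Hz. apply (cdiff_comp zt (strip_map p)); [apply cdiff_zt|apply cdiff_strip_map]. }
assert (Dwf : forall z, model_rect z -> cdiff (fun z => - zt_conj (strip_map p z)) z).
{ intros z Hz. destruct (cdiff_comp zt_conj (strip_map p) z (cdiff_zt_conj _) (cdiff_strip_map p z)) as [l Hl]. cdiff. exact Hl. }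
assert (Dzg : forall z, model_rect z -> cdiff (fun z => gzt (strip_map p z)) z).
{ intros z Hz. apply (cdiff_comp gzt (strip_map p)); [apply cdiff_gzt, Hnz, Hz|apply cdiff_strip_map]. }
assert (Dwg : forall z, model_rect z -> cdiff (fun z => - gzt_conj (strip_map p z)) z).
{ intros z Hz. destruct (Hnz z Hz) as [_ [Hb _]].
  destruct (cdiff_comp gzt_conj (strip_map p) z (cdiff_gzt_conj _ Hb) (cdiff_strip_map p z)) as [l Hl]. cdiff. exact Hl. }
assert (DV : forall z, model_rect z -> cdiff (fun z => root_gzt (strip_map p z)) z).
{ intros z Hz. apply (cdiff_comp root_gzt (strip_map p)); [apply cdiff_root_gzt, Hnz, Hz|apply cdiff_strip_map]. }
assert (Dch : forall z, model_rect z -> cdiff (fun z => RtoC eta * Cch (strip_map p z)) z).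
{ intros z Hz. apply (cdiff_mult (fun _ => RtoC eta)); [apply cdiff_const|].
  apply (cdiff_comp Cch (strip_map p)); [apply cdiff_Cch|apply cdiff_strip_map]. }
destruct (model_rect_bounded _ Dbe) as [Bb [HBb0 HBb]].
destruct (model_rect_bounded _ Dzf) as [Bf [HBf0 HBf]].
destruct (model_rect_bounded _ Dzg) as [Bg [HBg0 HBg]].
destruct (model_rect_bounded _ DV) as [BV [HBV0 HBV]].
destruct (model_rect_bounded _ Dch) as [Bc [HBc0 HBc]].
(* |jt_conj| <= Bb bounds Im(1/jt_conj), hence the height of - gzt_conj, from below *)
set (d := (eta / (M * (Bb * Bb)))%R).
assert (Hd : (0 < d)%R) by (apply Rdiv_lt_0_compat; [exact Heta|apply Rmult_lt_0_compat; nra]).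
assert (Hwg : forall z, model_rect z -> (Im (gzt_conj (strip_map p z)) <= - d)%R).
{ intros z Hz. destruct (Hnz z Hz) as [_ [Hb _]]. set (t := strip_map p z) in *.
  assert (Him := strip_jt_conj_im t (Hst z Hz)). specialize (HBb z Hz). cbv beta in HBb. fold t in HBb.
  assert (Hm := proj1 (Cmod_gt_0 _) Hb).
  assert (E : Im (gzt_conj t) = (Im (jt_conj t) / (M * (Cmod (jt_conj t) * Cmod (jt_conj t))))%R).
  { unfold gzt_conj. replace (/ (RtoC M * jt_conj t)) with (RtoC (/ M) * / jt_conj t) by (rewrite RtoC_inv by lra; field; split; [exact Hb|apply MC_nz]).
    rewrite <- RtoC_inv by lra.
    replace (Im (RtoC (/ M) - RtoC (/ M) * / jt_conj t)) with (- (/ M) * Im (/ jt_conj t))%R.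
    - rewrite Im_inv by exact Hb. field. lra.
    - generalize (/ jt_conj t). intros [u v]. unfold RtoC, Cmult, Cminus, Cplus, Copp, Im; simpl. ring. }
  rewrite E. unfold d.
  assert (Hsq : (Cmod (jt_conj t) * Cmod (jt_conj t) <= Bb * Bb)%R) by nra.
  assert (Hp1 : (0 < M * (Cmod (jt_conj t) * Cmod (jt_conj t)))%R) by (apply Rmult_lt_0_compat; nra).
  apply Rle_trans with (- eta / (M * (Cmod (jt_conj t) * Cmod (jt_conj t))))%R.
  - unfold Rdiv. apply Rmult_le_compat_r; [left; now apply Rinv_0_lt_compat|exact Him].
  - unfold Rdiv. rewrite <- Ropp_mult_distr_l. apply Ropp_le_contravar. apply Rmult_le_compat_l; [lra|].
    apply Rinv_le_contravar; [exact Hp1|]. apply Rmult_le_compat_l; lra. }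
assert (HUf : unif_holo model_rect (fun z => theta_gzt_conj (strip_map p z))).
{ apply (unif_holo_theta model_rect (fun z => - gzt_conj (strip_map p z)) d Hd); [exact Dwg|].
  intros z Hz. specialize (Hwg z Hz). destruct (gzt_conj (strip_map p z)) as [u v]. simpl in *. lra. }
assert (HWf : unif_holo model_rect (fun z => theta_zt_conj (strip_map p z))).
{ apply (unif_holo_theta model_rect (fun z => - zt_conj (strip_map p z)) y0 Hy0); [exact Dwf|].
  intros z Hz. assert (Him := strip_jt_conj_im _ (Hst z Hz)). unfold zt_conj. rewrite <- RtoC_inv by lra.
  destruct (jt_conj (strip_map p z)) as [u v]. unfold RtoC, Cmult, Cminus, Cplus, Copp, Im in *; simpl in *.
  unfold y0, Rdiv. assert (H1 := Rinv_0_lt_compat M HM). nra. }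
assert (HYf : unif_holo model_rect (fun z => jtheta_zt_conj (strip_map p z))).
{ apply (unif_holo_mult model_rect (fun z => RtoC eta * Cch (strip_map p z))); [|exact HWf].
  apply (unif_holo_of_bounded model_rect _ Bc); [exact Dch|exact HBc]. }
assert (HSg : unif_holo model_rect (fun z => S (root_gzt (strip_map p z)) (gzt (strip_map p z)))).
{ apply (unif_holo_ext_sum m Psi C0 KP JP HPsi a Ha a0 model_rect (fun z => root_gzt (strip_map p z)) (fun z => gzt (strip_map p z)) (BV + Bc / sqrt y0) d Bg Hd).
  - intros z Hz. split; [now apply DV|now apply Dzg].
  - intros z Hz. destruct (Hnz z Hz) as [_ [_ Hc]]. destruct (strip_Cch _ (Hst z Hz)) as [Hch Hre].
    assert (Hs := sqrt_lt_R0 y0 Hy0).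
    assert (HsC : RtoC (sqrt y0) <> 0) by (intros E; apply RtoC_inj in E; lra).
    assert (Hmc := proj1 (Cmod_gt_0 _) Hc).
    assert (Hinv : / (RtoC eta * Cch (strip_map p z)) <> 0).
    { apply Cmod_gt_0. rewrite Cmod_inv by exact Hc. now apply Rinv_0_lt_compat. }
    assert (HV0 : root_gzt (strip_map p z) <> 0) by (unfold root_gzt; now apply Cmult_neq_0).
    split; [exact HV0|]. split; [|split; [|split; [|now apply HBg]]].
    + unfold root_gzt. replace (Re (RtoC (sqrt y0) * / (RtoC eta * Cch (strip_map p z)))) with (sqrt y0 * Re (/ (RtoC eta * Cch (strip_map p z))))%R
        by (generalize (/ (RtoC eta * Cch (strip_map p z))); intros [u v]; unfold RtoC, Cmult, Re; simpl; ring).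
      rewrite Re_inv by exact Hc. apply Rmult_le_pos; [lra|]. apply Rdiv_le_0_compat; [|nra].
      destruct (Cch (strip_map p z)) as [u v]. unfold RtoC, Cmult, Re in *; simpl in *. nra.
    + apply Rplus_le_compat; [now apply HBV|]. unfold root_gzt. rewrite Cmod_mult, Cmod_R, (Rabs_pos_eq (sqrt y0)), Cmod_inv by (try lra; exact Hc).
      rewrite Rinv_mult, Rinv_inv. unfold Rdiv. rewrite Rmult_comm. apply Rmult_le_compat_r; [left; now apply Rinv_0_lt_compat|]. now apply HBc.
    + specialize (Hwg z Hz). rewrite (root_gzt_sq _ (Hst z Hz)).
      destruct (gzt_conj (strip_map p z)) as [u v], (root_gzt (strip_map p z) * root_gzt (strip_map p z)) as [u' v']. unfold Ci, RtoC, Cmult, Cplus, Re, Im in *; simpl in *. lra. }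
assert (HSf : unif_holo model_rect (fun z => S (RtoC (sqrt y0)) (zt (strip_map p z)))).
{ assert (Hs := sqrt_lt_R0 y0 Hy0).
  apply (unif_holo_ext_sum m Psi C0 KP JP HPsi a Ha a0 model_rect (fun z => RtoC (sqrt y0)) (fun z => zt (strip_map p z)) (sqrt y0 + / sqrt y0) y0 Bf Hy0).
  - intros z Hz. split; [apply cdiff_const|now apply Dzf].
  - intros z Hz. split; [intros E; apply RtoC_inj in E; lra|]. split; [simpl; lra|]. split; [|split; [|now apply HBf]].
    + rewrite Cmod_R, Rabs_pos_eq by lra. lra.
    + rewrite <- RtoC_mult, sqrt_sqrt by lra. assert (Him := strip_jt_conj_im _ (Hst z Hz)). unfold zt. rewrite <- RtoC_inv by lra.
      unfold jt, jt_conj in *. destruct (Csh (strip_map p z)) as [u v]. unfold Ci, RtoC, Cmult, Cminus, Cplus, Copp, Re, Im in *; simpl in *.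
      unfold y0, Rdiv. assert (H1 := Rinv_0_lt_compat M HM). nra. }
unfold slash_defect. apply unif_holo_mult; [|exact HWf]. apply unif_holo_mult; [|exact HUf].
apply unif_holo_minus; (apply unif_holo_mult; [apply unif_holo_mult; apply unif_holo_pow; assumption|assumption]).
Qed.

Lemma slash_defect_real (x : R) : slash_defect (x, 0%R) = 0.
Proof.
assert (HM := M_pos). assert (Hy0 := y0_pos). assert (Hrc := rch_pos x).
set (t := (x, 0%R) : C).
assert (Et : Csh t = RtoC (rsh x)) by (unfold t; rewrite Csh_pair, sin_0, cos_0; unfold RtoC; f_equal; ring).
assert (Ec : Cch t = RtoC (rch x)) by (unfold t; rewrite Cch_pair, sin_0, cos_0; unfold RtoC; f_equal; ring).
assert (Eal : jt t = ((eta * rsh x)%R, eta)) by (unfold jt; rewrite Et; unfold Ci, RtoC, Cmult, Cplus; simpl; f_equal; ring).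
assert (Ebe : jt_conj t = Cconj (jt t)).
{ rewrite Eal. unfold jt_conj. rewrite Et. unfold Ci, RtoC, Cmult, Cminus, Cplus, Copp, Cconj; simpl; f_equal; ring. }
assert (Hal : jt t <> 0).
{ rewrite Eal. intros H. apply (f_equal Im) in H. simpl in H. lra. }
assert (Hbe : jt_conj t <> 0) by (rewrite Ebe; now apply Cconj_nz).
set (z := zt t).
assert (Ez : z = (((eta * rsh x - 1) / M)%R, y0)).
{ unfold z, zt. rewrite Eal, <- RtoC_inv by lra. unfold y0, RtoC, Cmult, Cminus, Cplus, Copp; simpl. f_equal; field; lra. }
assert (Hz : upper_half_plane z) by (rewrite Ez; exact Hy0).
assert (Eaut : autj g0 z = jt t).
{ rewrite autj_g0. unfold z, zt. field. apply MC_nz. }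
assert (Emo : moebius g0 z = gzt t) by (rewrite moebius_g0, Eaut by (rewrite Eaut; exact Hal); reflexivity).
assert (HMC : RtoC M <> 0) by apply MC_nz.
assert (Hconj_inv : forall c : C, c <> 0 -> Cconj (/ c) = / Cconj c).
{ intros c Hc. assert (Hc' := Cconj_nz c Hc).
  replace (Cconj (/ c)) with (Cconj (/ c) * Cconj c * / Cconj c) by (field; exact Hc').
  rewrite <- Cmult_conj, Cinv_l by exact Hc. replace (Cconj 1) with (RtoC 1) by (unfold Cconj, RtoC; simpl; f_equal; ring). ring. }
assert (HconjR : forall r : R, Cconj (RtoC r) = RtoC r) by (intros r; unfold Cconj, RtoC; simpl; f_equal; ring).
assert (Ewg : gzt_conj t = Cconj (gzt t)).
{ unfold gzt_conj, gzt. rewrite Cminus_conj, !Hconj_inv, Cmult_conj, HconjR, Ebe by (try apply Cmult_neq_0; assumption). reflexivity. }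
assert (Ewf : zt_conj t = Cconj z).
{ unfold z, zt_conj, zt. rewrite Cmult_conj, Cminus_conj, Hconj_inv, !HconjR, Ebe by assumption. reflexivity. }
assert (EU : theta_gzt_conj t = Cconj (theta (moebius g0 z))) by (unfold theta_gzt_conj; rewrite Ewg, theta_conj, Emo; reflexivity).
assert (EW : theta_zt_conj t = Cconj (theta z)) by (unfold theta_zt_conj; rewrite Ewf, theta_conj; reflexivity).
assert (Her : (0 < eta * rch x)%R) by nra.
assert (Emod : Cmod (jt t) = (eta * rch x)%R).
{ assert (H : (Cmod (jt t) * Cmod (jt t) = (eta * rch x) * (eta * rch x))%R).
  { transitivity (Cmod (jt t) ^ 2)%R; [ring|]. rewrite Cmod2_alt, Eal. simpl.
    replace (eta * rch x * (eta * rch x))%R with (eta * eta * (rch x * rch x))%R by ring. rewrite rch_rsh. ring. }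
  assert (H1 := Cmod_ge_0 (jt t)). assert (H2 : (0 < eta * rch x)%R) by nra. apply Rsqr_inj; [exact H1|lra|exact H]. }
assert (EY : jtheta_zt_conj t = RtoC (Cmod (autj g0 z)) * Cconj (theta z)) by (unfold jtheta_zt_conj; rewrite Eaut, Emod, EW, Ec, RtoC_mult; ring).
assert (Vr : root_gzt t = RtoC (sqrt y0 / (eta * rch x))).
{ unfold root_gzt. rewrite Ec, <- RtoC_mult, <- RtoC_inv, <- RtoC_mult by nra. reflexivity. }
assert (Him : Im (gzt t) = (y0 / (eta * rch x * (eta * rch x)))%R).
{ unfold gzt. replace (/ (RtoC M * jt t)) with (/ RtoC M * / jt t) by (field; auto). rewrite <- RtoC_inv by lra.
  replace (Im (RtoC (/ M) - RtoC (/ M) * / jt t)) with (- (/ M) * Im (/ jt t))%R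
    by (generalize (/ jt t); intros [u v]; unfold RtoC, Cmult, Cminus, Cplus, Copp, Im; simpl; ring).
  rewrite Im_inv, Emod, Eal by exact Hal. simpl. unfold y0. field. split; [|split]; lra. }
assert (Himp : (0 < Im (gzt t))%R) by (rewrite Him; apply Rdiv_lt_0_compat; [exact Hy0|apply Rmult_lt_0_compat; exact Her]).
assert (Eh1 : h (gzt t) = S (root_gzt t) (gzt t)).
{ assert (H := h_ext_sum (Re (gzt t)) (Im (gzt t)) Himp). rewrite <- !surjective_pairing in H. rewrite H. f_equal.
  rewrite Vr, Him. f_equal. rewrite sqrt_div_alt by nra. rewrite sqrt_square by nra. reflexivity. }
assert (Eh2 : h z = S (RtoC (sqrt y0)) z) by (rewrite Ez; apply h_ext_sum; exact Hy0).
unfold slash_defect. fold t. fold z.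
destruct (classic (theta z = 0)) as [H0|H0]; [rewrite EW, H0; replace (Cconj 0) with (RtoC 0) by (symmetry; apply HconjR); ring|].
destruct (classic (theta (moebius g0 z) = 0)) as [H1|H1]; [rewrite EU, H1; replace (Cconj 0) with (RtoC 0) by (symmetry; apply HconjR); ring|].
assert (Hs := slash_cleared m h g0 z e1 e2 (autj_g0_nz z Hz) H0 H1 He (Hmod z Hz)).
rewrite <- EY, <- EU, Emo, Eh1, Eh2 in Hs. rewrite Hs. ring.
Qed.

Lemma slash_defect_bottom (p : R) : (5 <= Rabs p)%R -> slash_defect (p, (- (PI / 2))%R) = 0.
Proof.
intros Hp. assert (H := vanishing_propagates _ (unif_holo_slash_defect p Hp)). lapply H; clear H.
- intros H. cbv beta in H. replace (strip_map p (0, (-1)%R)) with ((p, (- (PI / 2))%R) : C) in H; [exact H|].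
  unfold strip_map, RtoC, Cmult, Cplus; simpl. f_equal; field.
- intros x _. replace (strip_map p (x, 0%R)) with (((p + PI / 2 * x)%R, 0%R) : C); [apply slash_defect_real|].
  unfold strip_map, RtoC, Cmult, Cplus; simpl. f_equal; field.
Qed.

(** At t = 5 - i pi/2 and t = -5 - i pi/2 all ingredients agree, except that cosh, and
    with it V and |Mz+1|, change sign.  As e1 and e2 have opposite parity, the two
    relations add up to a multiple of S(V, z) + S(-V, z) = 2 C0 A(z). *)
Lemma cut_identity : lower_sum a (gzt (5, - (PI / 2))%R) = 0 \/ theta_gzt_conj (5, - (PI / 2))%R = 0 \/ theta_zt_conj (5, - (PI / 2))%R = 0.
Proof.
set (tp := (5, - (PI / 2))%R : C). set (tm := ((-5)%R, (- (PI / 2))%R) : C).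
assert (Hp := slash_defect_bottom 5 ltac:(rewrite Rabs_pos_eq; lra)). fold tp in Hp.
assert (Hm := slash_defect_bottom (-5) ltac:(rewrite Rabs_left; lra)). fold tm in Hm.
assert (Hcos : cos (- (PI / 2)) = 0%R) by (rewrite cos_neg; apply cos_PI2).
assert (Hsin : sin (- (PI / 2)) = (-1)%R) by (rewrite sin_neg, sin_PI2; ring).
assert (Esh : Csh tm = Csh tp).
{ unfold tm, tp. rewrite !Csh_pair, Hcos, Hsin. replace (-5)%R with (- (5))%R by ring. rewrite rch_opp. f_equal; ring. }
assert (Ech : Cch tm = - Cch tp).
{ unfold tm, tp. rewrite !Cch_pair, Hcos, Hsin. replace (-5)%R with (- (5))%R by ring. rewrite rsh_opp. unfold Copp; simpl. f_equal; ring. }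
assert (Ech0 : Re (Cch tp) = 0%R) by (unfold tp; rewrite Cch_pair, Hcos; simpl; ring).
assert (Htp : strip tp).
{ assert (HP := PI_RGT_0). unfold strip, tp; simpl. split; [lra|lra]. }
destruct (strip_nz tp Htp) as [Hal [Hbe Hch]].
assert (Eal : jt tm = jt tp) by (unfold jt; now rewrite Esh).
assert (Ebe : jt_conj tm = jt_conj tp) by (unfold jt_conj; now rewrite Esh).
assert (Ezg : gzt tm = gzt tp) by (unfold gzt; now rewrite Eal).
assert (Ezf : zt tm = zt tp) by (unfold zt; now rewrite Eal).
assert (EU : theta_gzt_conj tm = theta_gzt_conj tp) by (unfold theta_gzt_conj, gzt_conj; now rewrite Ebe).
assert (EW : theta_zt_conj tm = theta_zt_conj tp) by (unfold theta_zt_conj, zt_conj; now rewrite Ebe).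
assert (EY : jtheta_zt_conj tm = - jtheta_zt_conj tp) by (unfold jtheta_zt_conj; rewrite EW, Ech; ring).
assert (EV : root_gzt tm = - root_gzt tp).
{ unfold root_gzt. rewrite Ech. replace (RtoC eta * - Cch tp) with (- (RtoC eta * Cch tp)) by ring.
  revert Hch. generalize (RtoC eta * Cch tp). intros X HX. field. exact HX. }
unfold slash_defect in Hp, Hm. rewrite EU, EW, EY, Ezg, Ezf, EV in Hm.
set (U := theta_gzt_conj tp) in *. set (W := theta_zt_conj tp) in *. set (Y := jtheta_zt_conj tp) in *. set (V := root_gzt tp) in *. set (z := gzt tp) in *.
set (G := S (RtoC (sqrt y0)) (zt tp)) in *.
destruct (classic (U = 0)) as [HU|HU]; [now right; left|].
destruct (classic (W = 0)) as [HW|HW]; [now right; right|].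
left.
assert (HY : Y <> 0) by (unfold Y, jtheta_zt_conj; now apply Cmult_neq_0).
assert (Hopp : forall n, (- Y) ^ n = (- (1)) ^ n * Y ^ n) by (intros n; rewrite <- Cpow_mult_l; f_equal; ring).
rewrite !Hopp in Hm.
assert (Hpar : forall k, (- (1)) ^ (2 * k) = 1).
{ intros k. rewrite Cpow_mult_r. replace ((- (1)) ^ 2) with (RtoC 1) by (simpl; ring). apply Cpow_1_l. }
assert (Hsgn : (- (1)) ^ e1 = - (- (1)) ^ e2).
{ destruct (Nat.Even_or_Odd e2) as [[k Hk]|[k Hk]]; destruct (Nat.Even_or_Odd e1) as [[k' Hk']|[k' Hk']]; try lia; subst e1 e2;
    rewrite ?Cpow_add_r, !Hpar; simpl; ring. }
rewrite Hsgn in Hm.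
assert (Hsq : (- (1)) ^ e2 * (- (1)) ^ e2 = 1).
{ rewrite <- Cpow_add_r. replace (e2 + e2)%nat with (2 * e2)%nat by lia. apply Hpar. }
set (s := (- (1)) ^ e2) in *.
assert (HUW : forall c, c * U * W = 0 -> c = 0).
{ intros c Hc. replace c with (c * U * W * (/ U * / W)) by (field; auto). rewrite Hc. ring. }
apply HUW in Hp. apply HUW in Hm.
assert (Hsum : U ^ e1 * Y ^ e2 * (S V z + S (- V) z) = 0).
{ transitivity ((U ^ e1 * Y ^ e2 * S V z - U ^ e2 * Y ^ e1 * G) + s * s * (U ^ e1 * Y ^ e2 * S (- V) z + U ^ e2 * Y ^ e1 * G));
    [rewrite Hsq; ring|].
  rewrite Hp. transitivity (s * (U ^ e1 * (s * Y ^ e2) * S (- V) z - U ^ e2 * (- s * Y ^ e1) * G)); [ring|rewrite Hm; ring]. }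
assert (Hs0 := sqrt_lt_R0 y0 y0_pos).
assert (HV0 : V <> 0).
{ unfold V, root_gzt. apply Cmult_neq_0; [intros E; apply RtoC_inj in E; lra|].
  apply Cmod_gt_0. rewrite Cmod_inv by exact Hch. apply Rinv_0_lt_compat. now apply Cmod_gt_0. }
assert (HVre : Re V = 0%R).
{ unfold V, root_gzt. replace (Re (RtoC (sqrt y0) * / (RtoC eta * Cch tp))) with (sqrt y0 * Re (/ (RtoC eta * Cch tp)))%R
    by (generalize (/ (RtoC eta * Cch tp)); intros [u v]; unfold RtoC, Cmult, Re; simpl; ring).
  rewrite Re_inv by exact Hch.
  replace (Re (RtoC eta * Cch tp)) with (eta * Re (Cch tp))%R
    by (destruct (Cch tp) as [u v]; unfold RtoC, Cmult, Re; simpl; ring).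
  rewrite Ech0. unfold Rdiv. ring. }
assert (HM := M_pos).
assert (Hwgim : (Im (gzt_conj tp) < 0)%R).
{ assert (Him := strip_jt_conj_im tp Htp). unfold gzt_conj. replace (/ (RtoC M * jt_conj tp)) with (/ RtoC M * / jt_conj tp) by (field; split; [exact Hbe|apply MC_nz]).
  rewrite <- RtoC_inv by lra.
  replace (Im (RtoC (/ M) - RtoC (/ M) * / jt_conj tp)) with (- (/ M) * Im (/ jt_conj tp))%R
    by (generalize (/ jt_conj tp); intros [u v]; unfold RtoC, Cmult, Cminus, Cplus, Copp, Im; simpl; ring).
  rewrite Im_inv by exact Hbe. assert (Hm' := proj1 (Cmod_gt_0 _) Hbe). assert (Hi := Rinv_0_lt_compat M HM).
  assert (0 < - Im (jt_conj tp) / (Cmod (jt_conj tp) * Cmod (jt_conj tp)))%R by (apply Rdiv_lt_0_compat; nra). nra. }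
assert (Hzim : (Im z < 2 * Re (V * V))%R).
{ unfold z. rewrite (root_gzt_sq tp Htp). fold V. destruct (gzt_conj tp) as [u v], (V * V) as [u' v'].
  unfold Ci, RtoC, Cmult, Cplus, Re, Im in *; simpl in *. lra. }
assert (HVsq : (Re (V * V) <= 0)%R).
{ destruct V as [u v]. unfold Cmult, Re in *; simpl in *. subst u. nra. }
assert (Hsym := ext_sum_sym m Psi C0 KP JP HPsi a Ha a0 V z HV0 HVre Hzim ltac:(lra)).
change (ext_sum m Psi a a0 V z + ext_sum m Psi a a0 (- V) z) with (S V z + S (- V) z) in Hsym. rewrite Hsym in Hsum.
assert (HC0 := psi_const _ _ _ _ _ HPsi).
assert (N1 := Cpow_nz U e1 HU). assert (N2 := Cpow_nz Y e2 HY).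
assert (E2 : RtoC 2 <> 0) by (intros E; apply RtoC_inj in E; lra).
replace (lower_sum a z) with (U ^ e1 * Y ^ e2 * (2 * C0 * lower_sum a z) * (/ (U ^ e1) * / (Y ^ e2) * (/ 2 * / C0))) by (field; auto).
rewrite Hsum. ring.
Qed.
End Continuation.

(** * Uniqueness of Fourier coefficients *)

Lemma sum_n_cderive (T T' : nat -> C -> C) (z : C) (N : nat) : (forall k, is_cderive (T k) z (T' k z)) ->
  is_cderive (fun z => csum (fun k => T k z) N) z (csum (fun k => T' k z) N).
Proof.
intros H. induction N as [|N IH].
- rewrite sum_O. apply (is_cderive_ext (T O)); [|apply H]. intros t. now rewrite sum_O.
- rewrite sum_Sn. assert (H2 := is_cderive_plus _ _ _ _ _ IH (H (S N))).
  refine (is_cderive_ext _ _ _ _ _ H2). intros t. now rewrite sum_Sn.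
Qed.

Lemma sum_n_delta (c : C) (P : nat -> Prop) (Pd : forall k, {P k} + {~ P k}) (k0 N : nat) :
  (forall k, P k <-> k = k0) -> (k0 <= N)%nat -> csum (fun k => if Pd k then c else RtoC 0) N = c.
Proof.
intros HP HN.
assert (H : forall n, csum (fun k => if Pd k then c else RtoC 0) n = if le_lt_dec k0 n then c else RtoC 0).
{ induction n as [|n IH].
  - rewrite sum_O. destruct (Pd O) as [H|H], (le_lt_dec k0 0) as [H1|H1]; auto; exfalso; rewrite HP in H; lia.
  - rewrite sum_Sn, IH. destruct (Pd (S n)) as [H|H]; rewrite HP in H;
      destruct (le_lt_dec k0 n), (le_lt_dec k0 (S n)); try lia.
    + change ((0 + c)%C = c). ring.
    + change ((c + 0)%C = c). ring.
    + change ((0 + 0)%C = 0). ring. }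
rewrite H. destruct (le_lt_dec k0 N); [reflexivity|lia].
Qed.

Lemma sum_n_zero (u : nat -> C) (N : nat) : (forall k, u k = 0) -> csum u N = RtoC 0.
Proof.
intros H. induction N as [|N IH]; [rewrite sum_O; apply H|]. rewrite sum_Sn, IH, H. change ((0 + 0)%C = 0). ring.
Qed.

Lemma sum_n_minus (u v : nat -> C) (N : nat) :
  csum u N - csum v N = csum (fun k => u k - v k) N.
Proof.
induction N as [|N IH]; [now rewrite !sum_O|]. rewrite !sum_Sn, <- IH.
change (csum u N + u (S N) - (csum v N + v (S N)) = csum u N - csum v N + (u (S N) - v (S N))).
generalize (csum u N : C), (csum v N : C). intros; ring.
Qed.

Lemma qexp_add (n k : Z) (z : C) : qexp (n + k) z = qexp n z * qexp k z.
Proof.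
unfold qexp. rewrite <- Cexp_plus. f_equal. rewrite plus_IZR, Rmult_plus_distr_l, RtoC_plus. ring.
Qed.

Lemma cos_sin_periodic (x : R) (k : Z) : cos (x + 2 * PI * IZR k) = cos x /\ sin (x + 2 * PI * IZR k) = sin x.
Proof.
assert (H : forall x n, cos (x + 2 * PI * INR n) = cos x /\ sin (x + 2 * PI * INR n) = sin x).
{ clear. intros x n. replace (x + 2 * PI * INR n)%R with (x + 2 * INR n * PI)%R by ring. split; [apply cos_period|apply sin_period]. }
destruct (Z_lt_le_dec k 0) as [Hk|Hk].
- assert (E : IZR k = (- INR (Z.to_nat (- k)))%R) by (rewrite INR_IZR_INZ, <- opp_IZR; f_equal; lia).
  destruct (H (x + 2 * PI * IZR k)%R (Z.to_nat (- k))) as [H1 H2].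
  replace (x + 2 * PI * IZR k + 2 * PI * INR (Z.to_nat (- k)))%R with x in H1, H2 by (rewrite E; ring). split; congruence.
- replace (IZR k) with (INR (Z.to_nat k)) by (rewrite INR_IZR_INZ; f_equal; lia). apply H.
Qed.

Lemma qexp_periodic (k : Z) (x y : R) : qexp k ((x + 1)%R, y) = qexp k (x, y).
Proof.
assert (E : forall u v, RtoC (2 * PI * IZR k) * Ci * (u, v) = ((- (2 * PI * IZR k * v))%R, (2 * PI * IZR k * u)%R)).
{ intros u v. unfold RtoC, Ci, Cmult; simpl. f_equal; ring. }
unfold qexp. rewrite !E. unfold Cexp. simpl Re; simpl Im.
replace (2 * PI * IZR k * (x + 1))%R with (2 * PI * IZR k * x + 2 * PI * IZR k)%R by ring.
destruct (cos_sin_periodic (2 * PI * IZR k * x) k) as [-> ->]. reflexivity.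
Qed.

(** The integral over a period of a partial sum times q^{-n} is b n as soon as the
    partial sum contains the index n, and the partial sums tend to 0 uniformly. *)
Lemma fourier_coefficients_zero (b : Z -> C) (x0 y D rho : R) : (0 <= rho < 1)%R ->
  (forall k x, x0 <= x <= x0 + 1 -> Cmod (b k * qexp k (x, y)) <= D * rho ^ Z.abs_nat k)%R ->
  (forall x, (x0 <= x <= x0 + 1)%R -> is_Zseries (fun k => b k * qexp k (x, y)) 0) ->
  forall n, b n = 0.
Proof.
intros Hr HD HS n.
set (T := fun (k : Z) (z : C) => b k * qexp (k - n) z).
set (P := fun (k : Z) (z : C) => if Z.eq_dec k n then b n * z else b k * (/ (RtoC (2 * PI * IZR (k - n)) * Ci) * qexp (k - n) z)).
assert (HP : forall k z, is_cderive (P k) z (T k z)).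
{ intros k z. unfold P, T. destruct (Z.eq_dec k n) as [->|Hk].
  - eapply is_cderive_eq; [cder|]. cbv beta. unfold qexp. rewrite Z.sub_diag, Rmult_0_r, !Cmult_0_l, Cexp_0. ring.
  - assert (Hnz : RtoC (2 * PI * IZR (k - n)) * Ci <> 0).
    { assert (HPI := PI_RGT_0). apply Cmult_neq_0.
      - intros E. apply RtoC_inj in E. apply Rmult_integral in E. destruct E as [E|E]; [lra|]. apply eq_IZR in E. lia.
      - intros E. apply (f_equal Im) in E. unfold Ci, RtoC in E; simpl in E. lra. }
    unfold qexp. eapply is_cderive_eq; [cder|]. cbv beta. revert Hnz. generalize (RtoC (2 * PI * IZR (k - n)) * Ci).
    intros c Hc. generalize (Cexp (c * z)). intros e. field. exact Hc. }
assert (HPd : forall k, P k ((x0 + 1)%R, y) - P k (x0, y) = if Z.eq_dec k n then b n else RtoC 0).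
{ intros k. unfold P. destruct (Z.eq_dec k n) as [->|Hk]; [|rewrite qexp_periodic; ring].
  replace (((x0 + 1)%R, y) : C) with ((x0, y) + 1) by (unfold RtoC, Cplus; simpl; f_equal; ring). ring. }
set (SN := fun N z => csum (fun k => T (Z.of_nat k) z) N + csum (fun k => T (- Z.of_nat (S k))%Z z) N).
set (PN := fun N z => csum (fun k => P (Z.of_nat k) z) N + csum (fun k => P (- Z.of_nat (S k))%Z z) N).
assert (HPN : forall N z, is_cderive (PN N) z (SN N z)).
{ intros N z. unfold PN, SN. apply (is_cderive_plus (fun z => csum (fun k => P (Z.of_nat k) z) N)).
  - apply (sum_n_cderive (fun k => P (Z.of_nat k)) (fun k => T (Z.of_nat k))). auto.
  - apply (sum_n_cderive (fun k => P (- Z.of_nat (S k))%Z) (fun k => T (- Z.of_nat (S k))%Z)). auto. }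
assert (HSN : forall N z, cdiff (SN N) z).
{ intros N z. unfold SN. assert (HT : forall k, cdiff (T k) z).
  { intros k. unfold T. apply (cdiff_mult (fun _ => b k)); [apply cdiff_const|]. apply (cdiff_qexp _ (fun z => z)). cdiff. }
  apply (cdiff_plus (fun z => csum (fun k => T (Z.of_nat k) z) N));
    [apply (sum_n_cdiff (fun k => T (Z.of_nat k)))|apply (sum_n_cdiff (fun k => T (- Z.of_nat (S k))%Z))]; auto. }
assert (Hint : forall N, (Z.abs_nat n <= N)%nat -> hint (SN N) y x0 (x0 + 1) = b n).
{ intros N HN. rewrite (hint_prim (PN N)) by (try lra; auto). unfold PN.
  transitivity (csum (fun k => P (Z.of_nat k) ((x0 + 1)%R, y) - P (Z.of_nat k) (x0, y)) N +
     csum (fun k => P (- Z.of_nat (S k))%Z ((x0 + 1)%R, y) - P (- Z.of_nat (S k))%Z (x0, y)) N).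
  { rewrite <- !sum_n_minus. Cring. }
  rewrite (sum_n_ext (G := CR) _ (fun k => if Z.eq_dec (Z.of_nat k) n then b n else RtoC 0)) by (intros; apply HPd).
  rewrite (sum_n_ext (G := CR) (fun k => P (- Z.of_nat (S k))%Z ((x0 + 1)%R, y) - _) (fun k => if Z.eq_dec (- Z.of_nat (S k))%Z n then b n else RtoC 0))
    by (intros; apply HPd).
  destruct (Z_lt_le_dec n 0) as [Hn|Hn].
  - rewrite sum_n_zero by (intros k; destruct (Z.eq_dec (Z.of_nat k) n); [lia|reflexivity]).
    rewrite (sum_n_delta (b n) (fun k => (- Z.of_nat (S k))%Z = n) (fun k => Z.eq_dec _ _) (Z.to_nat (- n - 1))) by (intros; lia). ring.
  - rewrite (sum_n_delta (b n) (fun k => Z.of_nat k = n) (fun k => Z.eq_dec _ _) (Z.to_nat n)) by (intros; lia).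
    rewrite sum_n_zero by (intros k; destruct (Z.eq_dec (- Z.of_nat (S k)) n); [lia|reflexivity]). ring. }
set (c := exp (2 * PI * IZR n * y)). assert (Hc := exp_pos (2 * PI * IZR n * y)). fold c in Hc.
assert (HD0 : (0 <= D)%R).
{ specialize (HD 0%Z x0 ltac:(lra)). simpl in HD. assert (H := Cmod_ge_0 (b 0%Z * qexp 0 (x0, y))). lra. }
assert (Ec : forall x, Cmod (qexp (- n) (x, y)) = c).
{ intros x. rewrite Cmod_qexp. unfold c. f_equal. rewrite opp_IZR. unfold Im; simpl. ring. }
assert (ET : forall k z, T k z = qexp (- n) z * (b k * qexp k z)).
{ intros k z. unfold T. unfold Z.sub. rewrite qexp_add. ring. }
assert (HT : forall k x, (x0 <= x <= x0 + 1)%R -> (Cmod (T k (x, y)) <= c * D * rho ^ Z.abs_nat k)%R).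
{ intros k x Hx. rewrite ET, Cmod_mult, Ec, Rmult_assoc. apply Rmult_le_compat_l; [lra|auto]. }
assert (Hbd : forall N x, (x0 <= x <= x0 + 1)%R -> (Cmod (SN N (x, y)) <= 2 * (c * D / (1 - rho)) * rho ^ S N)%R).
{ intros N x Hx. assert (HZ := is_Zseries_scal (qexp (- n) (x, y)) _ _ (HS x Hx)).
  destruct HZ as [l1 [l2 [H1 [H2 E]]]].
  assert (G1 := geom_tail (fun k => T (Z.of_nat k) (x, y)) l1 (c * D) rho Hr).
  assert (G2 := geom_tail (fun k => T (- Z.of_nat (S k))%Z (x, y)) l2 (c * D) rho Hr).
  lapply G1; [clear G1; intros G1|].
  2:{ intros k. specialize (HT (Z.of_nat k) x Hx). now rewrite Zabs2Nat.id in HT. }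
  lapply G2; [clear G2; intros G2|].
  2:{ intros k. specialize (HT (- Z.of_nat (S k))%Z x Hx). replace (Z.abs_nat (- Z.of_nat (S k))) with (S k) in HT by lia.
      eapply Rle_trans; [exact HT|]. simpl. assert (Hk := pow_le rho k (proj1 Hr)). apply Rmult_le_compat_l; nra. }
  lapply G1; [clear G1; intros G1|refine (is_series_ext (V := CR) _ _ _ _ H1); intros k; now rewrite ET].
  lapply G2; [clear G2; intros G2|refine (is_series_ext (V := CR) _ _ _ _ H2); intros k; now rewrite ET].
  specialize (G1 N). specialize (G2 N). unfold SN.
  match goal with |- (Cmod (?u + ?v)%C <= _)%R => replace (u + v) with ((u - l1) + (v - l2)) end.
  2:{ match goal with |- (?u - l1) + (?v - l2) = _ => generalize (u : C), (v : C) end. intros u v.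
      transitivity (u + v - (l1 + l2)); [ring|]. rewrite <- E. ring. }
  eapply Rle_trans; [apply Cmod_triangle|]. lra. }
apply Cmod_eq_0. apply Rle_antisym; [|apply Cmod_ge_0]. apply le_epsilon. intros eps Heps.
set (Q := (2 * (c * D / (1 - rho)))%R) in *.
assert (HQ : (0 <= Q)%R).
{ unfold Q. apply Rmult_le_pos; [lra|]. apply Rdiv_le_0_compat; [nra|lra]. }
destruct (pow_lt_1_zero rho ltac:(rewrite Rabs_pos_eq; lra) (eps / (Q + 1))%R) as [n0 Hn0]; [apply Rdiv_lt_0_compat; lra|].
set (N := Nat.max n0 (Z.abs_nat n)). specialize (Hn0 (S N) ltac:(lia)). rewrite Rabs_pos_eq in Hn0 by (apply pow_le; lra).
rewrite <- (Hint N ltac:(lia)).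
assert (HL := hint_le (SN N) y x0 (x0 + 1) (Q * rho ^ S N) ltac:(lra) ltac:(auto) ltac:(auto)).
apply Rlt_div_r in Hn0; [|lra]. assert (Hp := pow_le rho (S N) (proj1 Hr)). nra.
Qed.

(** * Vanishing of the nonconstant coefficients *)

Lemma Cinv_imaginary (c : R) : c <> 0%R -> / ((0, (- c)%R) : C) = (0, (/ c)%R).
Proof.
intros H. unfold Cinv; simpl. f_equal; field; auto.
Qed.

(** With eta = 1/(M r (cosh 5 - 1)) the point g z is 1/M - i r, and the two theta
    values are taken on the vertical lines through -1/M and 1/M, at heights
    proportional to r and to 1/r. *)
Lemma cut_points (Mz : Z) (r : R) : (0 < Mz)%Z -> (0 < r)%R ->
  let M := IZR Mz in let c := rch 5 in let eta := (/ (M * r * (c - 1)))%R in let t := (5, (- (PI / 2))%R) : C in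
  gzt Mz eta t = ((/ M)%R, (- r)%R) /\ theta_gzt_conj Mz eta t = theta ((- / M)%R, ((c - 1) / (c + 1) * r)%R) /\
  theta_zt_conj Mz eta t = theta ((/ M)%R, ((c + 1) / (M * M * (c - 1)) / r)%R).
Proof.
intros HMz Hr M c eta t. assert (HM : (0 < M)%R) by (apply IZR_lt; exact HMz).
assert (Hc : (1 < c)%R) by (apply rch_gt_1; lra).
assert (Heta : (0 < eta)%R) by (apply Rinv_0_lt_compat; assert (0 < M * r)%R by nra; nra).
assert (Hcos : cos (- (PI / 2)) = 0%R) by (rewrite cos_neg; apply cos_PI2).
assert (Hsin : sin (- (PI / 2)) = (-1)%R) by (rewrite sin_neg, sin_PI2; ring).
assert (Es : Csh t = (0, (- c)%R)%R) by (unfold t; rewrite Csh_pair, Hcos, Hsin; fold c; f_equal; ring).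
assert (Eal : jt eta t = (0, (- (eta * (c - 1)))%R)%R).
{ unfold jt. rewrite Es. unfold Ci, RtoC, Cmult, Cplus; simpl. f_equal; ring. }
assert (Ebe : jt_conj eta t = (0, (- (eta * (c + 1)))%R)%R).
{ unfold jt_conj. rewrite Es. unfold Ci, RtoC, Cmult, Cminus, Cplus, Copp; simpl. f_equal; ring. }
assert (EM : forall x y : R, RtoC M * (x, y) = ((M * x)%R, (M * y)%R)) by (intros; unfold RtoC, Cmult; simpl; f_equal; ring).
assert (Einv : forall d, (0 < d)%R -> / RtoC M - / (RtoC M * (0, (- d)%R)) = ((/ M)%R, (- / (M * d))%R)).
{ intros d Hd. rewrite EM. replace ((M * 0)%R, (M * - d)%R) with ((0, (- (M * d))%R) : C) by (f_equal; ring).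
  rewrite Cinv_imaginary by nra. rewrite <- RtoC_inv by lra. unfold RtoC, Cminus, Cplus, Copp; simpl. f_equal; ring. }
split; [|split].
- unfold gzt. fold M. rewrite Eal, Einv by nra. unfold eta. f_equal. field. lra.
- unfold theta_gzt_conj, gzt_conj. fold M. rewrite Ebe, Einv by nra. f_equal. unfold Copp; simpl. f_equal. unfold eta. field. lra.
- unfold theta_zt_conj, zt_conj. fold M. rewrite Ebe. f_equal. rewrite <- RtoC_inv by lra. unfold RtoC, Cmult, Cminus, Cplus, Copp; simpl. unfold eta. f_equal; field; lra.
Qed.

Section Coefficients.
Variables (m : Z) (Psi : C -> C) (C0 : C) (KP : R) (JP : nat).
Hypothesis HPsi : B_profile m Psi C0 KP JP.
Variable a : Z -> C.
Hypothesis Ha : forall y : R, (0 < y)%R -> exists B : R, forall n, n <> 0%Z ->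
  (Cmod (a n) * Cmod (Psi (mu n * RtoC (sqrt y))) <= B * exp (2 * PI * IZR n * y))%R.
Variable a0 : C.
Variable h : C -> C.
Hypothesis Hexp : forall z, upper_half_plane z -> is_Zseries (fun n => ext_term m Psi a a0 n (RtoC (sqrt (Im z))) z) (h z).
Variable Mz : Z.
Hypothesis HMz : (0 < Mz)%Z.
Let M : R := IZR Mz.
Let g0 : mat2 := Mat2 1 0 Mz 1.
Variables e1 e2 : nat.
Hypothesis He : (Z.of_nat e1 - Z.of_nat e2 = 3 - 2 * m)%Z.
Hypothesis Hmod : forall z, upper_half_plane z -> slash (3 / 2 - IZR m) h g0 z = h z.

(** If A were nonzero at depth r it would be nonzero on a whole segment of depths.
    For such depths the first theta value is not zero, its height being at least 1,
    so theta would vanish on a vertical segment. *)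
Lemma lower_sum_ray (r : R) : ((rch 5 + 1) / (rch 5 - 1) <= r)%R -> lower_sum a ((/ M)%R, (- r)%R) = 0.
Proof.
intros Hr. assert (HM : (0 < M)%R) by (apply IZR_lt; exact HMz).
assert (Hc : (1 < rch 5)%R) by (apply rch_gt_1; lra).
set (c := rch 5) in *.
assert (Hr0 : (0 < (c + 1) / (c - 1))%R) by (apply Rdiv_lt_0_compat; lra).
destruct (classic (lower_sum a ((/ M)%R, (- r)%R) = 0)) as [|HN]; [assumption|exfalso].
apply Cmod_gt_0 in HN. set (l := Cmod (lower_sum a ((/ M)%R, (- r)%R))) in *.
set (K := fun z : C => Re z = (/ M)%R /\ (- (r + 1) <= Im z <= - r)%R).
assert (HUL : unif_holo K (fun z => lower_sum a z)).
{ apply (unif_holo_lower_sum m Psi C0 KP JP HPsi a Ha K (fun z => z) r (/ M + (r + 1))); [lra|intros; cdiff|].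
  intros [u v] [H1 H2]. simpl in H1, H2. split; [simpl; lra|].
  eapply Rle_trans; [apply Cmod_le_abs|]. simpl. rewrite H1.
  assert (Hi := Rinv_0_lt_compat M HM). rewrite (Rabs_pos_eq (/ M)) by lra. rewrite Rabs_left by lra. lra. }
destruct (unif_holo_continuous K _ ((/ M)%R, (- r)%R) HUL ltac:(unfold K; simpl; lra) (l / 2)%R ltac:(lra)) as [d [Hd1 Hd]].
set (d' := Rmin (d / 2) 1). assert (Hd' : (0 < d')%R) by (apply Rmin_pos; lra).
assert (Hd'1 := Rmin_l (d / 2) 1). assert (Hd'2 := Rmin_r (d / 2) 1). fold d' in Hd'1, Hd'2.
assert (HA : forall s, (r <= s <= r + d')%R -> lower_sum a ((/ M)%R, (- s)%R) <> 0).
{ intros s Hs H0. specialize (Hd ((/ M)%R, (- s)%R)).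
  lapply Hd; [clear Hd; intros Hd|unfold K; simpl; lra].
  lapply Hd; [clear Hd; intros Hd|].
  - rewrite H0 in Hd. replace (0 - lower_sum a ((/ M)%R, (- r)%R)) with (- lower_sum a ((/ M)%R, (- r)%R)) in Hd by ring.
    rewrite Cmod_opp in Hd. fold l in Hd. lra.
  - replace (((/ M)%R, (- s)%R) - ((/ M)%R, (- r)%R)) with ((0, (- (s - r))%R) : C) by (unfold Cminus, Cplus, Copp; simpl; f_equal; ring).
    eapply Rle_lt_trans; [apply Cmod_le_abs|]. simpl. rewrite Rabs_R0, Rabs_Ropp, Rabs_pos_eq by lra. lra. }
set (k2 := ((c + 1) / (M * M * (c - 1)))%R).
assert (Hk2 : (0 < k2)%R) by (apply Rdiv_lt_0_compat; [lra|assert (0 < M * M)%R by nra; nra]).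
apply (theta_vertical (/ M) (k2 / (r + d')) (k2 / r)).
- split; [apply Rdiv_lt_0_compat; lra|]. apply Rmult_lt_compat_l; [exact Hk2|]. apply Rinv_lt_contravar; nra.
- intros y Hy. set (s := (k2 / y)%R).
  assert (Hy0 : (0 < y)%R) by (assert (0 < k2 / (r + d'))%R by (apply Rdiv_lt_0_compat; lra); lra).
  assert (Hs : (r <= s <= r + d')%R).
  { unfold s. destruct Hy as [Hy1 Hy2]. apply Rle_div_l in Hy1; [|lra]. apply Rle_div_r in Hy2; [|lra].
    split; [apply Rle_div_r; lra|apply Rle_div_l; lra]. }
  destruct (cut_points Mz s HMz ltac:(lra)) as [E1 [E2 E3]]. fold c M in E1, E2, E3.
  set (eta := (/ (M * s * (c - 1)))%R) in *.
  assert (Heta : (0 < eta)%R) by (apply Rinv_0_lt_compat; assert (0 < M * s)%R by nra; nra).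
  assert (H := cut_identity m Psi C0 KP JP HPsi a Ha a0 h Hexp Mz HMz e1 e2 He Hmod eta Heta).
  rewrite E1, E2, E3 in H. fold k2 in H. replace (k2 / s)%R with y in H by (unfold s; field; lra).
  destruct H as [H|[H|H]]; [now apply HA in H| |exact H].
  exfalso. revert H. apply theta_nz. simpl.
  assert (Hks : ((c - 1) / (c + 1) * ((c + 1) / (c - 1)) = 1)%R) by (field; lra).
  apply Rle_trans with ((c - 1) / (c + 1) * ((c + 1) / (c - 1)))%R; [lra|]. apply Rmult_le_compat_l; [|lra]. left. apply Rdiv_lt_0_compat; lra.
Qed.

(** The rectangle is turned by a right angle: its top side lies on the vertical half
    line of lower_sum_ray, and -i goes to a given point of the horizontal segment. *)
Lemma coefficients_zero (n : Z) : n <> 0%Z -> a n = 0.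
Proof.
intros Hn. assert (HM : (0 < M)%R) by (apply IZR_lt; exact HMz). assert (Hi := Rinv_0_lt_compat M HM).
assert (Hc : (1 < rch 5)%R) by (apply rch_gt_1; lra).
set (r0 := ((rch 5 + 1) / (rch 5 - 1))%R).
assert (Hr0 : (0 < r0)%R) by (apply Rdiv_lt_0_compat; lra).
set (y := (- (r0 + 2))%R).
assert (Hzero : forall x, (/ M <= x <= / M + 1)%R -> lower_sum a (x, y) = 0).
{ intros x Hx. set (u := (x - / M)%R).
  set (psi := fun z : C => ((/ M)%R, y) + Ci * RtoC u * z).
  assert (Epsi : forall p q : R, psi (p, q) = ((/ M - u * q)%R, (y + u * p)%R)).
  { intros p q. unfold psi, Ci, RtoC, Cmult, Cplus; simpl. f_equal; ring. }
  assert (HV := vanishing_propagates (fun z => lower_sum a (psi z))).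
  lapply HV; [clear HV; intros HV|].
  - lapply HV; [clear HV; intros HV|].
    + cbv beta in HV. rewrite Epsi in HV. rewrite <- HV. f_equal. f_equal; unfold u; ring.
    + intros p Hp. rewrite Epsi. replace (/ M - u * 0)%R with (/ M)%R by ring.
      replace (y + u * p)%R with (- (r0 + 2 - u * p))%R by (unfold y; ring).
      apply lower_sum_ray. fold r0. unfold u. nra.
  - assert (Dpsi : forall z, model_rect z -> cdiff psi z) by (intros z _; unfold psi; cdiff).
    destruct (model_rect_bounded psi Dpsi) as [B [_ HB]].
    apply (unif_holo_lower_sum m Psi C0 KP JP HPsi a Ha model_rect psi r0 B); [exact Hr0|exact Dpsi|].
    intros z Hz. split; [|now apply HB]. destruct z as [p q]. unfold model_rect, in_rect in Hz. simpl in Hz. rewrite Epsi. simpl.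
    unfold y, u. nra. }
set (b := fun k => if Z.eq_dec k 0 then RtoC 0 else a k).
assert (Eb : forall k z, b k * qexp k z = lower_term a k z).
{ intros k z. unfold b, lower_term. destruct (Z.eq_dec k 0); [ring|reflexivity]. }
destruct (lower_term_bound m Psi C0 KP JP HPsi a Ha (r0 + 2) (/ M + 1 + (r0 + 2)) ltac:(lra)) as [D [rho [Hrho HD]]].
assert (Hb : b n = 0).
{ apply (fourier_coefficients_zero b (/ M) y D rho Hrho).
  - intros k x Hx. rewrite Eb. apply HD; [unfold y; simpl; lra|].
    eapply Rle_trans; [apply Cmod_le_abs|]. simpl. rewrite Rabs_pos_eq by lra. unfold y. rewrite Rabs_left by lra. lra.
  - intros x Hx. rewrite <- (Hzero x Hx). apply (is_Zseries_ext (fun k => lower_term a k (x, y))); [intros; now rewrite Eb|].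
    apply (lower_sum_correct m Psi C0 KP JP HPsi a Ha). unfold y; simpl; lra. }
unfold b in Hb. now destruct (Z.eq_dec n 0).
Qed.
End Coefficients.

(** * Vanishing of the constant term *)

Lemma is_Zseries_delta (T : Z -> C) : (forall n, n <> 0%Z -> T n = 0) -> is_Zseries T (T 0%Z).
Proof.
intros H.
assert (Hs : forall (u : nat -> C) l, (forall n, csum u n = l) -> is_cseries u l).
{ intros u l Hu. apply is_series_CR. intros eps He. exists O. intros n _. rewrite Hu.
  replace (l - l) with (RtoC 0) by ring. rewrite Cmod_0. exact He. }
exists (T 0%Z), 0. split; [|split; [|ring]]; apply Hs; intros n.
- rewrite (sum_n_ext (G := CR) _ (fun k => if Nat.eq_dec k 0 then T 0%Z else RtoC 0)).
  + apply (sum_n_delta _ (fun k => k = 0%nat) (fun k => Nat.eq_dec k 0) 0); [reflexivity|lia].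
  + intros k. destruct (Nat.eq_dec k 0) as [->|Hk]; [reflexivity|apply H; lia].
- apply sum_n_zero. intros k. apply H. lia.
Qed.

Section ConstantTerm.
Variable Mz : Z.
Hypothesis HMz : (0 < Mz)%Z.
Let M : R := IZR Mz.
Let g0 : mat2 := Mat2 1 0 Mz 1.

Lemma Im_moebius_g0 (z : C) : autj g0 z <> 0 -> Im (moebius g0 z) = (Im z / (Cmod (autj g0 z) * Cmod (autj g0 z)))%R.
Proof.
intros Hj. assert (HM : (0 < M)%R) by (apply IZR_lt; exact HMz).
assert (HMC : RtoC M <> 0) by (intros E; apply RtoC_inj in E; lra).
unfold g0 in *. rewrite moebius_g0 by assumption. fold M.
assert (Ej : Im (autj {| ma := 1; mb := 0; mc := Mz; md := 1 |} z) = (M * Im z)%R).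
{ unfold autj, M. destruct z as [x y]. unfold RtoC, Cmult, Cplus, Im; simpl. ring. }
set (j := autj {| ma := 1; mb := 0; mc := Mz; md := 1 |} z) in *.
replace (/ (RtoC M * j)) with (/ RtoC M * / j) by (field; auto). rewrite <- RtoC_inv by lra.
replace (Im (RtoC (/ M) - RtoC (/ M) * / j)) with (- (/ M) * Im (/ j))%R
    by (generalize (/ j); intros [u v]; unfold RtoC, Cmult, Cminus, Cplus, Copp, Im; simpl; ring).
rewrite Im_inv, Ej by exact Hj. apply Cmod_gt_0 in Hj. field. lra.
Qed.

(** Im(g z) = Im z / |Mz+1|^2 stays away from 0 since |Mz+1| is bounded on the
    rectangle. *)
Lemma unif_holo_theta_moebius (psi : C -> C) (d : R) : (0 < d)%R -> (forall z, model_rect z -> cdiff psi z) ->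
  (forall z, model_rect z -> d <= Im (psi z))%R -> unif_holo model_rect (fun z => theta (moebius g0 (psi z))).
Proof.
intros Hd Dpsi Him. assert (HM : (0 < M)%R) by (apply IZR_lt; exact HMz).
assert (HMC : RtoC M <> 0) by (intros E; apply RtoC_inj in E; lra).
assert (Hj : forall z, model_rect z -> autj g0 (psi z) <> 0).
{ intros z Hz. apply autj_g0_nz; [exact HMz|]. unfold upper_half_plane. specialize (Him z Hz). lra. }
assert (Dj : forall z, model_rect z -> cdiff (fun z => autj g0 (psi z)) z).
{ intros z Hz. unfold autj. destruct (Dpsi z Hz) as [l Hl]. cdiff. exact Hl. }
destruct (model_rect_bounded _ Dj) as [B [HB0 HB]].
assert (Hd2 : (0 < d / (B * B))%R) by (apply Rdiv_lt_0_compat; nra).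
apply (unif_holo_theta model_rect (fun z => moebius g0 (psi z)) _ Hd2).
- intros z Hz. unfold moebius. destruct (Dpsi z Hz) as [l Hl]. unfold autj. cdiff; try exact Hl. exact (Hj z Hz).
- intros z Hz. rewrite Im_moebius_g0 by auto.
  assert (H1 := Him z Hz). assert (H2 := HB z Hz). assert (H3 := proj1 (Cmod_gt_0 _) (Hj z Hz)).
  assert (H4 : (Cmod (autj g0 (psi z)) * Cmod (autj g0 (psi z)) <= B * B)%R) by nra.
  unfold Rdiv. apply Rmult_le_compat; [lra| |exact H1|apply Rinv_le_contravar; [nra|exact H4]].
  left. apply Rinv_0_lt_compat. nra.
Qed.

(** Maps the top side of the rectangle into the line of height y, and -i to x + i y1. *)
Definition descent (x y y1 : R) (t : C) : C := (x, y) + RtoC (y - y1) * t.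

Lemma descent_pair (x y y1 p q : R) : descent x y y1 (p, q) = ((x + (y - y1) * p)%R, (y + (y - y1) * q)%R).
Proof. unfold descent, RtoC, Cmult, Cplus; simpl. f_equal; ring. Qed.

Lemma descent_cdiff (x y y1 : R) (t : C) : cdiff (descent x y y1) t.
Proof. unfold descent. cdiff. Qed.

Lemma descent_im (x y y1 : R) (t : C) : model_rect t -> (Rmin y y1 <= Im (descent x y y1 t))%R.
Proof.
destruct t as [p q]. intros Hz. unfold model_rect, in_rect in Hz; simpl in Hz. rewrite descent_pair. simpl.
unfold Rmin. destruct (Rle_dec y y1); nra.
Qed.

(** On the line Im z = 1 theta has no zero, so theta(g z) would vanish there, hence
    also at the point z = -1/M + i/M^2, for which g z = 1/M + i. *)
Lemma theta_orbit_not_all_zero : ~ (forall z, upper_half_plane z -> theta z = 0 \/ theta (moebius g0 z) = 0).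
Proof.
intros H. assert (HM : (0 < M)%R) by (apply IZR_lt; exact HMz).
assert (Hi := Rinv_0_lt_compat M HM).
assert (HM2 : (0 < / (M * M))%R) by (apply Rinv_0_lt_compat; nra).
assert (HV := vanishing_propagates (fun t => theta (moebius g0 (descent (- / M) 1 (/ (M * M)) t)))).
lapply HV; [clear HV; intros HV|].
- lapply HV; [clear HV; intros HV|].
  + cbv beta in HV. rewrite descent_pair in HV.
    match type of HV with context [theta (moebius _ ?z)] => replace z with (((- / M)%R, (/ (M * M))%R) : C) in HV by (f_equal; ring) end.
    revert HV. apply theta_nz.
    assert (Ej : autj g0 ((- / M)%R, (/ (M * M))%R) = (0, (/ M)%R)).
    { unfold autj, g0, RtoC, Cmult, Cplus; simpl. fold M. f_equal; field; lra. }
    assert (Hj : Cmod (0, (/ M)%R) = (/ M)%R) by (unfold Cmod; simpl; replace (0 * (0 * 1) + / M * (/ M * 1))%R with (/ M * / M)%R by ring; apply sqrt_square; lra).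
    rewrite Im_moebius_g0, Ej, Hj.
    * simpl. right. field. lra.
    * rewrite Ej. intros E. apply (f_equal Im) in E. simpl in E. lra.
  + intros p _. rewrite descent_pair. set (x := (- / M + (1 - / (M * M)) * p)%R).
    replace (1 + (1 - / (M * M)) * 0)%R with 1%R by ring.
    destruct (H (x, 1%R)) as [H1|H1]; [unfold upper_half_plane; simpl; lra| |exact H1].
    exfalso. revert H1. apply theta_nz. simpl. lra.
- apply (unif_holo_theta_moebius _ (Rmin 1 (/ (M * M)))); [now apply Rmin_pos; lra|intros; apply descent_cdiff|intros; now apply descent_im].
Qed.

Variables (m : Z) (e1 e2 : nat).
Hypothesis He : (Z.of_nat e1 - Z.of_nat e2 = 3 - 2 * m)%Z.
Variables (c : C) (h : C -> C).
Hypothesis Hc : c <> 0.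
Hypothesis Hh : forall z, upper_half_plane z -> h z = c * zpow (RtoC (sqrt (Im z))) (2 * m - 1).
Hypothesis Hmod : forall z, upper_half_plane z -> slash (3 / 2 - IZR m) h g0 z = h z.

(** The conjugate of the cleared transformation law for h(z) = c y^{m-1/2}: the powers
    of |Mz+1| that come from h and from the weight combine to |Mz+1|^2. *)
Lemma theta_power_relation (z : C) : upper_half_plane z -> theta z <> 0 -> theta (moebius g0 z) <> 0 ->
  theta (moebius g0 z) ^ e1 * theta z ^ e2 =
  theta (moebius g0 z) ^ e2 * theta z ^ e1 * (autj g0 z * (autj g0 z - 2 * Ci * RtoC M * RtoC (Im z))).
Proof.
intros Hz H1 H2. assert (HM : (0 < M)%R) by (apply IZR_lt; exact HMz).
assert (Hj : autj g0 z <> 0) by now apply autj_g0_nz.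
assert (Hs := slash_cleared m h g0 z e1 e2 Hj H1 H2 He (Hmod z Hz)).
assert (HJ := proj1 (Cmod_gt_0 _) Hj).
assert (Him := Im_moebius_g0 z Hj).
assert (Hgz : upper_half_plane (moebius g0 z)).
{ unfold upper_half_plane in *. rewrite Him. apply Rdiv_lt_0_compat; [exact Hz|nra]. }
rewrite !Hh in Hs by assumption.
assert (Hconj : autj g0 z - 2 * Ci * RtoC M * RtoC (Im z) = Cconj (autj g0 z)).
{ unfold autj, g0; simpl. fold M. destruct z as [x y]. unfold Cconj, Ci, RtoC, Cmult, Cminus, Cplus, Copp, Im; simpl. f_equal; ring. }
rewrite Hconj, <- Cmod2_conj.
set (J := Cmod (autj g0 z)) in *.
set (V' := RtoC (sqrt (Im (moebius g0 z)))) in *.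
assert (HV : RtoC (sqrt (Im z)) = V' * RtoC J).
{ unfold V'. rewrite Him, <- RtoC_mult. f_equal. rewrite sqrt_div_alt by nra. rewrite sqrt_square by lra. field. lra. }
rewrite HV in Hs.
assert (HV0 : V' <> 0).
{ intros E. unfold V' in E. apply RtoC_inj in E. assert (H := sqrt_lt_R0 _ Hgz). lra. }
assert (HJ0 : RtoC J <> 0) by (intros E; apply RtoC_inj in E; lra).
rewrite zpow_mult in Hs by assumption.
assert (Hp : zpow V' (2 * m - 1) <> 0) by now apply zpow_nz.
set (U := Cconj (theta (moebius g0 z))) in *. set (W := Cconj (theta z)) in *.
rewrite !Cpow_mult_l in Hs.
assert (HJe : RtoC J ^ e1 * zpow (RtoC J) (2 * m - 1) = RtoC J ^ e2 * (RtoC J * RtoC J)).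
{ replace (RtoC J ^ e2 * (RtoC J * RtoC J)) with (RtoC J ^ (e2 + 2)) by (rewrite Cpow_add_r; simpl; ring).
  rewrite <- !zpow_nat, <- zpow_add by exact HJ0. f_equal. lia. }
assert (HJe0 : RtoC J ^ e2 <> 0) by now apply Cpow_nz.
assert (E : U ^ e1 * W ^ e2 = U ^ e2 * W ^ e1 * (RtoC J * RtoC J)).
{ assert (E : (U ^ e1 * W ^ e2) * (RtoC J ^ e2 * (c * zpow V' (2 * m - 1))) =
    (U ^ e2 * W ^ e1 * (RtoC J * RtoC J)) * (RtoC J ^ e2 * (c * zpow V' (2 * m - 1)))).
  { transitivity (U ^ e1 * (RtoC J ^ e2 * W ^ e2) * (c * zpow V' (2 * m - 1))); [ring|]. rewrite Hs.
    transitivity (U ^ e2 * W ^ e1 * (c * zpow V' (2 * m - 1)) * (RtoC J ^ e1 * zpow (RtoC J) (2 * m - 1))); [ring|]. rewrite HJe. ring. }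
  assert (Hq : RtoC J ^ e2 * (c * zpow V' (2 * m - 1)) <> 0) by (apply Cmult_neq_0; [exact HJe0|now apply Cmult_neq_0]).
  revert E Hq. generalize (RtoC J ^ e2 * (c * zpow V' (2 * m - 1))). intros X E Hq.
  match goal with |- ?A = ?B => replace A with (A * X * / X) by (field; exact Hq); replace B with (B * X * / X) by (field; exact Hq) end.
  now rewrite E. }
apply (f_equal Cconj) in E. unfold U, W in E.
rewrite !Cmult_conj, !Cpow_conj, !Cconj_conj in E.
replace (Cconj (RtoC J)) with (RtoC J) in E by (unfold Cconj, RtoC; simpl; f_equal; ring).
rewrite E. f_equal. rewrite RtoC_pow. simpl. ring.
Qed.

(** E y z is the difference of both sides of theta_power_relation with the height in
    the last factor frozen at y.  It vanishes on the line Im z = y, hence everywhere,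
    and E 1 - E 2 is a nonvanishing multiple of powers of theta(z) and theta(g z). *)
Lemma constant_term_impossible : False.
Proof.
assert (HM : (0 < M)%R) by (apply IZR_lt; exact HMz).
set (E := fun (y : R) (z : C) =>
  (theta (moebius g0 z) ^ e1 * theta z ^ e2 -
   theta (moebius g0 z) ^ e2 * theta z ^ e1 * (autj g0 z * (autj g0 z - 2 * Ci * RtoC M * RtoC y))) *
  (theta z * theta (moebius g0 z))).
assert (HE : forall y z, (0 < y)%R -> upper_half_plane z -> E y z = 0).
{ intros y [x1 y1] Hy Hz. unfold upper_half_plane in Hz; simpl in Hz.
  assert (Hd : (0 < Rmin y y1)%R) by now apply Rmin_pos.
  assert (HV := vanishing_propagates (fun t => E y (descent x1 y y1 t))).
  lapply HV; [clear HV; intros HV|].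
  - lapply HV; [clear HV; intros HV|].
    + cbv beta in HV. rewrite descent_pair in HV.
      replace (((x1 + (y - y1) * 0)%R, (y + (y - y1) * -1)%R) : C) with ((x1, y1) : C) in HV by (f_equal; ring). exact HV.
    + intros p _. rewrite descent_pair. set (z := (((x1 + (y - y1) * p)%R, (y + (y - y1) * 0)%R) : C)).
      assert (Ez : Im z = y) by (unfold z; simpl; ring).
      assert (Hz' : upper_half_plane z) by (unfold upper_half_plane; now rewrite Ez).
      unfold E. destruct (classic (theta z = 0)) as [H1|H1]; [rewrite H1; ring|].
      destruct (classic (theta (moebius g0 z) = 0)) as [H2|H2]; [rewrite H2; ring|].
      rewrite (theta_power_relation z Hz' H1 H2), Ez. ring.
  - assert (UT := unif_holo_theta model_rect (descent x1 y y1) _ Hd (fun t _ => descent_cdiff x1 y y1 t) (descent_im x1 y y1)).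
    assert (UG := unif_holo_theta_moebius (descent x1 y y1) _ Hd (fun t _ => descent_cdiff x1 y y1 t) (descent_im x1 y y1)).
    assert (UJ : unif_holo model_rect (fun t => autj g0 (descent x1 y y1 t) * (autj g0 (descent x1 y y1 t) - 2 * Ci * RtoC M * RtoC y))).
    { apply unif_holo_model_rect. intros t _. destruct (descent_cdiff x1 y y1 t) as [l Hl]. unfold autj. cdiff; exact Hl. }
    unfold E.
    exact (unif_holo_mult _ _ _ (unif_holo_minus _ _ _ (unif_holo_mult _ _ _ (unif_holo_pow _ _ e1 UG) (unif_holo_pow _ _ e2 UT))
      (unif_holo_mult _ _ _ (unif_holo_mult _ _ _ (unif_holo_pow _ _ e2 UG) (unif_holo_pow _ _ e1 UT)) UJ)) (unif_holo_mult _ _ _ UT UG)). }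
apply theta_orbit_not_all_zero. intros z Hz.
assert (Hj : autj g0 z <> 0) by now apply autj_g0_nz.
assert (H1 := HE 1%R z ltac:(lra) Hz). assert (H2 := HE 2%R z ltac:(lra) Hz). unfold E in H1, H2.
destruct (classic (theta z = 0)) as [T1|T1]; [now left|]. right.
destruct (classic (theta (moebius g0 z) = 0)) as [T2|T2]; [exact T2|exfalso].
set (t := theta z) in *. set (u := theta (moebius g0 z)) in *. set (j := autj g0 z) in *.
assert (HMC : RtoC M <> 0) by (intros X; apply RtoC_inj in X; lra).
assert (HCi : Ci <> 0) by (intros X; apply (f_equal Im) in X; unfold Ci, RtoC in X; simpl in X; lra).
assert (E2 : RtoC 2 <> 0) by (intros X; apply RtoC_inj in X; lra).
assert (HX : u ^ e2 * t ^ e1 * j * (2 * Ci * RtoC M) * (t * u) <> 0).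
{ repeat apply Cmult_neq_0; auto using Cpow_nz. }
apply HX.
transitivity ((u ^ e1 * t ^ e2 - u ^ e2 * t ^ e1 * (j * (j - 2 * Ci * RtoC M * 2))) * (t * u) -
  (u ^ e1 * t ^ e2 - u ^ e2 * t ^ e1 * (j * (j - 2 * Ci * RtoC M * 1))) * (t * u)); [ring|].
rewrite H1, H2. ring.
Qed.
End ConstantTerm.

(** * Forms with vanishing holomorphic part *)

Theorem theorem6p3 (N : nat) (hN : (0 < N)%nat) (k : R)
  (hk : exists m : Z, k = (1 / 2 + IZR m)%R) :
  ~ exists g gp : C -> C,
      harmonic_weak_Maass (2 - k) (4 * N) g /\
      (exists z : C, upper_half_plane z /\ g z <> 0) /\
      is_holomorphic_part (2 - k) g gp /\
      (forall z : C, upper_half_plane z -> gp z = 0).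
Proof.
intros [g [gp [Hg [[z0 [Hz0 Hnz]] [[hm [_ [[B [am [HB Hexp]]] Hdec]]] Hgp]]]]].
destruct hk as [m ->].
replace (2 - (1 / 2 + IZR m))%R with (3 / 2 - IZR m)%R in * by field.
assert (Hgm : forall z, upper_half_plane z -> g z = hm z).
{ intros z Hz. rewrite Hdec, Hgp by exact Hz. ring. }
destruct (B_profile_exists m) as [Psi [C0 [KP [JP HPsi]]]].
destruct (nonholomorphic_expansion_ext m Psi C0 KP JP B am g HPsi HB) as [Ha Hser].
{ intros z Hz. rewrite (Hgm z Hz). now apply Hexp. }
set (Mz := Z.of_nat (4 * N)). assert (HMz : (0 < Mz)%Z) by (unfold Mz; lia).
assert (Hmod : forall z, upper_half_plane z -> slash (3 / 2 - IZR m) g (Mat2 1 0 Mz 1) z = g z).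
{ intros z Hz. apply (hwm_modular _ _ _ Hg); [|exact Hz]. split; [unfold SL2Z; simpl; lia|apply Z.divide_refl]. }
set (e1 := Z.to_nat (3 - 2 * m)). set (e2 := Z.to_nat (2 * m - 3)).
assert (He : (Z.of_nat e1 - Z.of_nat e2 = 3 - 2 * m)%Z) by (unfold e1, e2; lia).
assert (Hzero := coefficients_zero m Psi C0 KP JP HPsi am Ha (am 0%Z) g Hser Mz HMz e1 e2 He Hmod).
assert (Hg0 : forall z, upper_half_plane z -> g z = am 0%Z * zpow (RtoC (sqrt (Im z))) (2 * m - 1)).
{ intros z Hz. apply (is_Zseries_unique _ _ _ (Hser z Hz)).
  apply (is_Zseries_delta (fun n => ext_term m Psi am (am 0%Z) n (RtoC (sqrt (Im z))) z)).
  intros n Hn. unfold ext_term. destruct (Z.eq_dec n 0) as [|_]; [contradiction|]. rewrite (Hzero n Hn). ring. }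
destruct (classic (am 0%Z = 0)) as [H0|H0].
- apply Hnz. rewrite (Hg0 z0 Hz0), H0. ring.
- exact (constant_term_impossible Mz HMz m e1 e2 He _ g H0 Hg0 Hmod).
Qed.
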